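(* Let $G=G(m,p,N)$ with $m\ge2$, $p\mid m$ (and $p=1$ if $N=1$), and let $$\pi:=x^{(m/p-1)v}a_\delta=(x_1\cdots x_N)^{m/p-1}\prod_{1\le i<j\le N}(x_i^m-x_j^m).$$ Let $1$ denote the parameter tuple, in the normalization $k=(k_{C,i})$, all of whose entries are equal to $1$. For all $G$-invariant polynomials $f,g\in P^G$ we have $$(\pi f,\pi g)_k=(\pi,\pi)_k\,(f,g)_{k+1}.$$
   Context: $G(m,p,N)\subset U(N)$ is the group of $N\times N$ permutation matrices with nonzero entries replaced by $m$-th roots of unity whose product is an $(m/p)$-th root of unity. $P=\mathbb{C}[x_1,\dots,x_N]$; $G$ acts by linear substitutions of the variables ($gp(x)=p(xg)$), and $P^G$ is the ring of invariants. $v=(1,\dots,1)$. Let $\eta=e^{2\pi\mathrm{i}/m}$; $w\in S_N$ acts by $w(x^\alpha)=x^{w\alpha}$, $(w\alpha)_i=\alpha_{w^{-1}(i)}$; $(i,j)$ is the transposition; $\tau_ix^\alpha=\eta^{\alpha_i}x^\alpha$. For a tuple $(\kappa_0,\dots,\kappa_{m-1})$, $$T_i=\frac{\partial}{\partial x_i}+\kappa_0\sum_{j\ne i}\sum_{s=0}^{m-1}\frac{1-\tau_i^{-s}(i,j)\tau_i^s}{x_i-\eta^sx_j}+\sum_{t=1}^{m-1}\kappa_t\sum_{s=0}^{m-1}\frac{\eta^{-st}\tau_i^s}{x_i}$$ (divisions after applying numerators). For $G(m,p,N)$ one requires $\kappa_{sm/p}=0$ and $\kappa_{t+sm/p}=\kappa_t$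 for $1\le s\le p-1$, $1\le t\le\frac mp-1$, so the free parameters are $\kappa_0,\kappa_1,\dots,\kappa_{m/p-1}$. Normalization $k=(k_{C,i})$: the reflection hyperplanes are the hyperplanes $x_i=\eta^lx_j$ ($i<j$), forming the class $C_0$ (with $e_{C_0}=2$), and, if $p<m$, the hyperplanes $x_i=0$, forming the class $C_1$ (with $e_{C_1}=m/p$). Then $k_{C_0,1}=\kappa_0$ and $k_{C_1,i}=p\,\kappa_i$ for $1\le i\le\frac mp-1$. Thus $k\mapsto k+1$ corresponds to $\kappa_0\mapsto\kappa_0+1$ and $\kappa_i\mapsto\kappa_i+\frac1p$ for $1\le i\le\frac mp-1$ (extended periodically). If $p=m$ only $C_0$ occurs, if $N=1$ only $C_1$ occurs. The $T_i$ commute, and the pairing is $(f,g)_k=f^*(T)g(x)|_{x=0}$, where $f^*$ is $f$ with conjugated coefficients and $f^*(T)$ is obtained by substituting $T_i$ (at parameter $k$) for $x_i$. *)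

(* Defs.v *)
From HB Require Import structures.
From mathcomp Require Import all_boot all_order all_algebra all_fingroup.
From mathcomp Require Import complex mpoly.
From mathcomp Require Import boolp classical_sets reals.
(* [trigo] is not imported: its notations clash with those of [mpoly]. *)
From mathcomp Require trigo.

Set Implicit Arguments.
Unset Strict Implicit.
Unset Printing Implicit Defensive.

Import GRing.Theory Num.Theory.
Local Open Scope ring_scope.
Local Open Scope classical_set_scope.
Local Open Scope complex_scope.

(* The complex numbers are [R[i]], for [R] any model of the real numbers. *)

Definition eta (R : realType) (m : nat) : R[i] :=
  trigo.cos (2 * trigo.pi / m%:R) +i* trigo.sin (2 * trigo.pi / m%:R).

Definition in_G (R : realType) (m p N : nat) (g : 'M[R[i]]_N) : Prop :=
  exists (s : 'S_N) (a : 'I_N -> R[i]),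
    [/\ forall i, a i ^+ m = 1,
        (\prod_(i < N) a i) ^+ (m %/ p) = 1 &
        g = \matrix_(i, j) (if j == s i then a i else 0)].

(* [(g f)(x) = f (x g)], where [x] is the row vector of the variables. *)
Definition G_act (R : realType) (N : nat) (g : 'M[R[i]]_N)
    (f : {mpoly R[i][N]}) : {mpoly R[i][N]} :=
  f \mPo [tuple \sum_(i < N) g i j *: 'X_i | j < N].

Definition G_invariant (R : realType) (m p N : nat) (f : {mpoly R[i][N]}) :
    Prop :=
  forall g : 'M[R[i]]_N, in_G m p g -> G_act g f = f.

(* [tau m s i] is the power [tau_i ^ s]: it maps ['X_[a]] to
   [eta ^ (s * a i) *: 'X_[a]]. *)
Definition tau (R : realType) (m : nat) (s : int) (N : nat) (i : 'I_N)
    (f : {mpoly R[i][N]}) : {mpoly R[i][N]} :=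
  \sum_(a <- msupp f) (eta R m ^ (s * (a i)%:Z) * f@_a) *: 'X_[a].

(* The quotient of [q] by [d] when [d] divides [q] (unique if [d != 0]), and
   the junk value 0 otherwise. All the divisions in [dunkl] below are exact. *)
Definition exact_quo (R : realType) (N : nat) (q d : {mpoly R[i][N]}) :
    {mpoly R[i][N]} :=
  xget 0 [set r | r * d = q].

(* Only [kap 0], ..., [kap m.-1] are used. *)
Definition dunkl (R : realType) (m : nat) (kap : nat -> R[i]) (N : nat)
    (i : 'I_N) (f : {mpoly R[i][N]}) : {mpoly R[i][N]} :=
  f^`M(i)
  + kap 0%N *: (\sum_(j < N | j != i) \sum_(0 <= s < m)
      exact_quo (f - tau m (- s%:Z) i (msym (tperm i j) (tau m s%:Z i f)))
                ('X_i - eta R m ^+ s *: 'X_j))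
  + \sum_(1 <= t < m) kap t *:
      exact_quo (\sum_(0 <= s < m) eta R m ^ (- (s * t)%:Z) *: tau m s%:Z i f)
                'X_i.

(* The parameters [k_{C_0,1}] and [k_{C_1,i}]; the values [kC1 i] matter only
   for [1 <= i <= m/p - 1]. *)
Record multiplicity (R : realType) := Multiplicity {
  kC0 : R[i];
  kC1 : nat -> R[i]
}.

Definition mult_add1 (R : realType) (k : multiplicity R) : multiplicity R :=
  Multiplicity (kC0 k + 1) (fun i => kC1 k i + 1).

(* The tuple [kappa] attached to [k] for [G(m,p,N)]: it vanishes at the positive
   multiples of [m/p], is [m/p]-periodic at the other positive indices, and
   [k_{C_1,i} = p * kappa_i]. *)
Definition kappa (R : realType) (m p : nat) (k : multiplicity R) (t : nat) :
    R[i] :=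
  if t == 0%N then kC0 k
  else if (m %/ p %| t)%N then 0
  else kC1 k (t %% (m %/ p))%N / p%:R.

(* [f(T)]: the operator [T i] is substituted for the variable ['X_i]. For
   non-commuting operators the factors would be taken in the order of ['I_N]. *)
Definition subst_op (R : realType) (N : nat)
    (T : 'I_N -> {mpoly R[i][N]} -> {mpoly R[i][N]})
    (f g : {mpoly R[i][N]}) : {mpoly R[i][N]} :=
  \sum_(a <- msupp f)
    f@_a *: foldr (fun i h => iter (a i) (T i) h) g (enum 'I_N).

Definition pairing (R : realType) (m p N : nat) (k : multiplicity R)
    (f g : {mpoly R[i][N]}) : R[i] :=
  (subst_op (fun i => dunkl m (kappa m p k) i) (map_mpoly Num.conj f) g).@[fun=> 0].

Definition piG (R : realType) (m p N : nat) : {mpoly R[i][N]} :=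
  (\prod_(i < N) 'X_i) ^+ (m %/ p - 1) *
  \prod_(i < N) \prod_(j < N | (i < j)%N) ('X_i ^+ m - 'X_j ^+ m).

(* Main.v *)
(** Write [q = m/p], let [a] be the Vandermonde determinant, let [c = kappa_0], and let
    [Psi h = h(x_1^m, ..., x_N^m)]. An invariant of [G(m,p,N)] is a sum over
    [0 <= j < p] of [x^(jqv) Psi(s_j)] with [s_j] symmetric, and
    [pi = x^((q-1)v) Psi(a)].

    On functions [x^(bv) Psi h] with [b < m] the operator [T_i^m] is
    [m^m P_b(R_i) D_i] acting on [h], where [D_i] are the type A Dunkl operators at
    parameter [c], [R_i = D_i x_i], and [P_b] is a polynomial of degree [m-1]
    depending on [kappa]. For [b = jq+q-1] at parameter [k] and [b = jq] at parameter
    [k+1] these polynomials coincide. In type A, for [h] symmetric,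
    [sum_i R_i^n D_i (a h)] at parameter [c] is [a] times [sum_i R_i^n D_i h] at
    [c+1]: commutation with the Cherednik-Opdam quadratic Hamiltonian raises [n]
    by one. Together with the commutator of [sum_i T_i x_i T_i^m] with the power sums
    in the [T_i^m], this shows that every symmetric polynomial in the [T_i^m] acts on
    [pi x^(jqv) Psi h] at [k] as it acts on [x^(jqv) Psi h] at [k+1].

    The product [T_1 ... T_N] multiplies [x^((b+1)v) Psi g], for [g = 1] or [g = a],
    by a scalar and lowers [b+1] to [b]; the scalars at [(k, a)] and [(k+1, 1)] agree
    up to order over a block of [q] consecutive exponents. Hence both pairings of the
    components [x^(iqv) Psi s] and [x^(jqv) Psi t] vanish for [i <> j] (they have
    different weights under the diagonal matrices) and are proportional with factor
    [(pi, pi)_k] for [i = j]. *)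

Require Import Defs.
From HB Require Import structures.
From mathcomp Require Import all_boot all_order all_algebra all_fingroup.
From mathcomp Require Import complex mpoly reals ring lra zify.
(* [trigo] and [classical_sets] clash with the notations of [mpoly] and [finset]. *)
From mathcomp Require trigo classical_sets.
Import Defs.

Set Implicit Arguments.
Unset Strict Implicit.
Unset Printing Implicit Defensive.

Import Order.TTheory GRing.Theory Num.Theory.
Local Open Scope ring_scope.

(** * Roots of unity and monomial substitutions *)

Section PrimitiveRoot.
Variable R : realType.

(** For r >= 2 the operator induced by T_i^(m r) on h lowers the degree of h by r, so it is not of
    the form Q(R_i) D_i and the type A formula does not apply to it. Only p_1(T^m) and sum_i T_i x_i
    T_i^m have that form. The commutator of the latter with p_r(T^m) is a multiple of p_(r+1)(T^m),
    which yields the remaining power sums. In type A the obstacle is that the R_i do not commute and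
    that R_k^n D_k h is not symmetric for a single k. The quadratic Hamiltonian is therefore lifted
    to an operator on equivariant families (v_k) that commutes with v_k |-> R_k v_k; it is
    identified with the Hamiltonian only after summation over k. Conjugation by a carries the
    Hamiltonian at c to the one at c + 1 up to an additive constant, which a commutator does not
    see. The operators are built over any field with a chosen primitive root. Type A is the case of
    order 1, so commutativity and equivariance are proved once for both. *)

Lemma eta_exp (m k : nat) : eta R m ^+ k =
  (trigo.cos (k%:R * (2 * trigo.pi / m%:R)) +i* trigo.sin (k%:R * (2 * trigo.pi / m%:R)))%C.
Proof.
elim: k => [|k IH]; first by rewrite expr0 mul0r trigo.cos0 trigo.sin0.
have ek : k.+1%:R = k%:R + 1 :> R by rewrite natr1.
rewrite exprS IH /eta ek (mulrDl k%:R) mul1r trigo.cosD trigo.sinD.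
by apply/eqP; rewrite eq_complex /=; apply/andP; split; apply/eqP; ring.
Qed.

(** Write the angle of eta^k as 2 theta with theta = k pi / m. For 0 < k < m the sine of theta is
    positive, so cos(2 theta) = 1 - 2 sin(theta)^2 is not 1. *)
Lemma eta_prim (m : nat) : (0 < m)%N -> m.-primitive_root (eta R m).
Proof.
move=> m0; have mr0 : (m%:R : R) != 0 by rewrite pnatr_eq0 -lt0n.
apply/andP; split=> //; apply/forallP => i.
rewrite unity_rootE; apply/eqP.
have pi0 := trigo.pi_gt0 R.
have eqx k : k%:R * (2 * trigo.pi / m%:R) = (k%:R * trigo.pi / m%:R) *+ 2 :> R.
  by rewrite mulr2n; field.
rewrite eta_exp eqx; case: (i.+1 =P m) => [e|ne].
  rewrite e mulrAC divff // mul1r trigo.cos2pi trigo.sin2pi.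
  by rewrite eqxx.
have ltim : (i.+1 < m)%N.
  by move: (ltn_ord i); rewrite leq_eqVlt => /orP[/eqP|].
apply/negbTE/eqP => /eqP; rewrite eq_complex /= => /andP[/eqP h _].
have s0 : 0 < trigo.sin ((i.+1)%:R * trigo.pi / m%:R : R).
  apply: trigo.sin_gt0_pi; apply/andP; split.
    by rewrite divr_gt0 ?mulr_gt0 ?ltr0n.
  rewrite ltr_pdivrMr ?ltr0n // mulrC ltr_pM2l //.
  by rewrite ltr_nat.
move: h; rewrite trigo.cos_mulr2n trigo.cos2sin2 => h.
have : trigo.sin ((i.+1)%:R * trigo.pi / m%:R : R) ^+ 2 = 0 by lra.
by move/eqP; rewrite expf_eq0 /= => /eqP s00; rewrite s00 ltxx in s0.
Qed.

End PrimitiveRoot.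

(** Bundling the root with its order lets the same operators be used at order m and at order 1. *)
Record primroot (C : fieldType) (m : nat) :=
  Primroot { primroot_val :> C; primrootP : m.-primitive_root primroot_val }.

(** Suited to operators known through their commutators with the variables: only constants and the
    passage from f to ['X_l * f] remain to be treated. *)
Lemma mpoly_ind_mulX (C : comRingType) (N : nat) (P : {mpoly C[N]} -> Prop) :
  (forall c, P c%:MP) -> (forall f g, P f -> P g -> P (f + g)) ->
  (forall l f, P f -> P ('X_l * f)) -> forall f, P f.
Proof.
move=> Pc PD PX f.
have PM m : forall c, P (c *: 'X_[m]).
  have [d] := ubnP (mdeg m); elim: d m => // d IH m ltd c.
  have [->|m0] := eqVneq m 0%MM.
    by rewrite mpolyX0 -mul_mpolyC mulr1.
  have [i mi] : exists i, m i != 0%N.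
    apply/existsP; apply: contraR m0; rewrite negb_exists => /forallP h.
    by apply/eqP/mnmP => i; rewrite mnm0E; apply/eqP; move: (h i); rewrite negbK.
  have -> : m = (U_(i) + (m - U_(i)))%MM by rewrite addmC submK // lep1mP.
  rewrite mpolyXD scalerAr; apply: PX; apply: IH.
  have: mdeg m = (mdeg U_(i) + mdeg (m - U_(i)))%N.
    by rewrite -mdegD addmC submK // lep1mP.
  by rewrite mdeg1 add1n => e; move: ltd; rewrite e ltnS.
rewrite (mpolyE f); elim: (msupp f) => [|m s IH].
  by rewrite big_nil -mpolyC0.
by rewrite big_cons; apply: PD.
Qed.

Lemma mpoly_lrmorph_ext (C : comRingType) (N : nat) (A : algType C)
    (F G : {lrmorphism {mpoly C[N]} -> A}) :
  (forall l, F 'X_l = G 'X_l) -> F =1 G.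
Proof.
move=> FG; apply: mpoly_ind_mulX => [c|f g hf hg|l f hf].
- by rewrite -alg_mpolyC !linearZ /= !rmorph1.
- by rewrite !raddfD /= hf hg.
- by rewrite !rmorphM /= hf FG.
Qed.

(* The operators are locked: on closed terms, unification would unfold them down to
   the representation of polynomials. *)
HB.lock Definition gsub (C : comRingType) (N : nat) (a : 'I_N -> C) (w : 'S_N) :
    {mpoly C[N]} -> {mpoly C[N]} :=
  comp_mpoly [tuple (a i *: 'X_(w i) : {mpoly C[N]}) | i < N].

Section GsubMorphism.
Variables (C : comRingType) (N : nat) (a : 'I_N -> C) (w : 'S_N).

Lemma gsub_is_linear : linear (gsub a w).
Proof. by move=> c f g; rewrite gsub.unlock linearP. Qed.

Lemma gsub_is_monoid_morphism : monoid_morphism (gsub a w).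
Proof. by rewrite gsub.unlock; split; [exact: rmorph1|exact: rmorphM]. Qed.

HB.instance Definition _ :=
  GRing.isLinear.Build C {mpoly C[N]} {mpoly C[N]} _ (gsub a w) gsub_is_linear.
HB.instance Definition _ :=
  GRing.isMonoidMorphism.Build {mpoly C[N]} {mpoly C[N]} (gsub a w) gsub_is_monoid_morphism.

End GsubMorphism.

Section Gsub.
Variables (C : comRingType) (N : nat).
Implicit Types (a b : 'I_N -> C) (w u : 'S_N) (f g : {mpoly C[N]}).

Lemma gsubX a w l : gsub a w 'X_l = a l *: 'X_(w l).
Proof. by rewrite gsub.unlock comp_mpolyXU -tnth_nth tnth_mktuple. Qed.

Lemma gsubC a w c : gsub a w c%:MP = c%:MP.
Proof. by rewrite gsub.unlock; exact: comp_mpolyC. Qed.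

Lemma gsub_comp a w b u f :
  gsub a w (gsub b u f) = gsub (fun l => b l * a (u l)) (u * w)%g f.
Proof.
suff : (gsub a w \o gsub b u : {lrmorphism _ -> _}) =1 gsub (fun l => b l * a (u l)) (u * w)%g.
  exact.
apply: mpoly_lrmorph_ext => l /=.
by rewrite !gsubX linearZ /= gsubX scalerA permM.
Qed.

Lemma eq_gsub a b w : a =1 b -> gsub a w =1 gsub b w.
Proof.
by move=> ab; apply: mpoly_lrmorph_ext => l /=; rewrite !gsubX ab.
Qed.

Lemma msym_gsub w : msym w =1 gsub (fun=> 1) w :> ({mpoly C[N]} -> _).
Proof.
suff : (msym w : {lrmorphism {mpoly C[N]} -> {mpoly C[N]}}) =1 gsub (fun=> 1) w by [].
apply: mpoly_lrmorph_ext => l /=; rewrite gsubX scale1r msymX.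
congr 'X_[_]; apply/mnmP => j; rewrite mnmE !mnm1E.
by rewrite -(inj_eq (@perm_inj _ w)) permKV.
Qed.

Lemma gsub_mon a w m :
  gsub a w 'X_[m] = (\prod_i a i ^+ m i) *: msym w 'X_[m].
Proof.
rewrite mpolyXE_id !rmorph_prod -scaler_prod; apply: eq_bigr => i _ /=.
by rewrite !rmorphXn /= msym_gsub !gsubX scale1r exprZn.
Qed.

End Gsub.

Section Roots.
Variables (C : fieldType) (m : nat) (zeta : primroot C m).
Local Notation eta := (primroot_val zeta).
Let zetaP := primrootP zeta.

Lemma primroot_gt0 : (0 < m)%N.
Proof. exact: prim_order_gt0 zetaP. Qed.

Lemma primroot_neq0 s : eta ^+ s != 0.
Proof. by rewrite expf_neq0 // (prim_root_eq0 zetaP) -lt0n primroot_gt0. Qed.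
Let m0 := primroot_gt0.

Lemma primroot_expm : eta ^+ m = 1.
Proof. exact: prim_expr_order zetaP. Qed.

Lemma primroot_exp_root (s : nat) : (eta ^+ s) ^+ m = 1.
Proof. by rewrite exprAC primroot_expm expr1n. Qed.

Lemma sum_roots_shift (V : nmodType) (F : C -> V) (z : C) : z ^+ m = 1 ->
  \sum_(0 <= s < m) F (z * eta ^+ s) = \sum_(0 <= s < m) F (eta ^+ s).
Proof.
move=> /(prim_rootP zetaP) [k ->].
rewrite !big_mkord.
have lt (s : 'I_m) : ((k + s) %% m < m)%N by rewrite ltn_pmod.
have inj : injective (fun s : 'I_m => Ordinal (lt s)).
  move=> s t /(congr1 val) /= /eqP.
  by rewrite eqn_modDl !modn_small // => /eqP e; apply: val_inj.
rewrite [RHS](reindex_inj inj) /=; apply: eq_bigr => s _.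
by rewrite (prim_expr_mod zetaP) exprD.
Qed.

Lemma sum_roots_inv (V : nmodType) (F : C -> V) :
  \sum_(0 <= s < m) F (eta ^+ s)^-1 = \sum_(0 <= s < m) F (eta ^+ s).
Proof.
rewrite !big_mkord.
have lt (s : 'I_m) : ((m - s) %% m < m)%N by rewrite ltn_pmod.
have inj : injective (fun s : 'I_m => Ordinal (lt s)).
  have modE (s : 'I_m) : ((m - s) %% m = if s == 0 :> nat then 0 else m - s)%N.
    case: eqP => [->|/eqP s0]; first by rewrite subn0 modnn.
    by rewrite modn_small // ltn_subrL lt0n s0.
  move=> s t /(congr1 val) /=; rewrite !modE => e; apply: val_inj => /=.
  have := ltn_ord s; have := ltn_ord t.
  by move: e; case: eqP; case: eqP; lia.
rewrite [RHS](reindex_inj inj) /=; apply: eq_bigr => s _; congr F.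
rewrite (prim_expr_mod zetaP).
apply: (mulfI (primroot_neq0 s)); rewrite mulfV ?primroot_neq0 //.
by rewrite -exprD subnKC ?primroot_expm // ltnW.
Qed.

Lemma sum_roots_exp (n : nat) :
  \sum_(0 <= s < m) (eta ^+ s) ^+ n = if (m %| n)%N then m%:R else 0.
Proof.
case: ifP => mn.
  under eq_bigr => s _ do
    rewrite exprAC (eqP (_ : eta ^+ n == 1)) -?(prim_order_dvd zetaP) // expr1n.
  by rewrite big_const_nat iter_addr_0 subn0.
set S := LHS.
have h : eta ^+ n * S = S.
  rewrite /S -[RHS](sum_roots_shift (fun z => z ^+ n) primroot_expm) mulr_sumr.
  by apply: eq_bigr => s _; rewrite exprMn.
have /eqP : (eta ^+ n - 1) * S = 0 by rewrite mulrBl mul1r h subrr.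
rewrite mulf_eq0 subr_eq0 -(prim_order_dvd zetaP) mn /=.
by move/eqP.
Qed.

End Roots.

(** Convertible with [exact_quo], but over an arbitrary field. *)
Definition mquo (C : fieldType) (N : nat) (q d : {mpoly C[N]}) : {mpoly C[N]} :=
  classical_sets.xget 0 (fun r => r * d = q).

Section ExactQuo.
Variables (C : fieldType) (N : nat).
Local Notation P := {mpoly C[N]}.

Lemma mquoE (q d r : P) : d != 0 -> r * d = q -> mquo q d = r.
Proof.
move=> d0 e; apply: classical_sets.xget_unique => //= r' e'.
by apply: (mulIf d0); rewrite e e'.
Qed.

Lemma mquoP (q d : P) : (exists r, r * d = q) -> mquo q d * d = q.
Proof. exact: (@classical_sets.xgetPex _ 0 (fun r => r * d = q)). Qed.

End ExactQuo.

(** The reflection in the hyperplane x_i = z x_j; for z = eta^s it is tau_i^(-s) (i,j) tau_i^s, see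
    [tau_refl]. *)
HB.lock Definition refl (C : fieldType) (N : nat) (z : C) (i j : 'I_N) :
    {mpoly C[N]} -> {mpoly C[N]} :=
  gsub (fun l => if l == i then z else if l == j then z^-1 else 1) (tperm i j).

HB.lock Definition dil (C : fieldType) (N : nat) (z : C) (i : 'I_N) :
    {mpoly C[N]} -> {mpoly C[N]} :=
  gsub (fun l => if l == i then z else 1) 1%g.

HB.lock Definition ddiff (C : fieldType) (N : nat) (z : C) (i j : 'I_N)
    (f : {mpoly C[N]}) : {mpoly C[N]} :=
  mquo (f - refl z i j f) ('X_i - z *: 'X_j).

HB.lock Definition dilquo (C : fieldType) (m : nat) (zeta : primroot C m) (N t : nat) (i : 'I_N)
    (f : {mpoly C[N]}) : {mpoly C[N]} :=
  mquo (\sum_(0 <= s < m) (primroot_val zeta ^+ s) ^- t *: dil (primroot_val zeta ^+ s) i f) 'X_i.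

Section ReflMorphism.
Variables (C : fieldType) (N : nat) (z : C) (i j : 'I_N).

Lemma refl_is_linear : linear (refl z i j : {mpoly C[N]} -> _).
Proof. by move=> c f g; rewrite refl.unlock linearP. Qed.

Lemma refl_is_monoid_morphism : monoid_morphism (refl z i j : {mpoly C[N]} -> _).
Proof. by rewrite refl.unlock; split; [exact: rmorph1|exact: rmorphM]. Qed.

HB.instance Definition _ :=
  GRing.isLinear.Build C {mpoly C[N]} {mpoly C[N]} _ (refl z i j) refl_is_linear.
HB.instance Definition _ :=
  GRing.isMonoidMorphism.Build {mpoly C[N]} {mpoly C[N]} (refl z i j) refl_is_monoid_morphism.

End ReflMorphism.

Section DilMorphism.
Variables (C : fieldType) (N : nat) (z : C) (i : 'I_N).

Lemma dil_is_linear : linear (dil z i : {mpoly C[N]} -> _).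
Proof. by move=> c f g; rewrite dil.unlock linearP. Qed.

Lemma dil_is_monoid_morphism : monoid_morphism (dil z i : {mpoly C[N]} -> _).
Proof. by rewrite dil.unlock; split; [exact: rmorph1|exact: rmorphM]. Qed.

HB.instance Definition _ :=
  GRing.isLinear.Build C {mpoly C[N]} {mpoly C[N]} _ (dil z i) dil_is_linear.
HB.instance Definition _ :=
  GRing.isMonoidMorphism.Build {mpoly C[N]} {mpoly C[N]} (dil z i) dil_is_monoid_morphism.

End DilMorphism.

Section Divided.
Variables (C : fieldType) (N : nat).
Local Notation P := {mpoly C[N]}.

Lemma reflX (z : C) (i j l : 'I_N) : refl z i j 'X_l =
  (if l == i then z else if l == j then z^-1 else 1) *: 'X_(tperm i j l) :> P.
Proof. by rewrite refl.unlock gsubX. Qed.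

Lemma dilX (z : C) (i l : 'I_N) : dil z i 'X_l = (if l == i then z else 1) *: 'X_l :> P.
Proof. by rewrite dil.unlock gsubX perm1. Qed.

Lemma reflC (z : C) (i j : 'I_N) c : refl z i j c%:MP = c%:MP :> P.
Proof. by rewrite refl.unlock gsubC. Qed.

Lemma dilC (z : C) (i : 'I_N) c : dil z i c%:MP = c%:MP :> P.
Proof. by rewrite dil.unlock gsubC. Qed.

Lemma root_neq0 (z : C) (i j : 'I_N) : i != j -> 'X_i - z *: 'X_j != 0 :> P.
Proof.
move=> ij; apply/eqP => /(congr1 (mcoeff U_(i))).
rewrite mcoeffB mcoeffZ !mcoeffX mcoeff0 eqxx !eq_mnm1 [j == i]eq_sym (negbTE ij).
by rewrite mulr0 subr0 => /eqP; rewrite oner_eq0.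
Qed.

Lemma X_neq0 (i : 'I_N) : 'X_i != 0 :> P.
Proof.
by apply/eqP => /(congr1 (mcoeff U_(i))) /eqP; rewrite mcoeffX mcoeff0 eqxx oner_eq0.
Qed.

(** A twisted Leibniz rule reduces the claim to the variables, where x_l minus its reflection is 0
    or a scalar multiple of x_i - z x_j. *)
Lemma ddiff_dvd (z : C) (i j : 'I_N) (f : P) : i != j -> z != 0 ->
  exists r, r * ('X_i - z *: 'X_j) = f - refl z i j f.
Proof.
move=> ij z0; elim/mpoly_ind_mulX: f => [c|f g [r1 h1] [r2 h2]|l f [r h]].
- by exists 0; rewrite reflC mul0r subrr.
- by exists (r1 + r2); rewrite mulrDl h1 h2 rmorphD opprD addrACA.
rewrite rmorphM /= reflX; rewrite -!mul_mpolyC in h *.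
case: (l =P i) => [->|/eqP li].
  exists (f + (z%:MP * 'X_j) * r); rewrite mulrDl -mulrA.
  by rewrite h tpermL; ring.
case: (l =P j) => [->|/eqP lj].
  exists ('X_j * r - (z^-1)%:MP * refl z i j f).
  have zz : z%:MP * (z^-1)%:MP = 1 :> P by rewrite -mpolyCM mulfV.
  rewrite tpermR.
  transitivity ('X_j * (r * ('X_i - z%:MP * 'X_j)) - (z^-1)%:MP * refl z i j f * 'X_i
    + z%:MP * (z^-1)%:MP * refl z i j f * 'X_j : P); first by ring.
  by rewrite h zz; ring.
exists ('X_l * r); rewrite -mulrA h tpermD // 1?eq_sym //.
by rewrite mpolyC1; ring.
Qed.

Lemma ddiffP (z : C) (i j : 'I_N) (f : P) : i != j -> z != 0 ->
  ddiff z i j f * ('X_i - z *: 'X_j) = f - refl z i j f.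
Proof. by move=> ij z0; rewrite ddiff.unlock; apply/mquoP/ddiff_dvd. Qed.

Lemma ddiffE (z : C) (i j : 'I_N) (f r : P) : i != j ->
  r * ('X_i - z *: 'X_j) = f - refl z i j f -> ddiff z i j f = r.
Proof. by move=> ij; rewrite ddiff.unlock; apply/mquoE/root_neq0. Qed.

Lemma ddiff_linear (z : C) (i j : 'I_N) a (f g : P) : i != j -> z != 0 ->
  ddiff z i j (a *: f + g) = a *: ddiff z i j f + ddiff z i j g.
Proof.
move=> ij z0; apply: ddiffE => //.
have hf := ddiffP f ij z0; have hg := ddiffP g ij z0.
rewrite -!mul_mpolyC in hf hg; rewrite linearP /= -!mul_mpolyC mulrDl -mulrA hf hg; ring.
Qed.

Lemma ddiffM (z : C) (i j : 'I_N) (f g : P) : i != j -> z != 0 ->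
  ddiff z i j (f * g) = ddiff z i j f * g + refl z i j f * ddiff z i j g.
Proof.
move=> ij z0; apply: ddiffE => //.
rewrite mulrDl -mulrA [g * _]mulrC mulrA ddiffP // -mulrA ddiffP // rmorphM /=; ring.
Qed.

End Divided.

(** * Dunkl operators *)

HB.lock Definition dunklT (C : fieldType) (m : nat) (zeta : primroot C m) (kap : nat -> C) (N : nat)
  (i : 'I_N) (f : {mpoly C[N]}) : {mpoly C[N]} :=
  f^`M(i)
  + kap 0%N *: (\sum_(j < N | j != i) \sum_(0 <= s < m) ddiff (primroot_val zeta ^+ s) i j f)
  + \sum_(1 <= t < m) kap t *: dilquo zeta t i f.

(** The commutator of T_i with multiplication by x_l ([dunkl_mulX]). It involves only reflections
    and dilations, so working with it avoids the divided differences. *)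
HB.lock Definition dunkl_com (C : fieldType) (m : nat) (zeta : primroot C m) (kap : nat -> C) (N : nat)
  (i l : 'I_N) (f : {mpoly C[N]}) : {mpoly C[N]} :=
  if l == i then
    f + kap 0%N *: (\sum_(j < N | j != i) \sum_(0 <= s < m) refl (primroot_val zeta ^+ s) i j f)
    + \sum_(1 <= t < m) kap t *: (\sum_(0 <= s < m)
        ((primroot_val zeta ^+ s) ^- t * (primroot_val zeta ^+ s - 1)) *: dil (primroot_val zeta ^+ s) i f)
  else - (kap 0%N *: (\sum_(0 <= s < m) (primroot_val zeta ^+ s)^-1 *: refl (primroot_val zeta ^+ s) i l f)).

Section Dunkl.
Variables (C : fieldType) (m : nat) (zeta : primroot C m) (N : nat).
Local Notation eta := (primroot_val zeta).
Local Notation P := {mpoly C[N]}.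

Hint Extern 0 (is_true (negb (_ == _))) => exact: primroot_neq0 : core.

Lemma dunklTE (kap : nat -> C) (i : 'I_N) (f : P) : dunklT zeta kap i f =
  f^`M(i) + kap 0%N *: (\sum_(j < N | j != i) \sum_(0 <= s < m) ddiff (eta ^+ s) i j f)
  + \sum_(1 <= t < m) kap t *: dilquo zeta t i f.
Proof.
by rewrite dunklT.unlock.
Qed.

Lemma dilquo_dvd t (i : 'I_N) (f : P) : (0 < t < m)%N ->
  exists r, r * 'X_i = \sum_(0 <= s < m) (eta ^+ s) ^- t *: dil (eta ^+ s) i f.
Proof.
move=> /andP[t0 tm].
elim/mpoly_ind_mulX: f => [c|f g [r1 h1] [r2 h2]|l f [r h]].
- exists 0; under eq_bigr => s _ do rewrite dilC.
  rewrite -scaler_suml mul0r.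
  rewrite (eq_bigr (fun s => ((eta ^+ s)^-1) ^+ t)); last by move=> s _; rewrite exprVn.
  rewrite (sum_roots_inv zeta (fun z => z ^+ t)) sum_roots_exp // gtnNdvd //.
  by rewrite scale0r.
- exists (r1 + r2); rewrite mulrDl h1 h2 -big_split; apply: eq_bigr => s _ /=.
  by rewrite rmorphD scalerDr.
case: (l =P i) => [->|/eqP li].
  exists (\sum_(0 <= s < m) ((eta ^+ s) ^- t * eta ^+ s) *: dil (eta ^+ s) i f).
  rewrite mulr_suml; apply: eq_bigr => s _.
  by rewrite rmorphM /= dilX eqxx -!mul_mpolyC mpolyCM; ring.
exists ('X_l * r); rewrite -mulrA h mulr_sumr; apply: eq_bigr => s _.
by rewrite rmorphM /= dilX (negbTE li) scale1r scalerAr.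
Qed.

Lemma dilquoP t (i : 'I_N) (f : P) : (0 < t < m)%N -> dilquo zeta t i f * 'X_i =
  \sum_(0 <= s < m) (eta ^+ s) ^- t *: dil (eta ^+ s) i f.
Proof. by move=> tm; rewrite dilquo.unlock; apply/mquoP/dilquo_dvd. Qed.

Lemma dilquoE t (i : 'I_N) (f r : P) :
  r * 'X_i = \sum_(0 <= s < m) (eta ^+ s) ^- t *: dil (eta ^+ s) i f ->
  dilquo zeta t i f = r.
Proof. by rewrite dilquo.unlock; exact/mquoE/X_neq0. Qed.

Lemma dilquo_linear t (i : 'I_N) a (f g : P) : (0 < t < m)%N ->
  dilquo zeta t i (a *: f + g) = a *: dilquo zeta t i f + dilquo zeta t i g.
Proof.
move=> tm; apply: dilquoE; rewrite mulrDl -scalerAl !dilquoP // scaler_sumr -big_split.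
by apply: eq_bigr => s _ /=; rewrite linearP /= scalerDr !scalerA mulrC.
Qed.

Lemma dunkl_is_linear (kap : nat -> C) (i : 'I_N) : linear (dunklT zeta kap i : P -> P).
Proof.
move=> a f g; rewrite !dunklTE linearP /= !scalerDr.
have -> : \sum_(j < N | j != i) \sum_(0 <= s < m) ddiff (eta ^+ s) i j (a *: f + g) =
    a *: (\sum_(j < N | j != i) \sum_(0 <= s < m) ddiff (eta ^+ s) i j f)
  + \sum_(j < N | j != i) \sum_(0 <= s < m) ddiff (eta ^+ s) i j g.
  rewrite scaler_sumr -big_split; apply: eq_bigr => j ji /=.
  rewrite scaler_sumr -big_split; apply: eq_bigr => s _ /=.
  have ij : i != j by rewrite eq_sym.
  by rewrite ddiff_linear.
have -> : \sum_(1 <= t < m) kap t *: dilquo zeta t i (a *: f + g) =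
    a *: (\sum_(1 <= t < m) kap t *: dilquo zeta t i f)
  + \sum_(1 <= t < m) kap t *: dilquo zeta t i g.
  rewrite scaler_sumr -big_split; apply: eq_big_nat => t tm /=.
  by rewrite dilquo_linear // scalerDr !scalerA mulrC.
by rewrite scalerDr !scalerA [kap 0%N * a]mulrC -!mul_mpolyC; ring.
Qed.

HB.instance Definition _ (kap : nat -> C) (i : 'I_N) :=
  GRing.isLinear.Build C P P _ (dunklT zeta kap i) (dunkl_is_linear kap i).

Lemma ddiffX (z : C) (i j l : 'I_N) : i != j -> z != 0 ->
  ddiff z i j 'X_l = (if l == i then 1 else if l == j then - z^-1 else 0)%:MP :> P.
Proof.
move=> ij z0; apply: ddiffE => //; rewrite reflX -!mul_mpolyC.
case: (l =P i) => [->|/eqP li]; first by rewrite tpermL mpolyC1 mul1r.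
case: (l =P j) => [->|/eqP lj].
  have zz : z%:MP * (z^-1)%:MP = 1 :> P by rewrite -mpolyCM mulfV.
  rewrite tpermR mpolyCN.
  transitivity (z%:MP * (z^-1)%:MP * 'X_j - (z^-1)%:MP * 'X_i : P); first by ring.
  by rewrite zz mul1r.
by rewrite tpermD 1?eq_sym // mpolyC0 mpolyC1; ring.
Qed.

Lemma dilquo_mulX t (i l : 'I_N) (f : P) : (0 < t < m)%N ->
  dilquo zeta t i ('X_l * f) = 'X_l * dilquo zeta t i f +
   (if l == i then \sum_(0 <= s < m)
     ((eta ^+ s) ^- t * (eta ^+ s - 1)) *: dil (eta ^+ s) i f else 0).
Proof.
move=> tm; apply: dilquoE; rewrite mulrDl -mulrA dilquoP //.
case: (l =P i) => [->|/eqP li].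
  rewrite mulr_sumr mulr_suml -big_split; apply: eq_bigr => s _ /=.
  by rewrite rmorphM /= dilX eqxx -!mul_mpolyC mpolyCM mpolyCB mpolyC1; ring.
rewrite mul0r addr0 mulr_sumr; apply: eq_bigr => s _.
by rewrite rmorphM /= dilX (negbTE li) scale1r scalerAr.
Qed.

Lemma dunkl_mulX (kap : nat -> C) (i l : 'I_N) (f : P) :
  dunklT zeta kap i ('X_l * f) = 'X_l * dunklT zeta kap i f + dunkl_com zeta kap i l f.
Proof.
rewrite !dunklTE dunkl_com.unlock mderivM mderivX mnm1E.
have -> : \sum_(j < N | j != i) \sum_(0 <= s < m) ddiff (eta ^+ s) i j ('X_l * f) =
    'X_l * (\sum_(j < N | j != i) \sum_(0 <= s < m) ddiff (eta ^+ s) i j f)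
  + if l == i then \sum_(j < N | j != i) \sum_(0 <= s < m) refl (eta ^+ s) i j f
    else - \sum_(0 <= s < m) (eta ^+ s)^-1 *: refl (eta ^+ s) i l f.
  transitivity ('X_l * (\sum_(j < N | j != i) \sum_(0 <= s < m) ddiff (eta ^+ s) i j f)
    + \sum_(j < N | j != i) \sum_(0 <= s < m)
        (if l == i then 1 else if l == j then - (eta ^+ s)^-1 else 0) *: refl (eta ^+ s) i j f).
    rewrite mulr_sumr -big_split; apply: eq_bigr => j ji /=.
    rewrite mulr_sumr -big_split; apply: eq_bigr => s _ /=.
    by rewrite mulrC ddiffM // 1?eq_sym // ddiffX // 1?eq_sym // -mul_mpolyC; ring.
  congr (_ + _); case: (l =P i) => [_|/eqP li].
    by apply: eq_bigr => j _; apply: eq_bigr => s _; rewrite scale1r.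
  rewrite (bigD1 l) //= eqxx [X in _ + X]big1 ?addr0.
    by rewrite -sumrN; apply: eq_bigr => s _; rewrite scaleNr.
  move=> j /andP[_ jl]; rewrite eq_sym (negbTE jl).
  by apply: big1 => s _; rewrite scale0r.
have -> : \sum_(1 <= t < m) kap t *: dilquo zeta t i ('X_l * f) =
    'X_l * (\sum_(1 <= t < m) kap t *: dilquo zeta t i f) +
    if l == i then \sum_(1 <= t < m) kap t *: (\sum_(0 <= s < m)
        ((eta ^+ s) ^- t * (eta ^+ s - 1)) *: dil (eta ^+ s) i f) else 0.
  transitivity ('X_l * (\sum_(1 <= t < m) kap t *: dilquo zeta t i f) +
    \sum_(1 <= t < m) kap t *: (if l == i then \sum_(0 <= s < m)
        ((eta ^+ s) ^- t * (eta ^+ s - 1)) *: dil (eta ^+ s) i f else 0)).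
    rewrite mulr_sumr -big_split; apply: eq_big_nat => t tm /=.
    by rewrite dilquo_mulX // scalerDr scalerAr.
  by congr (_ + _); case: eqP => // _; rewrite big1 // => t _; rewrite scaler0.
case: (l =P i) => [->|/eqP li]; rewrite -!mul_mpolyC.
  have -> : (U_(i) - U_(i) = 0)%MM by apply/mnmP => k; rewrite mnmBE subnn mnm0E.
  by rewrite mpolyX0 mpolyC1; ring.
by rewrite mpolyC0; ring.
Qed.

Lemma dunklC (kap : nat -> C) (i : 'I_N) (c : C) : dunklT zeta kap i c%:MP = 0.
Proof.
rewrite dunklTE mderivC add0r [X in _ *: X]big1 ?scaler0 ?add0r => [|j ji]; last first.
  by apply: big1 => s _; apply: ddiffE; rewrite 1?eq_sym // reflC subrr mul0r.
rewrite big_nat; apply: big1 => t /andP[t0 tm]; rewrite (_ : dilquo zeta t i _ = 0) ?scaler0 //.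
apply: dilquoE; rewrite mul0r; under eq_bigr => s _ do rewrite dilC.
rewrite -scaler_suml (eq_bigr (fun s => ((eta ^+ s)^-1) ^+ t)); last by move=> s _; rewrite exprVn.
by rewrite (sum_roots_inv zeta (fun z => z ^+ t)) sum_roots_exp // gtnNdvd // scale0r.
Qed.

End Dunkl.

#[local] Hint Extern 0 (is_true (negb (_ == _))) => exact: primroot_neq0 : core.

(** * Equivariance under G(m,1,N) and commutativity of the Dunkl operators *)

Section Equivariance.
Variables (C : fieldType) (m : nat) (zeta : primroot C m) (N : nat).
Local Notation eta := (primroot_val zeta).
Local Notation P := {mpoly C[N]}.
Variable kap : nat -> C.
Local Notation T := (@dunklT C m zeta kap N).

Lemma root_unity_neq0 (z : C) : z ^+ m = 1 -> z != 0.
Proof.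
move=> zm; apply/eqP => z0; move/eqP: zm; rewrite z0 expr0n eqn0Ngt (primroot_gt0 zeta) /=.
by rewrite eq_sym oner_eq0.
Qed.

Lemma gsub_refl (a : 'I_N -> C) (w : 'S_N) (z : C) (i j : 'I_N) (f : P) :
  (forall l, a l != 0) -> i != j ->
  gsub a w (refl z i j f) = refl (z * (a j / a i)) (w i) (w j) (gsub a w f).
Proof.
move=> a0 ij; rewrite refl.unlock !gsub_comp.
have -> : (w * tperm (w i) (w j))%g = (tperm i j * w)%g.
  by rewrite -tpermJ /conjg !mulgA mulgV mul1g.
apply: eq_gsub => l; rewrite !(inj_eq perm_inj).
case: (l =P i) => [->|/eqP li]; first by rewrite tpermL; field; exact: a0.
case: (l =P j) => [->|/eqP lj].
  by rewrite tpermR invfM invf_div; move: z^-1 => y; field; exact: a0.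
have -> : tperm i j l = l by rewrite tpermD // eq_sym.
by rewrite mulr1 mul1r.
Qed.

Lemma gsub_dil (a : 'I_N -> C) (w : 'S_N) (z : C) (i : 'I_N) (f : P) :
  gsub a w (dil z i f) = dil z (w i) (gsub a w f).
Proof.
rewrite dil.unlock !gsub_comp mulg1 mul1g; apply: eq_gsub => l.
by rewrite perm1 (inj_eq perm_inj) mulrC.
Qed.

Lemma gsub_dunkl_com (a : 'I_N -> C) (w : 'S_N) (i l : 'I_N) (f : P) :
  (forall k, a k ^+ m = 1) ->
  gsub a w (dunkl_com zeta kap i l f) =
  (a l / a i) *: dunkl_com zeta kap (w i) (w l) (gsub a w f).
Proof.
move=> am; have a0 k : a k != 0 by exact: root_unity_neq0.
rewrite dunkl_com.unlock (inj_eq perm_inj); case: (l =P i) => [->|/eqP li].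
  rewrite divff // scale1r 2!raddfD /= linearZ /=.
  congr (_ + _ *: _ + _).
    rewrite [RHS](reindex_inj (@perm_inj _ w)) /= raddf_sum /=.
    rewrite [RHS](eq_bigl (fun j => j != i)); last by move=> j; rewrite (inj_eq perm_inj).
    apply: eq_bigr => j ji; rewrite raddf_sum /=.
    under eq_bigr => s _ do rewrite gsub_refl 1?eq_sym // mulrC.
    apply: (sum_roots_shift zeta (fun z => refl z (w i) (w j) (gsub a w f))).
    by rewrite exprMn exprVn !am invr1 mulr1.
  rewrite raddf_sum; apply: eq_bigr => t _ /=; rewrite linearZ /= raddf_sum /=.
  by congr (_ *: _); apply: eq_bigr => s _; rewrite linearZ /= gsub_dil.
rewrite raddfN /= linearZ /= scalerN; congr (- _).
rewrite scalerA [_ * kap _]mulrC -scalerA; congr (_ *: _).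
have ali : (a l / a i) ^+ m = 1 by rewrite exprMn exprVn !am invr1 mulr1.
rewrite -(sum_roots_shift zeta (fun z => z^-1 *: refl z (w i) (w l) (gsub a w f)) ali).
rewrite raddf_sum scaler_sumr; apply: eq_bigr => s _ /=.
rewrite linearZ /= gsub_refl 1?eq_sym // [_ * (_ / _)]mulrC scalerA; congr (_ *: _).
by rewrite invfM mulrA divff ?mul1r // root_unity_neq0.
Qed.

(** Both sides vanish on constants, and multiplication by a variable only brings in the commutators.
    The substitution permutes the reflections, and the sum over all m-th roots absorbs the quotient
    a_j / a_i. *)
Lemma gsub_dunkl (a : 'I_N -> C) (w : 'S_N) (i : 'I_N) (f : P) :
  (forall k, a k ^+ m = 1) ->
  gsub a w (T i f) = (a i)^-1 *: T (w i) (gsub a w f).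
Proof.
move=> am; elim/mpoly_ind_mulX: f => [c|f g hf hg|l f hf].
- by rewrite gsubC !dunklC raddf0 scaler0.
- by rewrite !raddfD /= hf hg.
rewrite dunkl_mulX raddfD rmorphM /= rmorphM /= hf gsubX gsub_dunkl_com //.
by rewrite -!scalerAl linearZ /= dunkl_mulX -!mul_mpolyC mpolyCM; ring.
Qed.

Lemma refl_dunkl (z : C) (i j k : 'I_N) (f : P) : z ^+ m = 1 ->
  refl z i j (T k f) =
  (if k == i then z^-1 else if k == j then z else 1) *: T (tperm i j k) (refl z i j f).
Proof.
move=> zm; rewrite refl.unlock gsub_dunkl => [|l]; last first.
  by case: eqP => // _; case: eqP => _; rewrite ?exprVn ?zm ?invr1 ?expr1n.
by congr (_ *: _); case: eqP => // _; case: eqP => _; rewrite ?invrK ?invr1.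
Qed.

Lemma dil_dunkl (z : C) (i k : 'I_N) (f : P) : z ^+ m = 1 ->
  dil z i (T k f) = (if k == i then z^-1 else 1) *: T k (dil z i f).
Proof.
move=> zm; rewrite dil.unlock gsub_dunkl => [|l]; last by case: eqP; rewrite ?expr1n.
by rewrite perm1; congr (_ *: _); case: eqP; rewrite ?invr1.
Qed.

Lemma refl_swap (z : C) (i j : 'I_N) (f : P) : i != j -> refl z i j f = refl z^-1 j i f.
Proof.
move=> ij; rewrite refl.unlock [tperm j i]tpermC; apply: eq_gsub => l.
case: (l =P i) => [->|]; first by rewrite (negbTE ij) invrK.
by [].
Qed.

Lemma dunkl_com_dunkl (i j l : 'I_N) (f : P) : i != j -> l != i -> l != j ->
  dunkl_com zeta kap i l (T j f) = T j (dunkl_com zeta kap i l f).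
Proof.
move=> ij li lj; rewrite dunkl_com.unlock (negbTE li) [T j (- _)]raddfN /= [T j (_ *: _)]linearZ /=.
congr (- (_ *: _)); rewrite [RHS]raddf_sum /=; apply: eq_bigr => s _.
rewrite linearZ /= refl_dunkl ?primroot_exp_root // [j == i]eq_sym (negbTE ij).
by rewrite [j == l]eq_sym (negbTE lj) scale1r tpermD // eq_sym.
Qed.

(** Every term of [T_i, x_i] commutes with T_j except the reflections exchanging x_i and x_j. These
    contribute S, and [T_j, x_i] contributes the same S after the roots are replaced by their
    inverses. *)
Lemma dunkl_com_swap (i j : 'I_N) (f : P) : i != j ->
  dunkl_com zeta kap i i (T j f) - T j (dunkl_com zeta kap i i f) =
  dunkl_com zeta kap j i (T i f) - T i (dunkl_com zeta kap j i f).
Proof.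
move=> ij; have ji : j != i by rewrite eq_sym.
set S := kap 0%N *: \sum_(0 <= s < m) (eta ^+ s *: T i (refl (eta ^+ s) i j f)
  - T j (refl (eta ^+ s) i j f)).
transitivity S.
  rewrite dunkl_com.unlock eqxx [T j (_ + _)]raddfD /= [T j (_ + _)]raddfD /= [T j (kap 0%N *: _)]linearZ /=.
  have -> : T j (\sum_(1 <= t < m) kap t *: (\sum_(0 <= s < m)
      ((eta ^+ s) ^- t * (eta ^+ s - 1)) *: dil (eta ^+ s) i f)) =
      \sum_(1 <= t < m) kap t *: (\sum_(0 <= s < m)
      ((eta ^+ s) ^- t * (eta ^+ s - 1)) *: dil (eta ^+ s) i (T j f)).
    rewrite raddf_sum /=; apply: eq_bigr => t _; rewrite linearZ /= raddf_sum /=.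
    congr (_ *: _); apply: eq_bigr => s _; rewrite linearZ /= dil_dunkl ?primroot_exp_root //.
    by rewrite (negbTE ji) scale1r.
  rewrite opprD addrACA subrr addr0 opprD addrACA subrr add0r -scalerBr /S; congr (_ *: _).
  rewrite (bigD1 j) //= [in X in _ - X](bigD1 j) //= [T j (_ + _)]raddfD /= opprD addrACA.
  rewrite [X in _ + X](_ : _ = 0) ?addr0.
    rewrite [T j (bigop.body _ _ _)]raddf_sum -sumrB; apply: eq_bigr => s _ /=.
    rewrite (refl_dunkl _ _ _ _ (primroot_exp_root zeta s)) (negbTE ji) eqxx tpermR.
    reflexivity.
  apply/eqP; rewrite subr_eq0; apply/eqP; rewrite [RHS]raddf_sum /=.
  apply: eq_bigr => r /andP[ri rj]; rewrite [RHS]raddf_sum; apply: eq_bigr => s _ /=.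
  rewrite refl_dunkl ?primroot_exp_root // (negbTE ji) [j == r]eq_sym (negbTE rj) scale1r.
  by rewrite tpermD // eq_sym.
rewrite dunkl_com.unlock (negbTE ij) [T i (- _)]raddfN /= opprK [T i (_ *: _)]linearZ /= addrC -scalerBr /S.
congr (_ *: _); rewrite [T i (bigop.body _ _ _)]raddf_sum -sumrB /=.
rewrite -(sum_roots_inv zeta (fun z => z *: T i (refl z i j f) - T j (refl z i j f))).
apply: eq_bigr => s _; rewrite linearZ /= refl_dunkl ?primroot_exp_root // (negbTE ij) eqxx.
rewrite tpermR scalerK ?unitfE ?primroot_neq0 //.
by rewrite [refl _ i j f]refl_swap // invrK.
Qed.

(** The operator [T_i, T_j] kills constants. By the Jacobi identity it commutes with x_l once
    [[T_i, x_l], T_j] = [[T_j, x_l], T_i], which is checked for l = i, l = j and the other l. *)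
Lemma dunkl_comm (i j : 'I_N) (f : P) : T i (T j f) = T j (T i f).
Proof.
have [->//|ij] := eqVneq i j; have ji : j != i by rewrite eq_sym.
elim/mpoly_ind_mulX: f => [c|f g hf hg|l f hf].
- by rewrite !dunklC.
- by rewrite !raddfD /= hf hg.
have e a b : T a (T b ('X_l * f)) =
    'X_l * T a (T b f) + (dunkl_com zeta kap a l (T b f) + T a (dunkl_com zeta kap b l f)).
  by rewrite [T b _]dunkl_mulX [T a (_ + _)]raddfD /= dunkl_mulX addrA.
rewrite (e i j) (e j i) hf; congr (_ + _).
suff : dunkl_com zeta kap i l (T j f) - T j (dunkl_com zeta kap i l f) =
  dunkl_com zeta kap j l (T i f) - T i (dunkl_com zeta kap j l f).
  move: (dunkl_com zeta kap i l (T j f)) (T j (dunkl_com zeta kap i l f)).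
  move: (dunkl_com zeta kap j l (T i f)) (T i (dunkl_com zeta kap j l f)) => u v u' v' h.
  by rewrite -[u'](subrK v') h; ring.
case: (l =P i) => [->|/eqP li]; first exact: dunkl_com_swap.
case: (l =P j) => [->|/eqP lj]; first exact/esym/dunkl_com_swap.
by rewrite (dunkl_com_dunkl _ ij) // (dunkl_com_dunkl _ ji) // !subrr.
Qed.

End Equivariance.

(** * Polynomials in the Dunkl operators *)

Lemma sum_msupp_sub (K : nzRingType) (N : nat) (V : lmodType K)
    (phi : 'X_{1..N} -> V) (s : seq 'X_{1..N}) (f : {mpoly K[N]}) :
  uniq s -> {subset msupp f <= s} ->
  \sum_(a <- msupp f) f@_a *: phi a = \sum_(a <- s) f@_a *: phi a.
Proof.
move=> us sub; rewrite [RHS](bigID (mem (msupp f))) /= [X in _ + X]big1 ?addr0.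
  rewrite -[RHS]big_filter; apply: perm_big; apply: uniq_perm.
  - exact: msupp_uniq.
  - exact: filter_uniq.
  move=> a; rewrite mem_filter; apply/idP/andP => [h|[//]].
  by split=> //; apply: sub.
by move=> a h; rewrite (memN_msupp_eq0 h) scale0r.
Qed.

Definition subst_mpoly (C : fieldType) (N : nat)
    (T : 'I_N -> {mpoly C[N]} -> {mpoly C[N]}) (f g : {mpoly C[N]}) : {mpoly C[N]} :=
  \sum_(a <- msupp f)
    f@_a *: foldr (fun i h => iter (a i) (T i) h) g (enum 'I_N).

(** The operator f(T) applied to g. Commutativity of the T_i makes it multiplicative in f
    ([dunklM_mul]). *)
HB.lock Definition dunklM (C : fieldType) (m : nat) (zeta : primroot C m) (kap : nat -> C) (N : nat)
  (f g : {mpoly C[N]}) : {mpoly C[N]} := subst_mpoly (fun i => dunklT zeta kap i) f g.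

Section DunklM.
Variables (C : fieldType) (m : nat) (zeta : primroot C m) (N : nat).
Local Notation eta := (primroot_val zeta).
Local Notation P := {mpoly C[N]}.
Variable kap : nat -> C.
Local Notation T := (@dunklT C m zeta kap N).

Definition dunkl_mon (s : seq 'I_N) (a : 'X_{1..N}) (g : P) : P :=
  foldr (fun i h => iter (a i) (T i) h) g s.

Lemma iter_dunkl_linear n i : linear (iter n (T i)).
Proof. by move=> c f g; elim: n => //= n ->; rewrite linearP. Qed.

Lemma dunkl_mon_linear s a : linear (dunkl_mon s a).
Proof.
by move=> c f g; elim: s => //= i s ->; rewrite iter_dunkl_linear.
Qed.

Lemma dunklM_is_linear (f : P) : linear (dunklM zeta kap f).
Proof.
move=> c g h; rewrite dunklM.unlock /subst_mpoly scaler_sumr -big_split.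
apply: eq_bigr => a _ /=; rewrite -!/(dunkl_mon _ _ _) dunkl_mon_linear scalerDr.
by rewrite !scalerA [c * _]mulrC.
Qed.

HB.instance Definition _ (f : P) :=
  GRing.isLinear.Build C P P _ (dunklM zeta kap f) (dunklM_is_linear f).

Lemma dunklM_linearl (c : C) (f h g : P) :
  dunklM zeta kap (c *: f + h) g = c *: dunklM zeta kap f g + dunklM zeta kap h g.
Proof.
rewrite dunklM.unlock /subst_mpoly.
set s := undup (msupp f ++ msupp h ++ msupp (c *: f + h)).
have us : uniq s by rewrite undup_uniq.
rewrite !(@sum_msupp_sub _ _ _ _ s) //.
- rewrite scaler_sumr -big_split; apply: eq_bigr => a _ /=.
  by rewrite mcoeffD mcoeffZ scalerDl scalerA.
- by move=> a; rewrite mem_undup !mem_cat => ->; rewrite !orbT.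
- by move=> a; rewrite mem_undup !mem_cat => ->.
- by move=> a; rewrite mem_undup !mem_cat => ->; rewrite !orbT.
Qed.

Lemma dunklMDl (f h g : P) : dunklM zeta kap (f + h) g = dunklM zeta kap f g + dunklM zeta kap h g.
Proof. by rewrite -[f]scale1r dunklM_linearl !scale1r. Qed.

Lemma dunklM0l (g : P) : dunklM zeta kap 0 g = 0.
Proof. by apply: (addrI (dunklM zeta kap 0 g)); rewrite -dunklMDl !addr0. Qed.

Lemma dunklMZl (c : C) (f g : P) : dunklM zeta kap (c *: f) g = c *: dunklM zeta kap f g.
Proof. by rewrite -[c *: f]addr0 dunklM_linearl dunklM0l addr0. Qed.

Lemma dunklM_suml (I : Type) (r : seq I) (Q : pred I) (F : I -> P) (g : P) :
  dunklM zeta kap (\sum_(i <- r | Q i) F i) g = \sum_(i <- r | Q i) dunklM zeta kap (F i) g.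
Proof.
by apply: (big_morph (fun f => dunklM zeta kap f g)) => [f h|]; rewrite ?dunklMDl ?dunklM0l.
Qed.

Lemma iter_dunkl_comm n k i j f : iter n (T i) (iter k (T j) f) = iter k (T j) (iter n (T i) f).
Proof.
elim: n k f => [|n IH] k f //=; rewrite IH; elim: k => //= k <-.
exact: dunkl_comm.
Qed.

Lemma dunkl_monD1 s a i g : uniq s ->
  dunkl_mon s (a + U_(i))%MM g = if i \in s then T i (dunkl_mon s a g) else dunkl_mon s a g.
Proof.
elim: s => //= j s IH /andP[js us]; rewrite IH // mnmDE mnm1E inE.
case: (i =P j) => [->|/eqP ij] /=; first by rewrite (negbTE js) addn1.
rewrite addn0; case: ifP => // _; exact: (iter_dunkl_comm _ 1).
Qed.

Lemma dunklM_X (a : 'X_{1..N}) (g : P) : dunklM zeta kap 'X_[a] g = dunkl_mon (enum 'I_N) a g.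
Proof. by rewrite dunklM.unlock /subst_mpoly msuppX big_seq1 mcoeffX eqxx scale1r. Qed.

Lemma dunklM_mulX (i : 'I_N) (f g : P) : dunklM zeta kap ('X_i * f) g = T i (dunklM zeta kap f g).
Proof.
rewrite (mpolyE f) mulr_sumr !dunklM_suml raddf_sum; apply: eq_bigr => a _ /=.
rewrite -scalerAr !dunklMZl linearZ -mpolyXD addmC !dunklM_X dunkl_monD1 ?enum_uniq //.
by rewrite mem_enum.
Qed.

Lemma dunklMC (c : C) (g : P) : dunklM zeta kap c%:MP g = c *: g.
Proof.
rewrite -[c%:MP]mulr1 mul_mpolyC -mpolyX0 dunklMZl dunklM_X; congr (_ *: _).
by elim: (enum 'I_N) => //= i s ->; rewrite mnm0E.
Qed.

Lemma dunklM1 (g : P) : dunklM zeta kap 1 g = g.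
Proof. by rewrite -mpolyC1 dunklMC scale1r. Qed.

Lemma dunklM_mul (f h g : P) : dunklM zeta kap (f * h) g = dunklM zeta kap f (dunklM zeta kap h g).
Proof.
elim/mpoly_ind_mulX: f => [c|f f' hf hf'|l f hf].
- by rewrite mul_mpolyC dunklMZl dunklMC.
- by rewrite mulrDl !dunklMDl hf hf'.
- by rewrite -mulrA !dunklM_mulX hf.
Qed.

Lemma dunklMXn (i : 'I_N) n (g : P) : dunklM zeta kap ('X_i ^+ n) g = iter n (T i) g.
Proof.
elim: n => [|n IH]; first by rewrite expr0 dunklM1.
by rewrite exprS dunklM_mulX IH.
Qed.

Lemma dunklM_comm (f h g : P) : dunklM zeta kap f (dunklM zeta kap h g) = dunklM zeta kap h (dunklM zeta kap f g).
Proof. by rewrite -!dunklM_mul mulrC. Qed.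

Lemma dunklM_X1 (i : 'I_N) (g : P) : dunklM zeta kap 'X_i g = T i g.
Proof. by rewrite -['X_i]mulr1 dunklM_mulX dunklM1. Qed.

(** The T_i transform like partial derivatives, dually to the variables; hence the inverse scalars
    on the operator side. *)
Lemma gsub_dunklM (a : 'I_N -> C) (w : 'S_N) (f g : P) : (forall k, a k ^+ m = 1) ->
  gsub a w (dunklM zeta kap f g) = dunklM zeta kap (gsub (fun k => (a k)^-1) w f) (gsub a w g).
Proof.
move=> am; elim/mpoly_ind_mulX: f => [c|f f' hf hf'|l f hf].
- by rewrite gsubC !dunklMC linearZ.
- by rewrite dunklMDl !raddfD /= dunklMDl hf hf'.
by rewrite rmorphM /= gsubX -scalerAl dunklMZl !dunklM_mulX -hf gsub_dunkl.
Qed.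

End DunklM.

(** * Commutators of power sums of the T_i with the variables *)

Section PowerSum.
Variables (C : fieldType) (m : nat) (zeta : primroot C m) (N : nat).
Local Notation eta := (primroot_val zeta).
Local Notation P := {mpoly C[N]}.
Variable kap : nat -> C.
Local Notation T := (@dunklT C m zeta kap N).
Local Notation pw j n g := (dunklM zeta kap ('X_j ^+ n) g).

Lemma dunkl_pow_mulX (n : nat) (j l : 'I_N) (f : P) :
  pw j n ('X_l * f) = 'X_l * pw j n f +
  \sum_(0 <= u < n) pw j u (dunkl_com zeta kap j l (pw j (n.-1 - u)%N f)).
Proof.
elim: n => [|n IH]; first by rewrite expr0 !dunklM1 big_nil addr0.
rewrite exprS !dunklM_mulX // IH raddfD /= dunkl_mulX -addrA; congr (_ + _).
rewrite big_nat_recl //= expr0 dunklM1 subn0; congr (_ + _).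
rewrite raddf_sum; apply: eq_big_nat => u /andP[_ un] /=.
by rewrite -dunklM_mulX // -exprS -subn1 subnAC subn1 -subnS.
Qed.

Lemma refl_pow (z : C) (i j : 'I_N) n f : z ^+ m = 1 -> i != j ->
  refl z i j (pw i n f) = z ^- n *: pw j n (refl z i j f).
Proof.
move=> zm ij; elim: n => [|n IH]; first by rewrite expr0 !dunklM1 invr1 scale1r.
rewrite !exprS !dunklM_mulX // refl_dunkl // eqxx tpermL IH linearZ /= scalerA.
by rewrite invfM.
Qed.

Lemma dil_pow (z : C) (i : 'I_N) n f : z ^+ m = 1 ->
  dil z i (pw i n f) = z ^- n *: pw i n (dil z i f).
Proof.
move=> zm; elim: n => [|n IH]; first by rewrite expr0 !dunklM1 invr1 scale1r.
rewrite !exprS !dunklM_mulX // dil_dunkl // eqxx IH linearZ /= scalerA.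
by rewrite invfM.
Qed.

(* The reflection terms cancel in pairs and the terms in tau_l add up to full
   geometric sums of roots of unity. *)
Lemma dunkl_power_sum_mulX (n : nat) (l : 'I_N) (f : P) : (m %| n)%N -> (0 < n)%N ->
  \sum_j pw j n ('X_l * f) = 'X_l * (\sum_j pw j n f) + n%:R *: pw l n.-1 f.
Proof.
move=> mn n0.
have zn s : (eta ^+ s) ^+ n = 1.
  by case/dvdnP: mn => k ->; rewrite mulnC exprM primroot_exp_root // expr1n.
rewrite (eq_bigr (fun j => 'X_l * pw j n f +
  \sum_(0 <= u < n) pw j u (dunkl_com zeta kap j l (pw j (n.-1 - u)%N f)))); last first.
  by move=> j _; rewrite dunkl_pow_mulX.
rewrite big_split /= -mulr_sumr; congr (_ + _).
rewrite (bigD1 l) //=.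
(* The common shape of the reflection terms. For j <> l they occur with a minus sign in the summand
   j and, after u is replaced by n-1-u and the roots by their inverses, with a plus sign in the
   summand l. *)
pose A j s u := (eta ^+ s) ^+ u *: pw j u (pw l (n.-1 - u)%N (refl (eta ^+ s) j l f)).
have com_jl j : j != l ->
    \sum_(0 <= u < n) pw j u (dunkl_com zeta kap j l (pw j (n.-1 - u)%N f)) =
    - (kap 0%N *: \sum_(0 <= s < m) \sum_(0 <= u < n) A j s u).
  move=> jl; rewrite exchange_big /= scaler_sumr -sumrN; apply: eq_big_nat => u /andP[_ un].
  rewrite dunkl_com.unlock eq_sym (negbTE jl) [dunklM _ _ _ (- _)]raddfN /=.
  rewrite [dunklM _ _ _ (_ *: _)]linearZ /= raddf_sum; congr (- (_ *: _)).
  apply: eq_bigr => s _ /=; rewrite refl_pow ?primroot_exp_root // !linearZ /= scalerA /A.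
  congr (_ *: _).
  rewrite -invfM -exprS; have -> : (n.-1 - u).+1 = (n - u)%N by lia.
  apply: (mulfI (expf_neq0 (n - u) (primroot_neq0 zeta s))).
  rewrite mulfV; last exact: expf_neq0 (primroot_neq0 zeta s).
  by rewrite -exprD subnK ?zn //; exact: ltnW.
have com_ll : \sum_(0 <= u < n) pw l u (dunkl_com zeta kap l l (pw l (n.-1 - u)%N f)) =
    n%:R *: pw l n.-1 f + kap 0%N *: \sum_(j < N | j != l) \sum_(0 <= s < m) \sum_(0 <= u < n) A j s u.
  have pwD u : (0 <= u < n)%N -> forall g, pw l u (pw l (n.-1 - u)%N g) = pw l n.-1 g.
    by move=> un g; rewrite -dunklM_mul // -exprD subnKC //; lia.
  rewrite (eq_big_nat _ _ (F2 := fun u => pw l n.-1 f +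
     kap 0%N *: \sum_(j < N | j != l) \sum_(0 <= s < m) A j s (n.-1 - u)%N +
     \sum_(1 <= t < m) kap t *: \sum_(0 <= s < m)
      (((eta ^+ s) ^- t * (eta ^+ s - 1)) * (eta ^+ s) ^- (n.-1 - u)) *:
        pw l n.-1 (dil (eta ^+ s) l f))).
    rewrite !big_split /= big_const_nat subn0 iter_addr_0 scaler_nat -addrA; congr (_ + _).
    rewrite -scaler_sumr [X in _ + X](_ : _ = 0) ?addr0.
      congr (_ *: _); rewrite exchange_big /=; apply: eq_bigr => j _.
      rewrite exchange_big /=; apply: eq_bigr => s _.
      by rewrite big_nat_rev /= add0n; apply: eq_big_nat => u un; congr (A j s); lia.
    rewrite exchange_big; apply: big1 => t _ /=; rewrite -scaler_sumr exchange_big big1 ?scaler0 //.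
    move=> s _ /=; rewrite -scaler_suml -mulr_sumr.
    rewrite big_nat_rev /= add0n (eq_big_nat _ _ (F2 := fun u => (eta ^+ s)^-1 ^+ u)); last first.
      by move=> u un; rewrite exprVn; congr (_ ^- _); lia.
    set z := eta ^+ s.
    have : (z^-1 - 1) * \sum_(0 <= u < n) z^-1 ^+ u = 0.
      by rewrite big_mkord -subrX1 exprVn zn invr1 subrr.
    have -> : z - 1 = - z * (z^-1 - 1) by rewrite mulrBr mulNr mulfV // mulr1; ring.
    by rewrite -!mulrA => ->; rewrite !mulr0 scale0r.
  move=> u un; rewrite dunkl_com.unlock eqxx [dunklM _ _ _ (_ + _)]raddfD /=.
  rewrite [dunklM _ _ _ (_ + _)]raddfD /= pwD // [dunklM _ _ _ (kap 0%N *: _)]linearZ /=.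
  congr (_ + _ *: _ + _).
    rewrite raddf_sum; apply: eq_bigr => j jl; rewrite raddf_sum /=.
    rewrite -(sum_roots_inv zeta (fun z => z ^+ (n.-1 - u) *: pw j (n.-1 - u)%N
                (pw l (n.-1 - (n.-1 - u))%N (refl z j l f)))).
    apply: eq_bigr => s _; rewrite /= refl_pow ?primroot_exp_root // 1?eq_sym // linearZ /=.
    rewrite exprVn; congr (_ *: _); rewrite dunklM_comm //.
    by rewrite -refl_swap 1?eq_sym //; congr (pw j _ (pw l _ _)); lia.
  rewrite [LHS]raddf_sum; apply: eq_bigr => t _ /=; rewrite [LHS]linearZ /= [dunklM _ _ _ _]raddf_sum; congr (_ *: _).
  apply: eq_bigr => s _ /=; rewrite [dunklM _ _ _ (_ *: _)]linearZ /= dil_pow ?primroot_exp_root //.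
  rewrite [dunklM _ _ _ (_ *: _)]linearZ /= scalerA.
  by rewrite pwD.
rewrite com_ll (eq_bigr _ com_jl) sumrN -scaler_sumr; apply/eqP.
by rewrite -subr_eq0 addrK subrr.
Qed.

End PowerSum.

(** * Commutation relations in the rational Cherednik algebra of type A *)

Section RationalCherednikA.
Variables (K : comNzRingType) (V : comAlgType K) (N : nat) (c e : K).
Variables (x : 'I_N -> V) (D : 'I_N -> {linear V -> V}).
Variable s : 'I_N -> 'I_N -> {linear V -> V}.
Hypothesis ee : e * e = 1.
Hypothesis sC : forall i j f, s i j f = s j i f.
Hypothesis D_comm : forall i j f, D i (D j f) = D j (D i f).
Hypothesis D_mulx : forall i f, D i (x i * f) = x i * D i f + f + c *: \sum_(j | j != i) s i j f.
Hypothesis D_mulx_ne : forall i j f, i != j -> D i (x j * f) = x j * D i f - c *: s i j f.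
Hypothesis sD : forall i j k f, s i j (D k f) = D (tperm i j k) (s i j f).
Hypothesis sx : forall i j k f, s i j (x k * f) = x (tperm i j k) * s i j f.

Definition rmul k f := D k (x k * f).
Local Notation r := rmul.

Lemma rmul_is_linear k : linear (r k).
Proof. by move=> a f g; rewrite /r mulrDr -scalerAr linearP. Qed.
HB.instance Definition _ k := GRing.isLinear.Build K V V _ (r k) (rmul_is_linear k).

Lemma s_rmul i j k f : s i j (r k f) = r (tperm i j k) (s i j f).
Proof. by rewrite /r sD sx. Qed.

(** Up to one reflection term each, both products equal D_i D_k x_i x_k. *)
Lemma rmul_comm i k f : i != k ->
  r i (r k f) = r k (r i f) + c *: (r i (s i k f) - r k (s i k f)).
Proof.
move=> ik; have ki : k != i by rewrite eq_sym.
have h a b g : a != b -> r a (r b g) = D a (D b (x a * (x b * g))) + c *: r a (s a b g).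
  move=> ab; have h : x a * D b (x b * g) = D b (x a * (x b * g)) + c *: (x a * s a b g).
    by rewrite (@D_mulx_ne b a) 1?eq_sym // sx tpermL [s b a g]sC subrK.
  by rewrite /r h raddfD /= [D a (_ *: _)]linearZ.
rewrite (h i k) // (h k i) // D_comm [s k i f]sC [x k * (x i * f)]mulrCA scalerBr.
by rewrite addrA addrAC addrK.
Qed.

(** Applying [rmul_comm] twice gives middle terms R_i R_k s, which cancel because s R_i = R_k s. *)
Lemma rmul_sq_comm i k f : i != k ->
  r i (r i (r k f)) = r k (r i (r i f)) + c *: (r i (r i (s i k f)) - r k (r k (s i k f))).
Proof.
move=> ik; rewrite (rmul_comm f ik) [r i (_ + _)]raddfD /= [r i (_ *: _)]linearZ /= [r i (_ - _)]raddfB /= (rmul_comm (r i f) ik).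
rewrite s_rmul tpermL -addrA; congr (_ + _); rewrite -scalerDr; congr (_ *: _).
by rewrite [LHS]addrC addrA subrK.
Qed.

Let rD k f g : r k (f + g) = r k f + r k g. Proof. exact: raddfD. Qed.
Let rN k f : r k (- f) = - r k f. Proof. exact: raddfN. Qed.
Let rB k f g : r k (f - g) = r k f - r k g. Proof. exact: raddfB. Qed.
Let rZ k a f : r k (a *: f) = a *: r k f. Proof. exact: linearZ. Qed.
Let DD k f g : D k (f + g) = D k f + D k g. Proof. exact: raddfD. Qed.
Let DB k f g : D k (f - g) = D k f - D k g. Proof. exact: raddfB. Qed.
Let DZ k a f : D k (a *: f) = a *: D k f. Proof. exact: linearZ. Qed.
Let Dsum k (F : 'I_N -> V) : D k (\sum_i F i) = \sum_i D k (F i). Proof. exact: raddf_sum. Qed.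
Let sZ i j a f : s i j (a *: f) = a *: s i j f. Proof. exact: linearZ. Qed.

(** The sign e is 1 for symmetric vectors h and -1 for skew vectors a h, so that one computation
    covers both sides of the shift. *)
Definition equifam (v : 'I_N -> V) := forall i j k, i != j -> s i j (v k) = e *: v (tperm i j k).
Definition epsym (h : V) := forall i j, i != j -> s i j h = e *: h.

Lemma equifam_rmul v : equifam v -> equifam (fun k => r k (v k)).
Proof. by move=> vP i j k ij; rewrite s_rmul vP // linearZ. Qed.

Lemma equifam_D h : epsym h -> equifam (fun k => D k h).
Proof. by move=> hP i j k ij; rewrite sD hP // linearZ. Qed.

(** Subtraction takes place in K, so small N causes no truncation. *)
Let n2 : K := N%:R - 2.
Let n1 : K := n2 + 1.

(* A lift of [cs] to equivariant families (up to a scalar, see [sum_fam_cs]), chosen to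
   commute with [v |-> (r k (v k))_k]. *)
Definition fam_cs (v : 'I_N -> V) (k : 'I_N) : V := r k (r k (v k)) +
  \sum_(i | i != k) (r i (r i (v k)) - (c * e) *: r i (v i) - (c * e * n2) *: r i (v k)
    - (c * e) *: r k (v i) + (c * c * n2) *: v i).

(* On [e]-symmetric vectors, a quadratic Hamiltonian: by [cs_lower] its commutator
   with [lower n] produces [lower n.+1]. *)
Definition cs (h : V) : V := \sum_i r i (r i h) - (c * e * n1) *: \sum_i r i h.

Lemma sum_neq_const (k : 'I_N) (f : V) : \sum_(i | i != k) f = n1 *: f.
Proof.
have : \sum_(i < N) f = N%:R *: f by rewrite sumr_const card_ord scaler_nat.
rewrite (bigD1 k) //= => h; apply: (addrI f); rewrite h -{2}[f]scale1r -scalerDl.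
by congr (_ *: _); rewrite /n1 /n2; ring.
Qed.

Let scE (a : K) (f : V) : a *: f = in_alg V a * f.
Proof. by rewrite mulr_algl. Qed.

(** The lower order terms of [fam_cs] compensate the corrections in [rmul_sq_comm] and [rmul_comm],
    where equivariance turns [s i k (v k)] into [e *: v i]. The remainder carries the factor 1 -
    e^2. *)
Lemma fam_cs_rmul v k : equifam v -> fam_cs (fun k => r k (v k)) k = r k (fam_cs v k).
Proof.
move=> vP; rewrite /fam_cs raddfD; congr (_ + _); rewrite raddf_sum.
apply: eq_bigr => i ik /=.
rewrite (rmul_sq_comm (v k) ik) (rmul_comm (v k) ik) vP // tpermR !(rD, rN, rZ).
rewrite !scE; apply: subr0_eq.
transitivity (in_alg V (1 - e * e) * in_alg V (c * c * n2) * (r i (v i) - r k (v i))).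
  by ring.
by rewrite ee subrr rmorph0 !mul0r.
Qed.

(** The term 2 R_k D_k h, coming from moving D_k past R_k^2, is the one that raises the power of R_k
    in [cs_lower]. *)
Lemma fam_cs_D h k : epsym h -> D k (cs h) =
  fam_cs (fun k => D k h) k + 2 *: r k (D k h) + (1 - c * c * n2 * n1) *: D k h.
Proof.
move=> hP.
have DR i : i != k -> D k (r i h) = r i (D k h) - (c * e) *: D i h.
  by move=> ik; rewrite /r D_comm D_mulx_ne 1?eq_sym // hP 1?eq_sym // DB !DZ scalerA.
have DRk : D k (r k h) = r k (D k h) + (1 + c * e * n1) *: D k h.
  rewrite {1}/r D_mulx !DD DZ scalerDl scale1r addrA; congr (_ + _ + _).
  rewrite (eq_bigr (fun=> e *: h)); last by move=> j jk; rewrite hP // eq_sym.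
  by rewrite sum_neq_const !DZ !scalerA; congr (_ *: _); ring.
have DRR i : i != k -> D k (r i (r i h)) =
    r i (r i (D k h)) - (c * e) *: r i (D i h) - (c * e) *: r k (D i h) + (c * c) *: D k h.
  move=> ik; have ki : k != i by rewrite eq_sym.
  have DRi : D i (r k h) = r k (D i h) - (c * e) *: D k h.
    by rewrite /r D_comm D_mulx_ne // hP // DB !DZ scalerA.
  rewrite {1}/r D_comm D_mulx_ne // s_rmul tpermR hP // DB rZ !DZ -/(r i _) DR // rB rZ DRi.
  rewrite !scE.
  transitivity (r i (r i (D k h)) - in_alg V (c * e) * r i (D i h) - in_alg V (c * e) * r k (D i h) +
    in_alg V (c * c * (e * e)) * D k h); first by ring.
  by rewrite ee mulr1.
have DRRk : D k (r k (r k h)) = r k (D k (r k h)) + D k (r k h) + (c * e) *: \sum_(j | j != k) D k (r j h).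
  rewrite {1}/r D_mulx !DD DZ; congr (_ + _ + _).
  rewrite (eq_bigr (fun j => e *: r j h)); last first.
    by move=> j jk; rewrite s_rmul tpermL hP 1?eq_sym // rZ.
  by rewrite -scaler_sumr DZ scalerA raddf_sum.
rewrite /cs DB DZ !Dsum (bigD1 k) //= [X in _ - _ *: X](bigD1 k) //=.
rewrite DRRk DRk.
rewrite (eq_bigr (fun i => r i (D k h) - (c * e) *: D i h)) => [|i ik]; last by rewrite DR.
rewrite (eq_bigr _ DRR) /fam_cs !big_split /= !sumrN -!scaler_sumr sum_neq_const !(rD, rZ).
rewrite -/n2.
set A := \sum_(i | i != k) D i h; set B := \sum_(i | i != k) r i (D k h).
set E := \sum_(i | i != k) r i (D i h); set F := \sum_(i | i != k) r k (D i h).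
set G := \sum_(i | i != k) r i (r i (D k h)).
rewrite !scE /n1; apply: subr0_eq.
transitivity (in_alg V (e * e - 1) * (in_alg V (c * c * n2) * A - in_alg V (c * c * (n2 + 1) ^+ 2) * D k h)).
  by ring.
by rewrite ee subrr rmorph0 mul0r.
Qed.

Lemma exchange_neq (F : 'I_N -> 'I_N -> V) :
  \sum_k \sum_(i | i != k) F k i = \sum_i \sum_(k | k != i) F k i.
Proof.
rewrite (exchange_big_dep xpredT) //=; apply: eq_bigr => i _.
by apply: eq_bigl => k; rewrite eq_sym.
Qed.

Let rsum k (F : 'I_N -> V) : r k (\sum_i F i) = \sum_i r k (F i). Proof. exact: raddf_sum. Qed.

Let sum_r_neq (F : 'I_N -> 'I_N -> V) i :
  \sum_(k | k != i) F i k = \sum_k F i k - F i i.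
Proof. by rewrite [in RHS](bigD1 i) //= addrAC subrr add0r. Qed.

(** The sums over i <> k are completed to full double sums. The diagonal terms R_i v_i then cancel
    because n1 = n2 + 1, and the terms R_i^2 v_i cancel against the leading term of [fam_cs]. *)
Lemma sum_fam_cs v :
  \sum_k fam_cs v k = cs (\sum_k v k) + (c * c * n2 * n1) *: \sum_k v k.
Proof.
rewrite /fam_cs big_split /=.
under [X in _ + X]eq_bigr => k _ do rewrite !big_split /= !sumrN -!scaler_sumr.
rewrite !big_split /= !sumrN -!scaler_sumr.
have /= -> := exchange_neq (fun k i => r i (r i (v k))); have /= -> := exchange_neq (fun k i => r i (v i)).
have /= -> := exchange_neq (fun k i => r i (v k)); have /= -> := exchange_neq (fun k i => v i).
have -> : \sum_i \sum_(k | k != i) r i (r i (v k)) =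
    \sum_i r i (r i (\sum_k v k)) - \sum_i r i (r i (v i)).
  rewrite -sumrB; apply: eq_bigr => i _.
  by have /= -> := sum_r_neq (fun i k => r i (r i (v k))) i; rewrite !rsum.
have -> : \sum_i \sum_(k | k != i) r i (v i) = n1 *: \sum_i r i (v i).
  by rewrite scaler_sumr; apply: eq_bigr => i _; rewrite sum_neq_const.
have -> : \sum_i \sum_(k | k != i) r i (v k) = \sum_i r i (\sum_k v k) - \sum_i r i (v i).
  rewrite -sumrB; apply: eq_bigr => i _.
  by have /= -> := sum_r_neq (fun i k => r i (v k)) i; rewrite rsum.
have -> : \sum_i \sum_(k | k != i) v i = n1 *: \sum_i v i.
  by rewrite scaler_sumr; apply: eq_bigr => i _; rewrite sum_neq_const.
by rewrite /cs !scE /n1; ring.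
Qed.

(** On e-symmetric h one has R_i h = x_i D_i h + (1 + c e n1) h, and the linear term of [cs] removes
    the part c e n1. In this form the operators at c and c + 1 can be compared ([csA_skew]). *)
Lemma cs_alt h : epsym h ->
  cs h = \sum_i D i (x i * (x i * D i h)) + \sum_i D i (x i * h).
Proof.
move=> hP; rewrite /cs scaler_sumr -sumrB -big_split; apply: eq_bigr => i _ /=.
have e1 : r i h = x i * D i h + h + (c * e * n1) *: h.
  rewrite /r D_mulx; congr (_ + _); rewrite (eq_bigr (fun=> e *: h)); last first.
    by move=> j ji; rewrite hP // eq_sym.
  by rewrite sum_neq_const !scalerA; congr (_ *: _); ring.
by rewrite [in X in r i X]e1 !rD rZ addrK.
Qed.

Definition lower (n : nat) (h : V) : V := \sum_k iter n (r k) (D k h).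

Lemma iter_rmul_linear n k : linear (iter n (r k)).
Proof. by move=> a f g; elim: n => //= n ->; rewrite linearP. Qed.
HB.instance Definition _ n k := GRing.isLinear.Build K V V _ (iter n (r k)) (iter_rmul_linear n k).

Lemma equifam_lower n h : epsym h -> equifam (fun k => iter n (r k) (D k h)).
Proof.
move=> hP; elim: n => [|n IH]; first exact: equifam_D.
exact: equifam_rmul IH.
Qed.

Lemma fam_cs_iter n v k : equifam v ->
  fam_cs (fun k => iter n (r k) (v k)) k = iter n (r k) (fam_cs v k).
Proof.
move=> vP; elim: n => //= n <-; apply: (fam_cs_rmul (v := fun k => iter n (r k) (v k))).
by elim: n => //= n IH; apply: equifam_rmul IH.
Qed.

(** Both sides are read off from the sum over k of the lift applied to (R_k^n D_k h). The scalars
    c^2 n2 n1 in [fam_cs_D] and [sum_fam_cs] cancel. *)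
Lemma cs_lower n h : epsym h ->
  cs (lower n h) = lower n (cs h) - 2 *: lower n.+1 h - lower n h.
Proof.
move=> hP.
have e1 := sum_fam_cs (fun k => iter n (r k) (D k h)).
have e2 : \sum_k fam_cs (fun k => iter n (r k) (D k h)) k =
   lower n (cs h) - 2 *: lower n.+1 h - (1 - c * c * n2 * n1) *: lower n h.
  rewrite /lower !scaler_sumr -!sumrB; apply: eq_bigr => k _.
  rewrite (fam_cs_iter _ _ (equifam_D hP)) (fam_cs_D k hP).
  rewrite (iterSr n (r k)); move: (fam_cs _ k) => Z.
  have iZ a f : iter n (r k) (a *: f) = a *: iter n (r k) f by exact: linearZ.
  have iD f g : iter n (r k) (f + g) = iter n (r k) f + iter n (r k) g by exact: raddfD.
  by rewrite !iD !iZ !scE; ring.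
move: e1; rewrite e2 -/(lower n h) => /eqP; rewrite eq_sym -subr_eq => /eqP e3.
by rewrite -(addrK ((c * c * n2 * n1) *: lower n h) (cs _)) -e3 -/(lower n h) !scE; ring.
Qed.

Lemma epsym_lower n h : epsym h -> epsym (lower n h).
Proof.
move=> hP i j ij; rewrite /lower raddf_sum /= scaler_sumr [RHS](reindex_inj (@perm_inj _ (tperm i j))) /=.
by apply: eq_bigr => k _; rewrite (equifam_lower n hP).
Qed.

Lemma epsym_cs h : epsym h -> epsym (cs h).
Proof.
move=> hP i j ij.
have h1 : s i j (\sum_k r k h) = e *: \sum_k r k h.
  rewrite raddf_sum scaler_sumr [RHS](reindex_inj (@perm_inj _ (tperm i j))) /=.
  by apply: eq_bigr => k _; rewrite s_rmul hP // rZ.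
have h2 : s i j (\sum_k r k (r k h)) = e *: \sum_k r k (r k h).
  rewrite raddf_sum scaler_sumr [RHS](reindex_inj (@perm_inj _ (tperm i j))) /=.
  by apply: eq_bigr => k _; rewrite !s_rmul hP // !rZ.
by rewrite /cs [s i j (_ - _)]raddfB /= sZ h1 h2 !scE; ring.
Qed.

End RationalCherednikA.

(** * The Vandermonde determinant *)

Lemma mderiv_prod (C : comRingType) (N : nat) (I : finType) (Q : pred I)
    (F : I -> {mpoly C[N]}) (i : 'I_N) :
  (\prod_(p | Q p) F p)^`M(i) =
  \sum_(p | Q p) (F p)^`M(i) * \prod_(q | Q q && (q != p)) F q.
Proof.
have seqP (r : seq I) : uniq r -> (\prod_(p <- r) F p)^`M(i) =
    \sum_(p <- r) (F p)^`M(i) * \prod_(q <- r | q != p) F q.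
  elim: r => [_|x r IH /= /andP[xr ur]]; first by rewrite !big_nil -mpolyC1 mderivC.
  rewrite !big_cons mderivM IH // eqxx /=; congr (_ * _ + _).
    rewrite big_seq_cond [RHS]big_seq_cond; apply: eq_bigl => q.
    by rewrite andbT; case: (boolP (q \in r)) => //= qr; rewrite (memPn xr).
  rewrite mulr_sumr big_seq_cond [RHS]big_seq_cond; apply: eq_bigr => p /andP[pr _].
  by rewrite big_cons eq_sym (memPn xr) //= mulrCA.
rewrite -big_filter seqP ?filter_uniq ?index_enum_uniq // big_filter.
by apply: eq_bigr => p _; rewrite big_filter_cond.
Qed.

HB.lock Definition vander (C : comRingType) (N : nat) : {mpoly C[N]} :=
  \prod_(i < N) \prod_(j < N | (i < j)%N) ('X_i - 'X_j).

Section Vandermonde.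
Variables (C : fieldType) (N : nat).
Local Notation P := {mpoly C[N]}.
Local Notation a := (vander C N).

Definition perm_mon (s : 'S_N) : 'X_{1..N} := [multinom (s^-1 i)%g : nat | i < N].

(** The Leibniz expansion of the Vandermonde determinant. The scalar accounts for factors x_i - x_j
    in place of x_j - x_i. *)
Lemma vander_det : a = (\prod_(i < N) \prod_(j < N | (i < j)%N) -1) *:
  \sum_(s : 'S_N) (-1) ^+ s *: 'X_[perm_mon s].
Proof.
have -> : \sum_(s : 'S_N) (-1) ^+ s *: 'X_[perm_mon s] =
    \prod_(i < N) \prod_(j < N | (i < j)%N) ('X_j - 'X_i) :> P.
  rewrite (eq_bigr (fun i : 'I_N => \prod_(j < N | (i < j)%N)
     ((\row_k 'X_k : 'rV[P]_N) 0 j - (\row_k 'X_k : 'rV[P]_N) 0 i))); last first.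
    by move=> i _; apply: eq_bigr => j _; rewrite !mxE.
  rewrite -det_Vandermonde; apply: eq_bigr => s _.
  rewrite -mul_mpolyC rmorphXn rmorphN rmorph1; congr (_ * _).
  rewrite (mpolyXE _ s); apply: eq_bigr => i _; rewrite !mxE.
  by rewrite mnmE permK.
rewrite vander.unlock -scaler_prod; apply: eq_bigr => i _.
by rewrite -scaler_prod; apply: eq_bigr => j _; rewrite scaleN1r opprB.
Qed.

Lemma msym_perm_mon (t s : 'S_N) : msym t 'X_[perm_mon s] = 'X_[perm_mon (s * t)] :> P.
Proof.
rewrite msymX; congr 'X_[_]; apply/mnmP => k.
by rewrite !mnmE invMg permM.
Qed.

Lemma msym_vander (i j : 'I_N) : i != j -> msym (tperm i j) a = - a.
Proof.
move=> ij; rewrite vander_det linearZ /= -scalerN; congr (_ *: _).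
rewrite raddf_sum -sumrN [RHS](reindex_inj (@mulIg _ (tperm i j))) /=.
apply: eq_bigr => s _; rewrite linearZ /= msym_perm_mon odd_permM odd_tperm ij.
by rewrite addbT signrN scaleNr opprK.
Qed.

Lemma mderiv_X_mon (i : 'I_N) (m : 'X_{1..N}) : 'X_i * 'X_[m]^`M(i) = (m i)%:R *: 'X_[m] :> P.
Proof.
rewrite mderivX -scalerAr -mpolyXD.
case: (m i =P 0%N) => [->|/eqP mi]; first by rewrite !scale0r.
by rewrite addmC submK // lep1mP.
Qed.

(** The monomials of a are exactly the permutations of x^(0,1,...,N-1), so a common eigenvalue on
    them is an eigenvalue on a. *)
Lemma vander_eigen (E : P -> P) (mu : C) : linear E ->
  (forall s, E 'X_[perm_mon s] = mu *: 'X_[perm_mon s]) -> E a = mu *: a.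
Proof.
move=> linE Es; rewrite vander_det.
have E0 : E 0 = 0 by have := linE (-1) 0 0; rewrite scaleN1r addNr scaleN1r addNr.
have EZ c f : E (c *: f) = c *: E f by have := linE c f 0; rewrite addr0 E0 addr0.
have ED f g : E (f + g) = E f + E g by have := linE 1 f g; rewrite !scale1r.
rewrite EZ scalerA [mu * _]mulrC -scalerA (big_morph E ED E0) [mu *: _]scaler_sumr.
by congr (_ *: _); apply: eq_bigr => s _; rewrite EZ Es scalerA mulrC -scalerA.
Qed.

Lemma euler_vander : exists mu : C, \sum_(i < N) 'X_i * a^`M(i) = mu *: a.
Proof.
exists (\sum_(i < N) i%:R).
apply: (vander_eigen (E := fun f => \sum_(i < N) 'X_i * f^`M(i))) => [c f g|s].
  rewrite scaler_sumr -big_split; apply: eq_bigr => i _ /=.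
  by rewrite linearP /= mulrDr scalerAr.
under eq_bigr => i _ do rewrite mderiv_X_mon.
rewrite -scaler_suml (reindex_inj (@perm_inj _ s)) /=; congr (_ *: _).
by apply: eq_bigr => i _; rewrite mnmE permK.
Qed.

Lemma euler2_vander : exists mu : C,
  \sum_(i < N) ('X_i * ('X_i * a^`M(i)))^`M(i) = mu *: a.
Proof.
(* On x^alpha the i-th summand is multiplication by alpha_i (alpha_i + 1). *)
exists (\sum_(i < N) (i%:R + i%:R * i%:R)).
apply: (vander_eigen (E := fun f => \sum_(i < N) ('X_i * ('X_i * f^`M(i)))^`M(i))) => [c f g|s].
  rewrite scaler_sumr -big_split; apply: eq_bigr => i _ /=.
  by rewrite linearP /= !mulrDr -!scalerAr linearP.
rewrite (eq_bigr (fun i => ((perm_mon s i)%:R + (perm_mon s i)%:R * (perm_mon s i)%:R) *: 'X_[perm_mon s])).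
  rewrite -scaler_suml (reindex_inj (@perm_inj _ s)) /=; congr (_ *: _).
  by apply: eq_bigr => i _; rewrite mnmE permK.
move=> i _; rewrite mderiv_X_mon -scalerAr linearZ /= mderivM mderiv_X_mon mderivX mnm1E eqxx.
have -> : (U_(i) - U_(i) = 0)%MM by apply/mnmP => k; rewrite mnmBE subnn mnm0E.
by rewrite mpolyX0 scale1r mul1r scalerDr scalerA scalerDl.
Qed.

Definition nab (i j : 'I_N) (f : P) : P := ddiff 1 i j f.

Lemma refl1 (i j : 'I_N) (f : P) : refl 1 i j f = msym (tperm i j) f.
Proof.
rewrite msym_gsub refl.unlock; apply: eq_gsub => l.
by case: eqP => // _; case: eqP => // _; rewrite invr1.
Qed.

Lemma nabP (i j : 'I_N) (f : P) : i != j -> nab i j f * ('X_i - 'X_j) = f - msym (tperm i j) f.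
Proof.
by move=> ij; rewrite /nab -refl1 -ddiffP ?oner_neq0 // scale1r.
Qed.

Lemma nabE (i j : 'I_N) (f g : P) : i != j -> g * ('X_i - 'X_j) = f - msym (tperm i j) f ->
  nab i j f = g.
Proof.
by move=> ij h; apply: ddiffE => //; rewrite scale1r h refl1.
Qed.

(** Logarithmic differentiation gives the derivative of a as the sum of a / (x_i - x_j), while
    skewness makes the divided difference of a equal to 2 a / (x_i - x_j). *)
Lemma mderiv_vander (i : 'I_N) : 2 *: a^`M(i) = \sum_(j | j != i) nab i j a.
Proof.
pose F (p : 'I_N * 'I_N) : P := 'X_p.1 - 'X_p.2.
(* [G p] plays the role of a / [F p]. *)
pose G (p : 'I_N * 'I_N) : P := \prod_(q : 'I_N * 'I_N | (q.1 < q.2)%N && (q != p)) F q.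
have aE : a = \prod_(p : 'I_N * 'I_N | (p.1 < p.2)%N) F p.
  by rewrite vander.unlock (pair_big_dep xpredT (fun i j : 'I_N => (i < j)%N)).
have GF (p : 'I_N * 'I_N) : (p.1 < p.2)%N -> G p * F p = a by move=> h; rewrite aE (bigD1 p) //= mulrC.
have Fd (p : 'I_N * 'I_N) : (F p)^`M(i) = (p.1 == i)%:R - (p.2 == i)%:R.
  rewrite /F mderivB !mderivX !mnm1E; congr (_ - _).
    case: eqP => [->|_]; last by rewrite scale0r.
    by rewrite (_ : (_ - _)%MM = 0%MM) ?mpolyX0 ?scale1r //; apply/mnmP => k; rewrite mnmBE subnn mnm0E.
  case: eqP => [->|_]; last by rewrite scale0r.
  by rewrite (_ : (_ - _)%MM = 0%MM) ?mpolyX0 ?scale1r //; apply/mnmP => k; rewrite mnmBE subnn mnm0E.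
have aa (j k : 'I_N) : j != k -> a - msym (tperm j k) a = 2 *: a.
  by move=> jk; rewrite msym_vander // opprK scaler_nat mulr2n.
have nG j : j != i -> nab i j a = 2 *: (if (i < j)%N then G (i, j) else - G (j, i)).
  move=> ji; have ij : i != j by rewrite eq_sym.
  apply: nabE => //; rewrite aa // -scalerAl; congr (_ *: _).
  case: ltnP => h; first exact: (GF (i, j)).
  have /GF <- : ((j, i).1 < (j, i).2)%N by rewrite /= ltn_neqAle ji.
  by rewrite mulNr -mulrN opprB.
rewrite [X in _ *: X^`M(i)]aE mderiv_prod (eq_bigr _ nG) -scaler_sumr; congr (_ *: _).
rewrite -(pair_big_dep xpredT (fun i j : 'I_N => (i < j)%N) (fun k l => (F (k, l))^`M(i) * G (k, l))) /=.
under eq_bigr => k _ do under eq_bigr => l _ do rewrite Fd mulrBl.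
under eq_bigr => k _ do rewrite sumrB /=.
rewrite sumrB.
have -> : \sum_(k < N) \sum_(l < N | (k < l)%N) (k == i)%:R * G (k, l) =
    \sum_(l < N | (i < l)%N) G (i, l).
  rewrite (bigD1 i) //= [X in _ + X]big1 ?addr0; last first.
    by move=> k ki; apply: big1 => l _; rewrite (negbTE ki) mul0r.
  by apply: eq_bigr => l _; rewrite eqxx mul1r.
have -> : \sum_(k < N) \sum_(l < N | (k < l)%N) (l == i)%:R * G (k, l) =
    \sum_(k < N | (k < i)%N) G (k, i).
  rewrite (exchange_big_dep xpredT) //= (bigD1 i) //= [X in _ + X]big1 ?addr0; last first.
    by move=> k ki; apply: big1 => l _; rewrite (negbTE ki) mul0r.
  by apply: eq_bigr => l _; rewrite eqxx mul1r.
rewrite [RHS](bigID (fun j : 'I_N => (i < j)%N)) /= -sumrN; congr (_ + _).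
  apply: eq_big => [j|j ij]; last by rewrite ij.
  by case: ltnP => h; rewrite ?andbF // andbT neq_ltn h orbT.
apply: eq_big => [j|j ji]; first by rewrite -leqNgt ltn_neqAle.
by rewrite ltnNge ltnW.
Qed.

End Vandermonde.

(** * The type A shift of the operators sum_i (D_i x_i)^n D_i *)

Lemma prim_root_one (C : fieldType) : 1.-primitive_root (1 : C).
Proof.
apply/andP; split=> //; apply/forallP => i.
by rewrite unity_rootE expr1n eqxx (ord1 i).
Qed.
Definition one_root (C : fieldType) : primroot C 1 := Primroot (prim_root_one C).

Section DunklA.
Variables (C : fieldType) (N : nat).
Local Notation P := {mpoly C[N]}.
Implicit Types (c : C) (f g h : P).

(** At order 1 the only root is 1 and the sum over 1 <= t < m is empty, which leaves the type A
    operator. *)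
Definition dunklA c (i : 'I_N) : {linear P -> P} := dunklT (one_root C) (fun=> c) i.
Definition swap (i j : 'I_N) : {linear P -> P} := msym (tperm i j).
Definition mpX (i : 'I_N) : P := 'X_i.

Lemma dunklAE c i f : dunklA c i f = f^`M(i) + c *: \sum_(j | j != i) nab i j f.
Proof.
rewrite /dunklA /= dunklTE big_geq // addr0; congr (_ + _ *: _).
by apply: eq_bigr => j _; rewrite big_nat1 expr0.
Qed.

Lemma dunklA_com c i l f : dunkl_com (one_root C) (fun=> c) i l f =
  if l == i then f + c *: \sum_(j | j != i) swap i j f else - (c *: swap i l f).
Proof.
rewrite dunkl_com.unlock big_geq // addr0; case: ifP => _; last first.
  by rewrite big_nat1 expr0 invr1 scale1r refl1.
by congr (_ + _ *: _); apply: eq_bigr => j _; rewrite big_nat1 expr0 refl1.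
Qed.

Lemma swapC i j f : swap i j f = swap j i f.
Proof. by rewrite /swap tpermC. Qed.

Lemma dunklA_comm c i j f : dunklA c i (dunklA c j f) = dunklA c j (dunklA c i f).
Proof. exact: dunkl_comm. Qed.

Lemma dunklA_mulx c i f :
  dunklA c i (mpX i * f) = mpX i * dunklA c i f + f + c *: \sum_(j | j != i) swap i j f.
Proof. by rewrite /dunklA /= dunkl_mulX dunklA_com eqxx addrA. Qed.

Lemma dunklA_mulx_ne c i j f : i != j ->
  dunklA c i (mpX j * f) = mpX j * dunklA c i f - c *: swap i j f.
Proof. by move=> ij; rewrite /dunklA /= dunkl_mulX dunklA_com eq_sym (negbTE ij). Qed.

Lemma msym_dunklA c (w : 'S_N) k f : msym w (dunklA c k f) = dunklA c (w k) (msym w f).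
Proof.
rewrite !msym_gsub /dunklA /= gsub_dunkl => [|l]; last by rewrite expr1n.
by rewrite invr1 scale1r.
Qed.

Lemma swap_dunklA c i j k f : swap i j (dunklA c k f) = dunklA c (tperm i j k) (swap i j f).
Proof. exact: msym_dunklA. Qed.

Lemma swap_mulx i j k f : swap i j (mpX k * f) = mpX (tperm i j k) * swap i j f.
Proof. by rewrite /swap /mpX /= rmorphM /= msym_gsub gsubX scale1r. Qed.

Lemma swapX i j k : swap i j 'X_k = 'X_(tperm i j k).
Proof. by rewrite /swap /= msym_gsub gsubX scale1r. Qed.

Lemma swapM i j f g : swap i j (f * g) = swap i j f * swap i j g.
Proof. exact: rmorphM. Qed.

Definition swapsym h := forall i j, i != j -> swap i j h = h.

Lemma nab_sym i j h : i != j -> swapsym h -> nab i j h = 0.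
Proof. by move=> ij hs; apply: nabE => //; rewrite mul0r [msym _ _]hs // subrr. Qed.

Lemma nabMr i j f h : i != j -> swapsym h -> nab i j (f * h) = nab i j f * h.
Proof.
move=> ij hs; apply: nabE => //.
by rewrite mulrAC nabP // rmorphM /= [msym _ h]hs // mulrBl.
Qed.

Lemma dunklA_sym c i h : swapsym h -> dunklA c i h = h^`M(i).
Proof.
move=> hs; rewrite dunklAE big1 ?scaler0 ?addr0 // => j ji.
by rewrite nab_sym // eq_sym.
Qed.

Lemma dunklA_Msym c i f h : swapsym h -> dunklA c i (f * h) = dunklA c i f * h + f * h^`M(i).
Proof.
move=> hs; rewrite !dunklAE mderivM mulrDl -scalerAl.
have -> : \sum_(j | j != i) nab i j (f * h) = (\sum_(j | j != i) nab i j f) * h.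
  by rewrite mulr_suml; apply: eq_bigr => j ji; rewrite nabMr // eq_sym.
by rewrite addrAC.
Qed.

Lemma swap_deriv i j k f : swap i j (f^`M(k)) = (swap i j f)^`M(tperm i j k).
Proof.
have h g l : g^`M(l) = dunklA 0 l g by rewrite dunklAE scale0r addr0.
by rewrite !h swap_dunklA.
Qed.

(* Negating both the numerator and the denominator of the divided difference. *)
Lemma nab_swap i j f : i != j -> nab j i (swap i j f) = nab i j f.
Proof.
move=> ij; apply: nabE; first by rewrite eq_sym.
rewrite -opprB mulrN nabP // [msym (tperm j i) _](_ : _ = f) ?opprB //.
by rewrite [tperm j i]tpermC /swap /= -msymMm tperm2 msym1m.
Qed.

Lemma nabN i j f : i != j -> nab i j (- f) = - nab i j f.
Proof. by move=> ij; apply: nabE => //; rewrite mulNr nabP // rmorphN /=; ring. Qed.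

Lemma exchange_neqP (F : 'I_N -> 'I_N -> P) :
  \sum_k \sum_(i | i != k) F k i = \sum_i \sum_(k | k != i) F k i.
Proof.
rewrite (exchange_big_dep xpredT) //=; apply: eq_bigr => i _.
by apply: eq_bigl => k; rewrite eq_sym.
Qed.

Lemma sum_neq_skew (F : 'I_N -> 'I_N -> P) : (2 : C) != 0 ->
  (forall i j, i != j -> F j i = - F i j) -> \sum_i \sum_(j | j != i) F i j = 0.
Proof.
move=> two h; set S := LHS.
have e : S = - S.
  rewrite {1}/S exchange_neqP -sumrN; apply: eq_bigr => i _; rewrite -sumrN.
  by apply: eq_bigr => j ji; rewrite h // eq_sym.
have : 2 *: S = 0 by rewrite scaler_nat mulr2n {1}e addNr.
by move/eqP; rewrite scaler_eq0 (negbTE two) => /eqP.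
Qed.

(** For a skew family, [nab i j (u i)] changes sign when i and j are exchanged, so the divided
    differences cancel in pairs. *)
Lemma sum_dunklA_skew c (u : 'I_N -> P) : (2 : C) != 0 ->
  (forall i j k, i != j -> swap i j (u k) = - u (tperm i j k)) ->
  \sum_i dunklA c i (u i) = \sum_i (u i)^`M(i).
Proof.
move=> two us; rewrite (eq_bigr _ (fun i _ => dunklAE c i (u i))) big_split /= -scaler_sumr.
rewrite sum_neq_skew ?scaler0 ?addr0 // => i j ij.
by rewrite -(nab_swap (u i) ij) us // tpermL nabN ?opprK // eq_sym.
Qed.

End DunklA.

Section Shift.
Variables (C : numFieldType) (N : nat).
Local Notation P := {mpoly C[N]}.
Local Notation a := (vander C N).
Implicit Types (c : C) (f g h : P).

Let two : (2 : C) != 0. Proof. by rewrite pnatr_eq0. Qed.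

Definition csA c (e : C) : P -> P := cs c e (@mpX C N) (dunklA c).
Definition lowerA c (n : nat) : P -> P := lower (@mpX C N) (dunklA c) n.

Lemma swapsym_epsym h : swapsym h -> epsym 1 (@swap C N) h.
Proof. by move=> hs i j ij; rewrite hs // scale1r. Qed.

Lemma swap_vander i j : i != j -> swap C i j a = - a.
Proof. exact: msym_vander. Qed.

Lemma skew_epsym h : swapsym h -> epsym (- 1) (@swap C N) (a * h).
Proof. by move=> hs i j ij; rewrite swapM swap_vander // hs // scaleN1r mulNr. Qed.

Lemma dunklA_vander c i : dunklA c i a = (1 + 2 * c) *: a^`M(i).
Proof.
by rewrite dunklAE -mderiv_vander scalerA scalerDl scale1r mulrC.
Qed.

Lemma nab_vander i j u : i != j ->
  2 *: (a * nab i j u) = nab i j a * (u - swap C i j u).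
Proof.
move=> ij; have ij0 : 'X_i - 'X_j != 0 :> P by rewrite -['X_j]scale1r root_neq0.
apply: (mulIf ij0); rewrite -scalerAl -mulrA nabP // mulrAC nabP //.
by rewrite [msym _ a]swap_vander // opprK -mulr2n -scaler_nat scalerAl.
Qed.

Lemma nab_vanderC i j : i != j -> nab j i a = - nab i j a.
Proof.
move=> ij; rewrite -(nab_swap a ij) swap_vander // nabN ?opprK //.
by rewrite eq_sym.
Qed.

(** Since [nab i j a] is 2 a / (x_i - x_j), multiplication by a converts divided differences of an
    equivariant family into a first order term. This is how the parameter c + 1 will match
    derivatives of a. *)
Lemma sum_nab_vander (u : 'I_N -> P) :
  (forall i j k, i != j -> swap C i j (u k) = u (tperm i j k)) ->
  a * (\sum_i \sum_(j | j != i) nab i j (u i)) = 2 *: \sum_i a^`M(i) * u i.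
Proof.
move=> us; apply: (scalerI two).
rewrite mulr_sumr scaler_sumr.
have -> : \sum_i 2 *: (a * \sum_(j | j != i) nab i j (u i)) =
    \sum_i \sum_(j | j != i) nab i j a * u i - \sum_i \sum_(j | j != i) nab i j a * u j.
  rewrite -sumrB; apply: eq_bigr => i _.
  rewrite mulr_sumr scaler_sumr -sumrB; apply: eq_bigr => j ji.
  by rewrite nab_vander 1?eq_sym // us 1?eq_sym // tpermL mulrBr.
have -> : \sum_i \sum_(j | j != i) nab i j a * u i = 2 *: \sum_i a^`M(i) * u i.
  rewrite scaler_sumr; apply: eq_bigr => i _.
  by rewrite -mulr_suml -mderiv_vander scalerAl.
have -> : \sum_i \sum_(j | j != i) nab i j a * u j = - (2 *: \sum_i a^`M(i) * u i).
  rewrite (exchange_neqP (fun i j => nab i j a * u j)) scaler_sumr -sumrN.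
  apply: eq_bigr => i _; rewrite scalerAl mderiv_vander mulr_suml -sumrN.
  by apply: eq_bigr => j ji; rewrite nab_vanderC 1?eq_sym // mulNr.
by rewrite opprK scalerA -scalerDl; congr (_ *: _); ring.
Qed.

(** The sum of the D_i a is a multiple of a double sum antisymmetric in its indices, hence zero. On
    the symmetric factor h the D_i are partial derivatives. *)
Lemma lowerA0 c h : swapsym h -> lowerA c 0 (a * h) = a * lowerA (c + 1) 0 h.
Proof.
move=> hs; rewrite /lowerA /lower /=.
under eq_bigr => i _ do rewrite dunklA_Msym //.
under [in RHS]eq_bigr => i _ do rewrite dunklA_sym //.
rewrite big_split /= -mulr_suml -mulr_sumr.
suff -> : \sum_i dunklA c i a = 0 by rewrite mul0r add0r.
under eq_bigr => i _ do rewrite dunklA_vander.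
apply: (scalerI two); rewrite scaler0 scaler_sumr.
rewrite (eq_bigr (fun i => (1 + 2 * c) *: \sum_(j | j != i) nab i j a)); last first.
  by move=> i _; rewrite -mderiv_vander !scalerA mulrC.
rewrite -scaler_sumr sum_neq_skew ?scaler0 // => i j ij.
exact: nab_vanderC.
Qed.

(** On the skew side the divided differences drop out ([sum_dunklA_skew]) and the cross term in the
    derivatives of a and h has coefficient 2 + 2c. By [sum_nab_vander] this is the divided
    difference part at parameter c + 1. *)
Lemma csA_skew c : exists lam : C, forall h, swapsym h ->
  csA c (- 1) (a * h) = a * csA (c + 1) 1 h + lam *: (a * h).
Proof.
have [mu1 e1] := euler_vander C N; have [mu2 e2] := euler2_vander C N.
set K : C := \sum_(i < N) \sum_(j < N | j != i) 1.
(* mu1 and mu2 are the Euler eigenvalues of a; K = N(N-1) counts the divided differences of x_i h,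
   each of which equals h. *)
exists ((1 + 2 * c) * mu2 + mu1 - (c + 1) * K) => h hs.
have hs1 := swapsym_epsym hs.
pose skew (u : 'I_N -> P) := forall i j k, i != j -> swap C i j (u k) = - u (tperm i j k).
rewrite /csA (cs_alt (@dunklA_mulx C N c) (skew_epsym hs)).
rewrite (cs_alt (@dunklA_mulx C N (c + 1)) hs1).
rewrite /mpX (sum_dunklA_skew (u := fun i => 'X_i * ('X_i * dunklA c i (a * h))) c two); last first.
  move=> i j k ij; rewrite !swapM !swapX swap_dunklA swapM [swap _ _ _ h]hs // swap_vander //.
  by rewrite mulNr raddfN /= !mulrN.
rewrite (sum_dunklA_skew (u := fun i => 'X_i * (a * h)) c two); last first.
  by move=> i j k ij; rewrite !swapM !swapX [swap _ _ _ h]hs // swap_vander // mulNr mulrN.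
have -> : \sum_i dunklA (c + 1) i ('X_i * ('X_i * dunklA (c + 1) i h)) =
  \sum_i ('X_i * ('X_i * h^`M(i)))^`M(i) +
  (c + 1) *: \sum_i \sum_(j | j != i) nab i j ('X_i * ('X_i * h^`M(i))).
  rewrite scaler_sumr -big_split; apply: eq_bigr => i _ /=.
  by rewrite (dunklA_sym _ _ hs) dunklAE.
have -> : \sum_i dunklA (c + 1) i ('X_i * h) = \sum_i ('X_i * h)^`M(i) + ((c + 1) * K) *: h.
  rewrite -scalerA /K scaler_suml scaler_sumr -big_split; apply: eq_bigr => i _ /=.
  rewrite dunklAE scaler_suml; congr (_ + _ *: _); apply: eq_bigr => j ji.
  rewrite scale1r nabMr 1?eq_sym // (_ : nab i j 'X_i = 1) ?mul1r //.
  by apply: nabE; rewrite 1?eq_sym // mul1r [msym _ _]swapX tpermL.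
rewrite !mulrDr -[a * (_ *: \sum_i \sum_(j | _) _)]scalerAr sum_nab_vander; last first.
  by move=> i j k ij; rewrite !swapM !swapX swap_deriv hs.
have -> : \sum_i ('X_i * ('X_i * dunklA c i (a * h)))^`M(i) =
    (1 + 2 * c) *: (h * \sum_i ('X_i * ('X_i * a^`M(i)))^`M(i)) +
    (2 + 2 * c) *: \sum_i a^`M(i) * ('X_i * ('X_i * h^`M(i))) +
    a * \sum_i ('X_i * ('X_i * h^`M(i)))^`M(i).
  rewrite !mulr_sumr !scaler_sumr -!big_split; apply: eq_bigr => i _ /=.
  rewrite dunklA_Msym // dunklA_vander.
  have -> : 'X_i * ('X_i * ((1 + 2 * c) *: a^`M(i) * h + a * h^`M(i))) =
    (1 + 2 * c) *: (('X_i * ('X_i * a^`M(i))) * h) + a * ('X_i * ('X_i * h^`M(i))) :> P.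
    by rewrite -!mul_mpolyC; ring.
  rewrite mderivD mderivZ (mderivM _ _ h) (mderivM _ a).
  move: (('X_i * ('X_i * a^`M(i)))^`M(i)) (('X_i * ('X_i * h^`M(i)))^`M(i)) => u v.
  by rewrite -!mul_mpolyC; ring.
have -> : \sum_i ('X_i * (a * h))^`M(i) =
    h * \sum_i 'X_i * a^`M(i) + a * \sum_i ('X_i * h)^`M(i).
  rewrite !mulr_sumr -big_split; apply: eq_bigr => i _ /=.
  have -> : 'X_i * (a * h) = a * ('X_i * h) :> P by ring.
  by rewrite (mderivM _ a) addrC; ring.
rewrite e1 e2.
move: (\sum_i a^`M(i) * ('X_i * ('X_i * h^`M(i)))) => S1.
move: (\sum_i ('X_i * ('X_i * h^`M(i)))^`M(i)) => S2.
move: (\sum_i ('X_i * h)^`M(i)) => S3.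
by rewrite -!mul_mpolyC; ring.
Qed.

Lemma swapsym_cs c h : swapsym h -> swapsym (csA c 1 h).
Proof.
move=> hs i j ij; rewrite -[RHS]scale1r.
exact: (epsym_cs c (@swap_dunklA C N c) (@swap_mulx C N) (swapsym_epsym hs)).
Qed.

Lemma swapsym_lower c n h : swapsym h -> swapsym (lowerA c n h).
Proof.
move=> hs i j ij; rewrite -[RHS]scale1r.
exact: (epsym_lower (@swap_dunklA C N c) (@swap_mulx C N) n (swapsym_epsym hs)).
Qed.

Lemma csA_lower c e n h : e * e = 1 -> epsym e (@swap C N) h ->
  csA c e (lowerA c n h) = lowerA c n (csA c e h) - 2 *: lowerA c n.+1 h - lowerA c n h.
Proof.
move=> ee hs; exact: (cs_lower ee (@swapC C N) (@dunklA_comm C N c) (@dunklA_mulx C N c)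
  (@dunklA_mulx_ne C N c) (@swap_dunklA C N c) (@swap_mulx C N) n hs).
Qed.

Lemma lowerA_linear c n : linear (lowerA c n).
Proof.
move=> b f g; rewrite /lowerA /lower scaler_sumr -big_split; apply: eq_bigr => k _ /=.
by rewrite linearP /= iter_rmul_linear.
Qed.

(** By [csA_lower], twice [lowerA c n.+1] is a commutator with the Hamiltonian minus [lowerA c n],
    at both parameters. The constant of [csA_skew] cancels in the commutator. *)
Theorem lowerA_skew c n h : swapsym h -> lowerA c n (a * h) = a * lowerA (c + 1) n h.
Proof.
have [lam cs_sk] := csA_skew c.
elim: n h => [|n IH] h hs; first exact: lowerA0.
have l1 := csA_lower c n _ (skew_epsym hs).
have l2 := csA_lower (c + 1) n (mulr1 1) (swapsym_epsym hs).
apply: (scalerI two); rewrite scalerAr.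
have -> : 2 *: lowerA c n.+1 (a * h) = lowerA c n (csA c (- 1) (a * h)) - lowerA c n (a * h)
    - csA c (- 1) (lowerA c n (a * h)).
  rewrite l1; last by rewrite mulrNN mulr1.
  by rewrite -!mul_mpolyC; ring.
have -> : 2 *: lowerA (c + 1) n.+1 h = lowerA (c + 1) n (csA (c + 1) 1 h) - lowerA (c + 1) n h
    - csA (c + 1) 1 (lowerA (c + 1) n h).
  by rewrite l2 -!mul_mpolyC; ring.
rewrite (IH _ hs) (cs_sk _ hs) cs_sk; last exact: swapsym_lower.
have -> : a * csA (c + 1) 1 h + lam *: (a * h) = lam *: (a * h) + a * csA (c + 1) 1 h.
  by rewrite addrC.
rewrite lowerA_linear (IH _ hs) IH; last exact: swapsym_cs.
by rewrite -!mul_mpolyC; ring.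
Qed.

End Shift.

(** * Dunkl operators on monomials times polynomials in the m-th powers *)

HB.lock Definition powsub (C : comRingType) (N m : nat) (f : {mpoly C[N]}) : {mpoly C[N]} :=
  f \mPo [tuple 'X_i ^+ m | i < N].

Section Powsub.
Variables (C : comRingType) (N m : nat).
Local Notation P := {mpoly C[N]}.

Lemma powsub_is_linear : linear (@powsub C N m).
Proof. by move=> c f g; rewrite powsub.unlock linearP. Qed.
Lemma powsub_is_monoid_morphism : monoid_morphism (@powsub C N m).
Proof. by rewrite powsub.unlock; split; [exact: rmorph1|exact: rmorphM]. Qed.
HB.instance Definition _ :=
  GRing.isLinear.Build C P P _ (@powsub C N m) powsub_is_linear.
HB.instance Definition _ :=
  GRing.isMonoidMorphism.Build P P (@powsub C N m) powsub_is_monoid_morphism.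

Lemma powsubX (l : 'I_N) : powsub m 'X_l = 'X_l ^+ m :> P.
Proof. by rewrite powsub.unlock comp_mpolyXU -tnth_nth tnth_mktuple. Qed.

Lemma powsubC (c : C) : powsub m c%:MP = c%:MP :> P.
Proof. by rewrite powsub.unlock comp_mpolyC. Qed.

(** The chain rule, multiplied by x_i so that x_i^(m-1) becomes x_i^m and both sides stay in the
    image of [powsub m]. *)
Lemma mderiv_powsub (f : P) (i : 'I_N) :
  'X_i * (powsub m f)^`M(i) = m%:R *: powsub m ('X_i * f^`M(i)).
Proof.
have XX (l : 'I_N) : 'X_i * ('X_l)^`M(i) = (i == l)%:R *: 'X_l :> P.
  rewrite mderivX mnm1E eq_sym; case: eqP => [->|_]; last by rewrite !scale0r mulr0.
  by rewrite (_ : (_ - _)%MM = 0%MM) ?mpolyX0 ?scale1r ?mulr1 //; apply/mnmP => k; rewrite mnmBE subnn mnm0E.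
elim/mpoly_ind_mulX: f => [c|f g hf hg|l f hf].
- by rewrite powsubC !mderivC !mulr0 raddf0 scaler0.
- by rewrite !raddfD /= mulrDr hf hg -scalerDr -raddfD /= -mulrDr -raddfD.
have Xm : 'X_i * ('X_l ^+ m)^`M(i) = (m%:R * (i == l)%:R) *: 'X_l ^+ m :> P.
  elim: (m) => [|k IH]; first by rewrite expr0 -mpolyC1 mderivC mulr0 mul0r scale0r.
  rewrite exprS mderivM.
  transitivity ('X_i * 'X_l^`M(i) * 'X_l ^+ k + 'X_l * ('X_i * ('X_l ^+ k)^`M(i)) : P).
    by ring.
  by rewrite IH XX -!mul_mpolyC -natr1 !mpolyCM mpolyCD mpolyC1; ring.
rewrite rmorphM /= powsubX !mderivM.
transitivity ('X_i * ('X_l ^+ m)^`M(i) * powsub m f + 'X_l ^+ m * ('X_i * (powsub m f)^`M(i)) : P).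
  by ring.
have -> : 'X_i * ('X_l^`M(i) * f + 'X_l * f^`M(i)) = 'X_i * 'X_l^`M(i) * f + 'X_l * ('X_i * f^`M(i)) :> P.
  by ring.
rewrite Xm hf XX [powsub m (_ + _)]raddfD /= -!scalerAl [powsub m (_ *: _)]linearZ /= !rmorphM /= !powsubX.
by rewrite -!mul_mpolyC mpolyCM; ring.
Qed.

End Powsub.

Lemma gsub_powsub (C : fieldType) (N m : nat) (b : 'I_N -> C) (w : 'S_N) (f : {mpoly C[N]}) :
  (forall l, b l ^+ m = 1) -> gsub b w (powsub m f) = powsub m (msym w f).
Proof.
move=> bm; suff : (gsub b w \o powsub m : {lrmorphism {mpoly C[N]} -> {mpoly C[N]}}) =1
   (powsub m \o msym w) by exact.
apply: mpoly_lrmorph_ext => l /=.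
by rewrite powsubX rmorphXn /= msym_gsub !gsubX scale1r exprZn bm scale1r powsubX.
Qed.

Section Reduction.
Variables (C : fieldType) (m : nat) (zeta : primroot C m) (N : nat).
Local Notation eta := (primroot_val zeta).
Local Notation P := {mpoly C[N]}.
Variable kap : nat -> C.
Local Notation T := (@dunklT C m zeta kap N).
Local Notation Psi := (powsub m).
Local Notation c := (kap 0%N).
Let m0 : (0 < m)%N := primroot_gt0 zeta.

(* [kap 0] is the parameter of the hyperplanes [x_i = eta^l x_j]; the parameter with
   index [0] of the hyperplanes [x_i = 0] is [0]. *)
Definition kapz (t : nat) : C := if (m %| t)%N then 0 else kap (t %% m)%N.

Lemma sum_roots_diff (t n : nat) :
  \sum_(0 <= s < m) (eta ^+ s) ^- t * (eta ^+ s) ^+ n = if (n == t %[mod m])%N then m%:R else 0.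
Proof.
rewrite (eq_bigr (fun s => (eta ^+ s) ^+ (n + m.-1 * t)%N)); last first.
  move=> s _; apply: (mulfI (expf_neq0 t (primroot_neq0 zeta s))).
  rewrite mulrA mulfV; last exact: expf_neq0 (primroot_neq0 zeta s).
  have -> : (n + m.-1 * t = n + m * t - t)%N by rewrite -subn1 mulnBl mul1n addnBA // leq_pmull.
  rewrite mul1r -exprD subnKC; last by rewrite (leq_trans (leq_pmull t m0)) ?leq_addl.
  by rewrite exprD (exprM _ m) primroot_exp_root expr1n mulr1.
rewrite sum_roots_exp; congr (if _ then _ else _).
rewrite -(eqn_modDr (m.-1 * t)) -mulSn prednK // modnMr; exact: esym.
Qed.

(** The operator on h induced by (1/m) x_i T_i on x^al Psi h ([dunkl_red]). Comparing the exponents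
    of x_i and x_j decides whether x_i stands outside or inside the divided difference. *)
Definition red_op (al : 'X_{1..N}) (i : 'I_N) (h : P) : P :=
  'X_i * h^`M(i) + ((al i)%:R / m%:R + kapz (al i)) *: h +
  c *: \sum_(j | j != i) (if (al i <= al j)%N then 'X_i * nab i j h else nab i j ('X_i * h)).

Lemma dil_mon (z : C) (i : 'I_N) (al : 'X_{1..N}) h : z ^+ m = 1 ->
  dil z i ('X_[al] * Psi h) = z ^+ al i *: ('X_[al] * Psi h).
Proof.
move=> zm; rewrite dil.unlock rmorphM /= gsub_powsub; last by move=> l; case: eqP; rewrite ?expr1n.
rewrite gsub_mon !msym1m (bigD1 i) //= eqxx big1 ?mulr1 ?scalerAl // => l /negbTE ->.
by rewrite expr1n.
Qed.

Lemma refl_mon (z : C) (i j : 'I_N) (al : 'X_{1..N}) h : z ^+ m = 1 -> i != j ->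
  refl z i j ('X_[al] * Psi h) =
  (z ^- al j * z ^+ al i) *: (msym (tperm i j) 'X_[al] * Psi (swap C i j h)).
Proof.
move=> zm ij; rewrite refl.unlock rmorphM /= gsub_powsub; last first.
  by move=> l; case: eqP => // _; case: eqP => _; rewrite ?exprVn ?zm ?invr1 ?expr1n.
rewrite gsub_mon (bigD1 i) //= (bigD1 j) 1?eq_sym //= eqxx eq_sym (negbTE ij) eqxx big1 ?mulr1.
  by rewrite exprVn [z ^+ _ * _]mulrC scalerAl.
by move=> l /andP[/negbTE -> /negbTE ->]; rewrite expr1n.
Qed.

(** The quotient (x_i^m - x_j^m) / (x_i - z x_j): it gives the divided differences for all m roots z
    a common denominator. *)
Definition cofactor (z : C) (i j : 'I_N) : P :=
  \sum_(v < m) 'X_i ^+ (m.-1 - v) * (z *: 'X_j) ^+ v.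

Lemma root_cofactor (z : C) (i j : 'I_N) : z ^+ m = 1 ->
  ('X_i - z *: 'X_j) * cofactor z i j = 'X_i ^+ m - 'X_j ^+ m.
Proof. by move=> zm; rewrite -subrXX exprZn zm scale1r. Qed.

(** Orthogonality of the powers of eta keeps the single monomial of the cofactor whose index is b -
    a modulo m. *)
Lemma sum_cofactor (i j : 'I_N) (a b v : nat) : (v < m)%N -> (a + v = b %[mod m])%N ->
  \sum_(0 <= s < m) ((eta ^+ s) ^- b * (eta ^+ s) ^+ a) *: cofactor (eta ^+ s) i j =
  m%:R *: ('X_i ^+ (m.-1 - v) * 'X_j ^+ v).
Proof.
move=> vm avb; rewrite /cofactor.
under eq_bigr => s _ do rewrite scaler_sumr.
rewrite exchange_big /= (bigD1 (Ordinal vm)) //= [X in _ + X]big1 ?addr0 => [|u uv].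
  rewrite (eq_bigr (fun s => ((eta ^+ s) ^- b * (eta ^+ s) ^+ (a + v)) *: ('X_i ^+ (m.-1 - v) * 'X_j ^+ v))).
    by rewrite -scaler_suml sum_roots_diff avb eqxx.
  by move=> s _; rewrite exprZn -scalerAr scalerA -mulrA exprD.
rewrite (eq_bigr (fun s => ((eta ^+ s) ^- b * (eta ^+ s) ^+ (a + u)) *: ('X_i ^+ (m.-1 - u) * 'X_j ^+ u))).
  rewrite -scaler_suml sum_roots_diff -avb eqn_modDl !modn_small //.
  by rewrite (negbTE (_ : u != v :> nat)) ?scale0r // -val_eqE.
by move=> s _; rewrite exprZn -scalerAr scalerA -mulrA exprD.
Qed.

(** After multiplication by x_i^m - x_j^m, the reflected part keeps one monomial of the cofactor,
    with index v = al_j - al_i or v = m + al_j - al_i; the bounds on al keep v in [0, m-1]. The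
    reflected monomial becomes x^al x_i^m or x^al x_j^m, so the numerator is Psi of x_i (h - s h) or
    of x_i h - x_j s h. *)
Lemma sum_ddiff_mon (i j : 'I_N) (al : 'X_{1..N}) h : i != j ->
  (al i <= al j + m)%N -> (al j < al i + m)%N ->
  'X_i * (\sum_(0 <= s < m) ddiff (eta ^+ s) i j ('X_[al] * Psi h)) =
  m%:R *: ('X_[al] * Psi (if (al i <= al j)%N then 'X_i * nab i j h else nab i j ('X_i * h))).
Proof.
move=> ij le1 lt1.
have Y0 : 'X_i ^+ m - 'X_j ^+ m != 0 :> P.
  have h1 := root_cofactor i j (expr1n _ m); apply/eqP => e.
  have /eqP := congr1 (mcoeff (U_(i) *+ m)%MM) e.
  rewrite mcoeffB !mcoeffXn mcoeff0 eqxx.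
  case: ((U_(j) *+ m)%MM =P _) => [/(congr1 (fun M : 'X_{1..N} => M i))|_]; last by rewrite subr0 oner_eq0.
  rewrite !mulmnE !mnm1E eqxx eq_sym (negbTE ij) mul0n mul1n => /esym/eqP.
  by rewrite -leqn0 leqNgt m0.
apply: (mulIf Y0); rewrite -mulrA mulr_suml.
have -> : \sum_(0 <= s < m) ddiff (eta ^+ s) i j ('X_[al] * Psi h) * ('X_i ^+ m - 'X_j ^+ m) =
  'X_[al] * Psi h * (\sum_(0 <= s < m) cofactor (eta ^+ s) i j) -
  msym (tperm i j) 'X_[al] * Psi (swap C i j h) *
    (\sum_(0 <= s < m) ((eta ^+ s) ^- al j * (eta ^+ s) ^+ al i) *: cofactor (eta ^+ s) i j).
  rewrite !mulr_sumr -sumrB; apply: eq_bigr => s _.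
  rewrite -(root_cofactor i j (primroot_exp_root zeta s)) mulrA ddiffP // refl_mon //; last first.
    exact: primroot_exp_root.
  by rewrite -!mul_mpolyC; ring.
have -> : \sum_(0 <= s < m) cofactor (eta ^+ s) i j = m%:R *: 'X_i ^+ m.-1.
  have := @sum_cofactor i j 0 0 0 m0 erefl.
  rewrite subn0 expr0 mulr1 => <-; apply: eq_bigr => s _.
  by rewrite expr0 invr1 mulr1 scale1r.
have monE k l n : 'X_[al] * 'X_k ^+ n = 'X_[al + U_(k) *+ n] :> P.
  by rewrite mpolyXD mpolyXn.
have nY f : Psi (nab i j f) * ('X_i ^+ m - 'X_j ^+ m) = Psi f - Psi (swap C i j f).
  by rewrite -!powsubX -!rmorphB -rmorphM /= nabP // raddfB.
case: leqP => aij.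
  rewrite (@sum_cofactor i j (al i) (al j) (al j - al i)); [|lia|by rewrite subnKC].
  have mon : 'X_i * (msym (tperm i j) 'X_[al] * ('X_i ^+ (m.-1 - (al j - al i)) * 'X_j ^+ (al j - al i))) =
      'X_[al] * 'X_i ^+ m :> P.
    rewrite msymX -[X in X * _]expr1 !mpolyXn -!mpolyXD; congr 'X_[_]; apply/mnmP => k.
    rewrite !(mnmDE, mulmnE, mnm1E, mnmE) tpermV.
    case: (i =P k) => [<-|/eqP ik]; first by rewrite tpermL eq_sym (negbTE ij); lia.
    case: (j =P k) => [<-|/eqP jk]; first by rewrite tpermR; lia.
    by rewrite tpermD //; lia.
  rewrite rmorphM /= powsubX -scalerAl -!mulrA nY.
  transitivity (m%:R%:MP * ('X_[al] * Psi h * ('X_i ^+ m.-1 * 'X_i)) - m%:R%:MP *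
    ('X_i * (msym (tperm i j) 'X_[al] * ('X_i ^+ (m.-1 - (al j - al i)) * 'X_j ^+ (al j - al i)))) *
     Psi (swap C i j h)).
    by rewrite -!mul_mpolyC; ring.
  by rewrite mon -exprSr prednK // -!mul_mpolyC; ring.
rewrite (@sum_cofactor i j (al i) (al j) (m + al j - al i)); [|lia|]; last first.
  by rewrite subnKC ?modnDl //; lia.
have mon : 'X_i * (msym (tperm i j) 'X_[al] *
      ('X_i ^+ (m.-1 - (m + al j - al i)) * 'X_j ^+ (m + al j - al i))) =
    'X_[al] * 'X_j ^+ m :> P.
  rewrite msymX -[X in X * _]expr1 !mpolyXn -!mpolyXD; congr 'X_[_]; apply/mnmP => k.
  rewrite !(mnmDE, mulmnE, mnm1E, mnmE) tpermV.
  case: (i =P k) => [<-|/eqP ik]; first by rewrite tpermL eq_sym (negbTE ij); lia.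
  case: (j =P k) => [<-|/eqP jk]; first by rewrite tpermR; lia.
  by rewrite tpermD //; lia.
rewrite -scalerAl -!mulrA nY swapM swapX tpermL !rmorphM /= !powsubX.
transitivity (m%:R%:MP * ('X_[al] * Psi h * ('X_i ^+ m.-1 * 'X_i)) - m%:R%:MP *
    ('X_i * (msym (tperm i j) 'X_[al] * ('X_i ^+ (m.-1 - (m + al j - al i)) * 'X_j ^+ (m + al j - al i)))) *
     Psi (swap C i j h)).
  by rewrite -!mul_mpolyC; ring.
by rewrite mon -exprSr prednK // -!mul_mpolyC; ring.
Qed.

Hypothesis char0 : (m%:R : C) != 0.

Theorem dunkl_red (al : 'X_{1..N}) (i : 'I_N) (h : P) :
  (forall j, al i <= al j + m)%N -> (forall j, al j < al i + m)%N ->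
  'X_i * T i ('X_[al] * Psi h) = m%:R *: ('X_[al] * Psi (red_op al i h)).
Proof.
move=> le1 lt1; rewrite dunklTE /red_op.
have dpart : 'X_i * ('X_[al] * Psi h)^`M(i) =
    m%:R *: ('X_[al] * Psi ('X_i * h^`M(i) + ((al i)%:R / m%:R) *: h)).
  rewrite mderivM.
  transitivity ('X_i * 'X_[al]^`M(i) * Psi h + 'X_[al] * ('X_i * (Psi h)^`M(i)) : P).
    by ring.
  rewrite mderiv_X_mon mderiv_powsub [Psi (_ + _)]raddfD /= [Psi (_ / _ *: _)]linearZ /=.
  have am : (al i)%:R = m%:R * ((al i)%:R / m%:R) :> C by rewrite mulrCA mulfV // mulr1.
  by rewrite {1}am -!mul_mpolyC mpolyCM; ring.
(* Only t congruent to al_i modulo m survives. When m divides al_i there is no such t in the range,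
   which is why [kapz] is 0 there. *)
have kpart : 'X_i * (\sum_(1 <= t < m) kap t *: dilquo zeta t i ('X_[al] * Psi h)) =
    m%:R *: ('X_[al] * Psi (kapz (al i) *: h)).
  rewrite mulr_sumr (eq_big_nat _ _ (F2 := fun t =>
     (kap t * (if (al i == t %[mod m])%N then m%:R else 0)) *: ('X_[al] * Psi h))).
    rewrite -scaler_suml linearZ /= -scalerAr scalerA; congr (_ *: _); rewrite /kapz.
    case: (boolP (m %| al i)%N) => mal.
      rewrite mulr0 big_nat big1 // => t /andP[t0 tm].
      rewrite (modn_small tm) (eqP mal) eq_sym (negbTE (_ : t != 0%N)) ?mulr0 //.
      by rewrite -lt0n.
    have am : (0 < al i %% m < m)%N by rewrite ltn_pmod // andbT lt0n.
    rewrite mulrC (bigD1_seq (al i %% m)%N) ?iota_uniq //=; last by rewrite mem_index_iota.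
    rewrite modn_mod eqxx big_seq_cond big1 ?addr0 // => t.
    rewrite mem_index_iota => /andP[/andP[t0 tm] tn].
    by rewrite (modn_small tm) eq_sym (negbTE tn) mulr0.
  move=> t tm; rewrite -scalerAr mulrC dilquoP // -scalerA; congr (_ *: _).
  rewrite -sum_roots_diff scaler_suml; apply: eq_bigr => s _.
  by rewrite dil_mon ?scalerA // primroot_exp_root.
have cpart : 'X_i * (c *: \sum_(j | j != i) \sum_(0 <= s < m) ddiff (eta ^+ s) i j ('X_[al] * Psi h)) =
    m%:R *: ('X_[al] * Psi (c *: \sum_(j | j != i)
     (if (al i <= al j)%N then 'X_i * nab i j h else nab i j ('X_i * h)))).
  rewrite linearZ /= -!scalerAr scalerA [m%:R * c]mulrC -scalerA; congr (_ *: _).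
  rewrite raddf_sum !mulr_sumr scaler_sumr; apply: eq_bigr => j ji.
  by rewrite sum_ddiff_mon // eq_sym.
rewrite !mulrDr dpart kpart cpart.
set A := _ + _ *: h; set B := kapz _ *: h; set E := c *: _.
transitivity (m%:R *: ('X_[al] * Psi (A + B + E))).
  by rewrite [Psi (_ + E)]raddfD /= [Psi (_ + B)]raddfD /= -!mul_mpolyC; ring.
by congr (_ *: (_ * Psi (_ + _))); rewrite /A /B scalerDl addrA.
Qed.

End Reduction.

Section ShiftedProduct.
Variables (C : numFieldType) (N : nat).
Local Notation P := {mpoly C[N]}.
Implicit Types (c z : C) (zs : seq C) (f g h : P).

Definition rmulA c i : {linear P -> P} := rmul (@mpX C N) (dunklA c) i.

(** A polynomial in R_i stored as the list of its linear factors R_i + z. Equality of two such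
    polynomials then follows from a permutation of lists ([rops_perm]). *)
Definition rops c (i : 'I_N) zs h : P := foldr (fun z g => rmulA c i g + z *: g) h zs.

Lemma rops_linear c i zs : linear (rops c i zs).
Proof.
move=> b f g; elim: zs => //= z zs ->; rewrite linearP /= scalerDr scalerDr !scalerA.
by rewrite [z * b]mulrC addrACA.
Qed.

Lemma rmulA_rops c i zs g : rops c i zs (rmulA c i g) = rmulA c i (rops c i zs g).
Proof. by elim: zs => //= z zs ->; rewrite linearD linearZ. Qed.

Lemma ropsC c i zs1 zs2 g : rops c i zs1 (rops c i zs2 g) = rops c i zs2 (rops c i zs1 g).
Proof.
elim: zs1 => //= z zs ->; rewrite [X in _ = rops _ _ _ X]addrC rops_linear addrC.
by rewrite rmulA_rops.
Qed.

Lemma rops_perm c i zs1 zs2 g : perm_eq zs1 zs2 -> rops c i zs1 g = rops c i zs2 g.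
Proof.
move=> pe; apply/esym.
apply: (@catCA_perm_ind _ (fun s => rops c i s g = rops c i zs1 g) _ _ _ pe erefl).
by move=> s1 s2 s3 <-; rewrite /rops !foldr_cat -!/(rops _ _ _ _) ropsC.
Qed.

(** Removing one factor R_i + z leaves a term with one more R_i in front, so the induction on the
    list needs an arbitrary power k. The empty list is [lowerA_skew]. *)
Lemma sum_rops_skew c k zs h : swapsym h ->
  \sum_i iter k (rmulA c i) (rops c i zs (dunklA c i (vander C N * h))) =
  vander C N * \sum_i iter k (rmulA (c + 1) i) (rops (c + 1) i zs (dunklA (c + 1) i h)).
Proof.
move=> hs; elim: zs k => [|z zs IH] k /=; first exact: (lowerA_skew c k hs).
have e d i g : iter k (rmulA d i) (rmulA d i g + z *: g) =
    iter k.+1 (rmulA d i) g + z *: iter k (rmulA d i) g.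
  by rewrite iterSr addrC /rmulA /= iter_rmul_linear addrC.
under eq_bigr => i _ do rewrite e.
under [in RHS]eq_bigr => i _ do rewrite e.
rewrite big_split [in RHS]big_split -!scaler_sumr (IH k.+1) (IH k).
by rewrite [RHS]mulrDr scalerAr.
Qed.

Lemma swapsym_sum_rops c zs h : swapsym h -> swapsym (\sum_i rops c i zs (dunklA c i h)).
Proof.
move=> hs i j ij; rewrite raddf_sum [RHS](reindex_inj (@perm_inj _ (tperm i j))) /=.
apply: eq_bigr => k _; elim: zs => [|z zs IH] /=.
  by rewrite msym_dunklA [msym _ h]hs.
rewrite [msym _ (_ + _)]raddfD /= [msym _ (_ *: _)]linearZ /= IH; congr (_ + _).
by rewrite /rmul [msym _ _]swap_dunklA swap_mulx -IH.
Qed.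

End ShiftedProduct.

Section Iterate.
Variables (C : numFieldType) (m : nat) (zeta : primroot C m) (N : nat).
Local Notation eta := (primroot_val zeta).
Local Notation P := {mpoly C[N]}.
Variable kap : nat -> C.
Local Notation T := (@dunklT C m zeta kap N).
Local Notation Psi := (powsub m).
Local Notation c := (kap 0%N).
Local Notation kz := (kapz m kap).
Let m0 : (0 < m)%N := primroot_gt0 zeta.
Let mR0 : (m%:R : C) != 0. Proof. by rewrite pnatr_eq0 -lt0n. Qed.

Definition cmon (b : nat) : 'X_{1..N} := [multinom b | j < N].
Definition cmon1 (b : nat) (i : 'I_N) (l : nat) : 'X_{1..N} :=
  [multinom if j == i then l else b | j < N].

Lemma cmon1E b i : cmon1 b i b = cmon b.
Proof. by apply/mnmP => j; rewrite !mnmE if_same. Qed.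

Lemma cmon1S b i l : 'X_[cmon1 b i l.+1] = 'X_i * 'X_[cmon1 b i l] :> P.
Proof.
rewrite -mpolyXD; congr 'X_[_]; apply/mnmP => j; rewrite !(mnmDE, mnmE) eq_sym.
by case: eqP.
Qed.

Lemma nab_mulX (i j : 'I_N) (h : P) : i != j ->
  nab i j ('X_i * h) = 'X_i * nab i j h + swap C i j h.
Proof.
move=> ij; apply: nabE => //; rewrite mulrDl -mulrA nabP // [msym _ ('X_i * h)]swapM swapX tpermL.
by rewrite -/(swap C i j h) -[msym _ _]/(swap C i j h); ring.
Qed.

Lemma dunkl_cmon1_low b i l h : (l.+1 <= b)%N -> (b < m)%N ->
  T i ('X_[cmon1 b i l.+1] * Psi h) = m%:R *: ('X_[cmon1 b i l] *
    Psi ('X_i * dunklA c i h + ((l.+1)%:R / m%:R + kz l.+1) *: h)).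
Proof.
move=> lb bm; apply: (mulfI (X_neq0 C i)).
rewrite dunkl_red //; first last.
- by move=> j; rewrite !mnmE eqxx; case: eqP => _; lia.
- by move=> j; rewrite !mnmE eqxx; case: eqP => _; lia.
rewrite -scalerAr mulrA -cmon1S; congr (_ *: (_ * Psi _)).
rewrite /red_op !mnmE eqxx dunklAE.
rewrite (eq_bigr (fun j => 'X_i * nab i j h)) => [|j ji]; last first.
  by rewrite !mnmE (negbTE ji) lb.
by rewrite -[\sum_(j | _) 'X_i * _]mulr_sumr -!mul_mpolyC; ring.
Qed.

(** Here x_i T_i produces Psi (x_i D_i h) = x_i^m Psi (D_i h). Cancelling x_i leaves the exponent
    m-1 and a bare D_i. *)
Lemma dunkl_cmon1_zero b i h : (b < m)%N ->
  T i ('X_[cmon1 b i 0] * Psi h) = m%:R *: ('X_[cmon1 b i m.-1] * Psi (dunklA c i h)).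
Proof.
move=> bm; apply: (mulfI (X_neq0 C i)).
rewrite dunkl_red //; first last.
- by move=> j; rewrite !mnmE eqxx; case: eqP => _; lia.
- by move=> j; rewrite !mnmE eqxx; case: eqP => _; lia.
rewrite -scalerAr mulrA -cmon1S prednK //.
have -> : red_op m kap (cmon1 b i 0) i h = 'X_i * dunklA c i h.
  rewrite /red_op !mnmE eqxx mul0r /kapz dvdn0 addr0 scale0r addr0 dunklAE.
  rewrite (eq_bigr (fun j => 'X_i * nab i j h)) //.
  by rewrite -[\sum_(j | _) 'X_i * _]mulr_sumr -!mul_mpolyC; ring.
rewrite rmorphM /= powsubX mulrA; congr (_ *: (_ * _)).
rewrite mpolyXn -mpolyXD; congr 'X_[_]; apply/mnmP => j.
rewrite !(mnmDE, mnmE, mulmnE, mnm1E) eq_sym.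
by case: eqP => _; rewrite ?mul1n ?mul0n ?addn0.
Qed.

(** For exponents of x_i above b the factor x_i is inside the divided differences. The -1 comes from
    the partial derivative of x_i in R_i = D_i x_i. *)
Lemma dunkl_cmon1_high b i l h : (b <= l)%N -> (l < b + m)%N ->
  T i ('X_[cmon1 b i l.+1] * Psi h) = m%:R *: ('X_[cmon1 b i l] *
    Psi (rmulA c i h + ((l.+1)%:R / m%:R + kz l.+1 - 1) *: h)).
Proof.
move=> lb bm; apply: (mulfI (X_neq0 C i)).
rewrite dunkl_red //; first last.
- by move=> j; rewrite !mnmE eqxx; case: eqP => _; lia.
- by move=> j; rewrite !mnmE eqxx; case: eqP => _; lia.
rewrite -scalerAr mulrA -cmon1S; congr (_ *: (_ * Psi _)).
rewrite /red_op !mnmE eqxx /rmulA /= /rmul dunklAE mderivM mderivX mnm1E eqxx.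
rewrite (_ : (_ - _)%MM = 0%MM); last by apply/mnmP => k; rewrite mnmBE subnn mnm0E.
rewrite mpolyX0 scale1r mul1r.
rewrite (eq_bigr (fun j => nab i j ('X_i * h))) => [|j ji]; last first.
  by rewrite !mnmE (negbTE ji) leqNgt ltnS lb.
move: (_ / _ + kz _) => w; rewrite -/(mpX C i).
by rewrite -!mul_mpolyC mpolyCB mpolyC1; ring.
Qed.

(** The constant z in the factor R_i + z contributed by lowering the exponent of x_i from l to l-1
    while the other variables have exponent b. *)
Definition wgt (b l : nat) : C := l%:R / m%:R + kz l - (b < l)%:R.

Let iterZ n i (b : C) f : iter n (T i) (b *: f) = b *: iter n (T i) f.
Proof. by elim: n => //= n ->; rewrite linearZ. Qed.

Lemma iter_dunkl_phase3 b i n h : (b + n < m)%N ->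
  iter n (T i) ('X_[cmon1 b i (b + n)] * Psi h) =
  m%:R ^+ n *: ('X_[cmon b] * Psi (rops c i [seq wgt b l | l <- iota b.+1 n] h)).
Proof.
elim: n h => [|n IH] h bn; first by rewrite addn0 cmon1E scale1r.
rewrite iterSr addnS dunkl_cmon1_high; [|exact: leq_addr|by lia].
rewrite iterZ IH; last by lia.
rewrite scalerA -exprS -addn1 iotaD map_cat /rops foldr_cat /= -/(rops _ _ _ _) addn1.
have -> : wgt b (b.+1 + n) = (b + n).+1%:R / m%:R + kz (b + n).+1 - 1.
  by rewrite /wgt addSn ltnS leq_addr.
by [].
Qed.

(** Below b the factors are x_i D_i + z rather than R_i + z. The D_i of the next jump converts them,
    since D_i (x_i D_i + z) = (R_i + z) D_i; so only [dunklA c i g] has a useful form. *)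
Lemma iter_dunkl_phase1 b i n h : (n <= b)%N -> (b < m)%N ->
  exists2 g, iter n (T i) ('X_[cmon1 b i n] * Psi h) = m%:R ^+ n *: ('X_[cmon1 b i 0] * Psi g)
   & dunklA c i g = rops c i [seq wgt b l | l <- iota 1 n] (dunklA c i h).
Proof.
move=> + bm; elim: n h => [|n IH] h nb; first by exists h; rewrite ?scale1r.
set h1 := 'X_i * dunklA c i h + (n.+1%:R / m%:R + kz n.+1) *: h.
have [g e1 e2] := IH h1 (ltnW nb); exists g.
  by rewrite iterSr dunkl_cmon1_low // iterZ e1 scalerA -exprS.
rewrite e2 -[n.+1]addn1 iotaD map_cat /rops foldr_cat /= -/(rops _ _ _ _) add1n.
have -> : dunklA c i h1 = rmulA c i (dunklA c i h) + wgt b n.+1 *: dunklA c i h.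
  by rewrite /h1 linearD linearZ /wgt ltnNge nb subr0.
by [].
Qed.

(* The exponent of [x_i] decreases from [b] to [0], jumps to [m-1], and decreases
   to [b]. *)
Lemma iter_dunkl_m b i h : (b < m)%N ->
  iter m (T i) ('X_[cmon b] * Psi h) =
  m%:R ^+ m *: ('X_[cmon b] * Psi (rops c i [seq wgt b l | l <- iota 1 m.-1] (dunklA c i h))).
Proof.
move=> bm; have [g e1 e2] := iter_dunkl_phase1 i h (leqnn b) bm.
have em : m = ((m.-1 - b) + 1 + b)%N by lia.
have iterE F : iter m (T i) F = iter (m.-1 - b) (T i) (T i (iter b (T i) F)).
  by rewrite -iterS -iterD; congr (iter _ _ _); lia.
rewrite iterE -{1}(cmon1E b i) e1 linearZ /= dunkl_cmon1_zero // !iterZ.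
have bm1 : (b + (m.-1 - b) = m.-1)%N by lia.
have := @iter_dunkl_phase3 b i (m.-1 - b) (dunklA c i g); rewrite bm1 => -> //; last by lia.
have -> : m%:R ^+ b *: (m%:R *: (m%:R ^+ (m.-1 - b) *: ('X_[cmon b] * Psi (rops c i
    [seq wgt b l | l <- iota b.+1 (m.-1 - b)] (dunklA c i g))))) =
    m%:R ^+ m *: ('X_[cmon b] * Psi (rops c i
    [seq wgt b l | l <- iota b.+1 (m.-1 - b)] (dunklA c i g))).
  rewrite !scalerA; congr (_ *: _).
  by rewrite ?mulrA -exprSr -exprD; congr (_ ^+ _); lia.
rewrite e2; have -> : rops c i [seq wgt b l | l <- iota 1 m.-1] (dunklA c i h) =
  rops c i ([seq wgt b l | l <- iota b.+1 (m.-1 - b)] ++ [seq wgt b l | l <- iota 1 b]) (dunklA c i h).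
  by apply: rops_perm; rewrite -{1}bm1 iotaD map_cat add1n perm_catC.
by rewrite /rops foldr_cat.
Qed.

Lemma dunkl_raise b i g :
  T i ('X_i * ('X_[cmon b] * Psi g)) = m%:R *: ('X_[cmon b] *
    Psi (rmulA c i g + (b.+1%:R / m%:R + kz b.+1 - 1) *: g)).
Proof.
rewrite mulrA -{1}(cmon1E b i) -cmon1S dunkl_cmon1_high ?cmon1E //.
by rewrite -addn1 leq_add2l.
Qed.

End Iterate.

(** * Symmetric polynomials in the m-th powers of the Dunkl operators *)

Section PowerSumAlgebra.
Variables (C : numFieldType) (N : nat).
Local Notation P := {mpoly C[N]}.

(** The algebra generated by the power sums, as a predicate whose induction principle drives
    [shifts_sym]. *)
Inductive psalg : P -> Prop :=
| PsalgC c : psalg c%:MP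
| PsalgP r : (0 < r)%N -> psalg (\sum_j 'X_j ^+ r)
| PsalgD f g : psalg f -> psalg g -> psalg (f + g)
| PsalgM f g : psalg f -> psalg g -> psalg (f * g).

(* [euler2] preserves [psalg], and [euler2 e_r = e_1 e_r - (r+1) e_(r+1)]; in
   characteristic 0 this puts all elementary symmetric polynomials in [psalg]. *)
Definition euler2 (f : P) : P := \sum_i 'X_i * ('X_i * f^`M(i)).

Lemma euler2D f g : euler2 (f + g) = euler2 f + euler2 g.
Proof. by rewrite -big_split; apply: eq_bigr => i _ /=; rewrite mderivD !mulrDr. Qed.

Lemma psalgZ c f : psalg f -> psalg (c *: f).
Proof. by move=> h; rewrite -mul_mpolyC; apply: PsalgM => //; apply: PsalgC. Qed.

Lemma psalg_euler2 f : psalg f -> psalg (euler2 f).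
Proof.
elim=> [c|r r0|f1 f2 _ h1 _ h2|f1 f2 p1 h1 p2 h2].
- rewrite /euler2 big1 => [|i _]; last by rewrite mderivC !mulr0.
  by rewrite -mpolyC0; apply: PsalgC.
- have -> : euler2 (\sum_j 'X_j ^+ r) = r%:R *: \sum_j 'X_j ^+ r.+1.
    rewrite scaler_sumr; apply: eq_bigr => i _.
    rewrite raddf_sum mulr_sumr (bigD1 i) //= big1 ?addr0 => [|j ji].
      rewrite mpolyXn mderiv_X_mon mulmnE mnm1E eqxx mul1n -scalerAr -mpolyXn.
      by rewrite exprS.
    by rewrite mpolyXn mderiv_X_mon mulmnE mnm1E (negbTE ji) mul0n scale0r.
  by apply: psalgZ; apply: PsalgP.
- by rewrite euler2D; apply: PsalgD.
have -> : euler2 (f1 * f2) = euler2 f1 * f2 + f1 * euler2 f2.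
  rewrite mulr_suml mulr_sumr -big_split; apply: eq_bigr => i _ /=.
  by rewrite mderivM; ring.
by apply: PsalgD; apply: PsalgM.
Qed.

(** In e_1 e_k the products of x_i with the monomial of a set containing i form [euler2]. The other
    products give each (k+1)-set once for every one of its elements. *)
Lemma euler2_mesym k : euler2 (mesym N C k) = mesym N C 1 * mesym N C k - k.+1%:R *: mesym N C k.+1.
Proof.
rewrite mesym1E mulr_suml.
have e1 i : 'X_i * ('X_i * (mesym N C k)^`M(i)) =
    \sum_(h : {set 'I_N} | (#|h| == k) && (i \in h)) 'X_i * 'X_[mesym1 h].
  rewrite mesymE raddf_sum !mulr_sumr big_mkcondr; apply: eq_bigr => h _ /=.
  rewrite mderiv_X_mon mnmE; case: (i \in h); first by rewrite scale1r.
  by rewrite scale0r mulr0.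
rewrite /euler2 (eq_bigr _ (fun i _ => e1 i)); apply/eqP; rewrite eq_sym subr_eq; apply/eqP.
have e2 : k.+1%:R *: mesym N C k.+1 =
    \sum_i \sum_(h : {set 'I_N} | (#|h| == k.+1) && (i \in h)) 'X_[mesym1 h].
  rewrite (exchange_big_dep (fun h : {set 'I_N} => #|h| == k.+1)) /=; last by move=> i h _ /andP[].
  rewrite mesymE scaler_sumr; apply: eq_bigr => h hk.
  rewrite (eq_bigl (fun i => i \in h)); last by move=> i; rewrite hk.
  by rewrite sumr_const (eqP hk) scaler_nat.
rewrite e2 -big_split; apply: eq_bigr => i _ /=.
rewrite mesymE mulr_sumr (bigID (fun h : {set 'I_N} => i \in h)) /=; congr (_ + _).
rewrite [RHS](reindex_onto (fun h => i |: h) (fun h => h :\ i)) /=; last first.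
  by move=> h /andP[_ ih]; rewrite setD1K.
apply: eq_big => [h|h /andP[_ ih]].
  rewrite setU11 andbT cardsU1; case: (boolP (i \in h)) => ih; rewrite ?andbF ?andbT /=.
    apply/esym/negbTE; rewrite negb_and; apply/orP; right; apply/eqP => /setP /(_ i).
    by rewrite !inE eqxx ih.
  by rewrite add1n eqSS setU1K // eqxx andbT.
rewrite -mpolyXD; congr 'X_[_]; apply/mnmP => l; rewrite !(mnmDE, mnm1E, mnmE) inE.
rewrite in_set1 eq_sym; case: (l =P i) => [->|_] /=; first by rewrite (negbTE ih).
by [].
Qed.

Lemma psalg_mesym k : psalg (mesym N C k).
Proof.
elim: k => [|k IH]; first by rewrite mesym0E -mpolyC1; apply: PsalgC.
have -> : mesym N C k.+1 = (k.+1%:R)^-1 *: (mesym N C 1 * mesym N C k + (- 1) *: euler2 (mesym N C k)).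
  rewrite euler2_mesym scaleN1r opprB addrC subrK scalerA mulVf ?scale1r //.
  by rewrite pnatr_eq0.
apply: psalgZ; apply: PsalgD.
  by apply: PsalgM => //; rewrite mesym1E; have := @PsalgP 1 isT.
by apply: psalgZ; apply: psalg_euler2.
Qed.

Lemma psalg_symmetric f : f \is symmetric -> psalg f.
Proof.
move=> /sym_fundamental [t [<- _]].
elim/mpoly_ind_mulX: t => [c|f1 f2 h1 h2|l f1 h1].
- by rewrite comp_mpolyC; apply: PsalgC.
- by rewrite comp_mpolyD; apply: PsalgD.
rewrite rmorphM /= comp_mpolyXU; apply: PsalgM => //.
by rewrite -tnth_nth tnth_mktuple; apply: psalg_mesym.
Qed.

End PowerSumAlgebra.

Lemma swapsym_symmetric (C : fieldType) (N : nat) (f : {mpoly C[N]}) :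
  swapsym f -> f \is symmetric.
Proof.
move=> fs; apply/issymP => s; have [ts -> dts] := prod_tpermP s.
elim: ts dts => [|t ts IH] /=; first by rewrite big_nil msym1m.
move=> /andP[dt dts]; rewrite big_cons msymMm.
by rewrite [msym (tperm _ _) f]fs // IH.
Qed.

(** * Coincidence of the two lists of weights *)

Section WeightPerm.
Variables (C : numFieldType) (p q m j : nat) (kapL kapR : nat -> C).
Hypothesis mE : m = (p * q)%N.
Hypothesis q0 : (0 < q)%N.
Hypothesis jp : (j < p)%N.
Local Notation kL := (kapz m kapL).
Local Notation kR := (kapz m kapR).
Hypothesis kL0 : forall t, (q %| t)%N -> kL t = 0.
Hypothesis kR0 : forall t, (q %| t)%N -> kR t = 0.
Hypothesis kRL : forall t, ~~ (q %| t)%N -> kR t = kL t + p%:R^-1.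
Hypothesis kLq : forall t, kL (t + q)%N = kL t.

Lemma kL_mod t : kL (t %% m)%N = kL t.
Proof. by rewrite /kapz modn_mod /dvdn modn_mod. Qed.

(* The permutation shifts by [q], modulo [m], the indices not divisible by [q]. *)
Lemma wgt_shift : perm_eq [seq wgt m kapL (j * q + q - 1) l | l <- iota 1 m.-1]
  [seq wgt m kapR (j * q) l | l <- iota 1 m.-1].
Proof.
have m0 : (0 < m)%N by rewrite mE muln_gt0 q0 (leq_ltn_trans _ jp).
have w0 kap b : wgt m kap b 0 = 0 :> C by rewrite /wgt mul0r /kapz dvdn0 subr0 addr0.
have iE : iota 0 m = 0%N :: iota 1 m.-1 by rewrite -{1}(prednK m0).
(* The index 0, of weight 0 on both sides, is added so that the permutation acts on all residues
   modulo m. *)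
rewrite -(perm_cons (0 : C)) -{1}(w0 kapL (j * q + q - 1)%N) -{1}(w0 kapR (j * q)%N).
rewrite -!map_cons -iE.
pose s l := if (q %| l)%N then l else ((l + q) %% m)%N.
have qm : (q %| m)%N by rewrite mE dvdn_mull.
have sq l : (q %| s l)%N = (q %| l)%N.
  rewrite /s; case: ifP => // ql; rewrite /dvdn modn_dvdm // modnDr.
  by rewrite -/(dvdn q l) ql.
have sperm : perm_eq (iota 0 m) (map s (iota 0 m)).
  have U : uniq (map s (iota 0 m)).
    rewrite map_inj_in_uniq ?iota_uniq // => l1 l2; rewrite !mem_iota !add0n /= => l1m l2m e.
    have := sq l1; rewrite e sq => ql; move: e; rewrite /s ql; case: ifP => // _ /eqP.
    by rewrite eqn_modDr !modn_small // => /eqP.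
  have S : {subset map s (iota 0 m) <= iota 0 m}.
    move=> _ /mapP [l lm ->]; rewrite mem_iota /s; case: ifP => _; first by rewrite -mem_iota.
    by rewrite add0n ltn_pmod.
  have [_ eqi] : (size (map s (iota 0 m)) = size (iota 0 m)) * (map s (iota 0 m) =i iota 0 m).
    by apply: uniq_min_size => //; rewrite size_map.
  by rewrite perm_sym; apply: uniq_perm => //; exact: iota_uniq.
have pR0 : (p%:R : C) != 0 by rewrite pnatr_eq0 -lt0n (leq_ltn_trans _ jp).
have qR0 : (q%:R : C) != 0 by rewrite pnatr_eq0 -lt0n.
have mR : (m%:R : C) = p%:R * q%:R by rewrite mE natrM.
rewrite (perm_trans (perm_map _ sperm)) // -map_comp.
rewrite (_ : map _ _ = [seq wgt m kapR (j * q) l | l <- iota 0 m]) ?perm_refl //.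
apply/eq_in_map => l; rewrite mem_iota add0n /= => lm; rewrite /wgt /s.
case: ifP => ql.
  rewrite kL0 // kR0 //; congr (_ - (nat_of_bool _)%:R).
  case/dvdnP: ql => u ->; rewrite ltn_pmul2r //.
  have -> : (j * q + q - 1 < u * q)%N = (j.+1 * q <= u * q)%N by rewrite mulSn; lia.
  by rewrite leq_pmul2r.
(* Moving l to l + q adds q/m = 1/p, the difference of the two kappas. If l + q wraps around, the
   loss of m/m = 1 is offset by the -1 of the right-hand weight. *)
rewrite kL_mod kLq kRL ?ql //.
have ljq : (l != j * q)%N by apply: contraFN ql => /eqP ->; rewrite dvdn_mull.
case: (ltnP (l + q) m) => lq.
  rewrite modn_small // natrD mR.
  have -> : (j * q + q - 1 < l + q)%N = (j * q < l)%N by move: ljq; lia.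
  by field; rewrite pR0.
have lq' : ((l + q) %% m = l + q - m)%N.
  by rewrite -{1}(subnK lq) modnDr modn_small //; nia.
rewrite lq' natrB // natrD mR.
have -> : (j * q + q - 1 < l + q - m)%N = false by apply/negbTE; rewrite -leqNgt; lia.
have -> : (j * q < l)%N = true by apply/idP; nia.
by rewrite mulr1n mulr0n; field; rewrite pR0.
Qed.

End WeightPerm.

(** * Generating the power sums in the T_i^m by commutators *)

Section RaisingOperator.
Variables (C : numFieldType) (m : nat) (zeta : primroot C m) (N : nat) (kap : nat -> C).
Local Notation P := {mpoly C[N]}.
Local Notation T := (@dunklT C m zeta kap N).
Local Notation Psi := (powsub m).
Local Notation MT := (@dunklM C m zeta kap N).
Let m0 : (0 < m)%N := primroot_gt0 zeta.

Definition psum n : P := \sum_j 'X_j ^+ n.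

(** Subtracting a multiple of p_1(T^m) removes the constant in [dunkl_raise], which may differ
    between the two sides; with w = [wtop kap b] what remains is a multiple of sum_i R_i P_b(R_i)
    D_i. The subtracted part commutes with all power sums in the T_i. *)
Definition araise (w : C) (f : P) : P :=
  \sum_i T i ('X_i * MT ('X_i ^+ m) f) - (m%:R * w) *: MT (psum m) f.

Lemma psum_T n f : MT (psum n) f = \sum_j MT ('X_j ^+ n) f.
Proof. exact: dunklM_suml. Qed.

(** Since [p_(mr)(T), x_i] = m r T_i^(mr-1), the commutator with T_i x_i T_i^m is m r
    T_i^(m(r+1)). *)
Lemma araise_psum w r f : (0 < r)%N ->
  MT (psum (m * r)) (araise w f) = araise w (MT (psum (m * r)) f) +
  (m * r)%:R *: MT (psum (m * r.+1)) f.
Proof.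
move=> r0; have mr0 : (0 < m * r)%N by rewrite muln_gt0 m0.
have main : MT (psum (m * r)) (\sum_i T i ('X_i * MT ('X_i ^+ m) f)) =
    \sum_i T i ('X_i * MT ('X_i ^+ m) (MT (psum (m * r)) f)) +
    (m * r)%:R *: MT (psum (m * r.+1)) f.
  rewrite [LHS]raddf_sum [MT (psum (m * r.+1)) f]psum_T scaler_sumr -big_split.
  apply: eq_bigr => i _ /=.
  rewrite -dunklM_X1 dunklM_comm dunklM_X1.
  have -> : MT (psum (m * r)) ('X_i * MT ('X_i ^+ m) f) =
      'X_i * MT (psum (m * r)) (MT ('X_i ^+ m) f) +
      (m * r)%:R *: MT ('X_i ^+ (m * r).-1) (MT ('X_i ^+ m) f).
    by rewrite !psum_T dunkl_power_sum_mulX // dvdn_mulr.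
  rewrite linearD linearZ /= [MT (psum _) (MT ('X_i ^+ m) f)]dunklM_comm.
  rewrite -[T i (MT ('X_i ^+ (m * r).-1) _)]dunklM_X1 -!dunklM_mul -exprS -exprD.
  by have -> : ((m * r).-1.+1 + m = m * r.+1)%N by rewrite prednK // mulnS addnC.
rewrite /araise linearB /= main linearZ /= [MT (psum (m * r)) (MT (psum m) f)]dunklM_comm.
by rewrite addrAC.
Qed.

End RaisingOperator.

Section Shifts.
Variables (C : numFieldType) (m : nat) (zeta : primroot C m) (N : nat).
Variables (kapL kapR : nat -> C) (bL bR : nat).
Local Notation P := {mpoly C[N]}.
Local Notation Psi := (powsub m).
Local Notation a := (vander C N).
Local Notation ML := (@dunklM C m zeta kapL N).
Local Notation MR := (@dunklM C m zeta kapR N).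
Let m0 : (0 < m)%N := primroot_gt0 zeta.
Hypothesis kap0 : kapR 0%N = kapL 0%N + 1.
Hypothesis bLm : (bL < m)%N.
Hypothesis bRm : (bR < m)%N.
Hypothesis wgt_perm : perm_eq [seq wgt m kapL bL l | l <- iota 1 m.-1]
  [seq wgt m kapR bR l | l <- iota 1 m.-1].

(** A single symmetric h' describes both results; its symmetry makes the relation stable under
    composition ([shifts_comp]). *)
Definition shifts (XL XR : P -> P) := forall h, swapsym h -> exists2 h', swapsym h' &
  XL ('X_[cmon N bL] * Psi (a * h)) = 'X_[cmon N bL] * Psi (a * h') /\
  XR ('X_[cmon N bR] * Psi h) = 'X_[cmon N bR] * Psi h'.

Lemma swapsymD (h1 h2 : P) : swapsym h1 -> swapsym h2 -> swapsym (h1 + h2).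
Proof. by move=> s1 s2 i j ij; rewrite linearD s1 // s2. Qed.

Lemma swapsymZ (b : C) (h : P) : swapsym h -> swapsym (b *: h).
Proof. by move=> s1 i j ij; rewrite linearZ s1. Qed.

Lemma shifts_ext XL XR YL YR : XL =1 YL -> XR =1 YR -> shifts XL XR -> shifts YL YR.
Proof.
by move=> eL eR sX h /sX [h' hs [e1 e2]]; exists h' => //; rewrite -eL -eR.
Qed.

Lemma shifts_lin (b : C) XL XR YL YR : shifts XL XR -> shifts YL YR ->
  shifts (fun f => b *: XL f + YL f) (fun f => b *: XR f + YR f).
Proof.
move=> sX sY h hs; have [h1 hs1 [e1 e2]] := sX h hs; have [h2 hs2 [e3 e4]] := sY h hs.
exists (b *: h1 + h2); first by apply: swapsymD => //; apply: swapsymZ.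
rewrite e1 e2 e3 e4; split; last by rewrite linearP mulrDr scalerAr.
by rewrite mulrDr -scalerAr linearP mulrDr scalerAr.
Qed.

Lemma shifts_comp XL XR YL YR : shifts XL XR -> shifts YL YR ->
  shifts (XL \o YL) (XR \o YR).
Proof.
move=> sX sY h hs; have [h2 hs2 [e3 e4]] := sY h hs; have [h1 hs1 [e1 e2]] := sX h2 hs2.
by exists h1 => //; split; rewrite /= ?e3 ?e4.
Qed.

Lemma shifts0 : shifts (fun=> 0) (fun=> 0).
Proof.
move=> h hs; exists 0; last by rewrite !mulr0 !raddf0 !mulr0.
by move=> i j ij; rewrite raddf0.
Qed.

Let zs := [seq wgt m kapR bR l | l <- iota 1 m.-1].

Let aPsi (b : nat) (F : 'I_N -> P) (x : C) :
  \sum_i x *: ('X_[cmon N b] * Psi (F i)) = 'X_[cmon N b] * Psi (x *: \sum_i F i).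
Proof. by rewrite -scaler_sumr -mulr_sumr -raddf_sum linearZ /= scalerAr. Qed.

Lemma ropsL h k : swapsym h ->
  \sum_i iter k (rmulA (kapL 0%N) i) (rops (kapL 0%N) i [seq wgt m kapL bL l | l <- iota 1 m.-1]
    (dunklA (kapL 0%N) i (a * h))) =
  a * \sum_i iter k (rmulA (kapR 0%N) i) (rops (kapR 0%N) i zs (dunklA (kapR 0%N) i h)).
Proof.
move=> hs; rewrite kap0 -sum_rops_skew //; apply: eq_bigr => i _; congr (iter _ _ _).
exact: rops_perm.
Qed.

Lemma shifts_psum : shifts (ML (psum C N m)) (MR (psum C N m)).
Proof.
move=> h hs; exists (m%:R ^+ m *: \sum_i rops (kapR 0%N) i zs (dunklA (kapR 0%N) i h)).
  by apply/swapsymZ/swapsym_sum_rops.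
rewrite !psum_T; split; last first.
  by rewrite -aPsi; apply: eq_bigr => i _; rewrite dunklMXn // iter_dunkl_m.
rewrite -scalerAr -(ropsL 0 hs) /= -aPsi; apply: eq_bigr => i _.
by rewrite dunklMXn // iter_dunkl_m.
Qed.

Definition wtop (kap : nat -> C) (b : nat) : C := b.+1%:R / m%:R + kapz m kap b.+1 - 1.

Let araiseE kap b (f : P) : (b < m)%N ->
  araise zeta kap (wtop kap b) ('X_[cmon N b] * Psi f) =
  'X_[cmon N b] * Psi (m%:R ^+ m.+1 *: \sum_i rmulA (kap 0%N) i (rops (kap 0%N) i
     [seq wgt m kap b l | l <- iota 1 m.-1] (dunklA (kap 0%N) i f))).
Proof.
move=> bm; rewrite /araise psum_T -aPsi scaler_sumr -sumrB; apply: eq_bigr => i _.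
rewrite dunklMXn // iter_dunkl_m // -scalerAr linearZ /= dunkl_raise -/(wtop kap b).
rewrite linearD /= [Psi (_ *: _)]linearZ /= exprS.
by rewrite -!mul_mpolyC; ring.
Qed.

Lemma shifts_araise :
  shifts (araise zeta kapL (wtop kapL bL)) (araise zeta kapR (wtop kapR bR)).
Proof.
move=> h hs.
exists (m%:R ^+ m.+1 *: \sum_i rmulA (kapR 0%N) i (rops (kapR 0%N) i zs (dunklA (kapR 0%N) i h))).
  (* The additional factor R_i is the entry 0 at the head of the list. *)
  apply: swapsymZ; have := swapsym_sum_rops (kapR 0%N) (0 :: zs) hs.
  by move=> s1; under eq_bigr => i _ do rewrite -[rmulA _ _ _]addr0 -[0](scale0r (rops (kapR 0%N) i zs (dunklA (kapR 0%N) i h))).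
by rewrite !araiseE //; split=> //; rewrite (ropsL 1 hs) scalerAr.
Qed.

(** By [araise_psum] the next power sum is a scalar multiple of a commutator of two operators
    already known to shift. *)
Lemma shifts_power_sum r : (0 < r)%N -> shifts (ML (psum C N (m * r))) (MR (psum C N (m * r))).
Proof.
elim: r => // r IH _; have [->|r0] := posnP r; first by rewrite muln1; exact: shifts_psum.
have sr := IH r0; have mr : ((m * r)%:R : C) != 0 by rewrite pnatr_eq0 -lt0n muln_gt0 m0.
have e kap w f : dunklM zeta kap (psum C N (m * r.+1)) f =
    (m * r)%:R^-1 *: dunklM zeta kap (psum C N (m * r)) (araise zeta kap w f) +
    ((- (m * r)%:R^-1) *: araise zeta kap w (dunklM zeta kap (psum C N (m * r)) f) + 0).
  rewrite araise_psum // addr0 scaleNr scalerDr addrAC subrr add0r scalerA mulVf // scale1r.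
  by [].
apply: (shifts_ext (fun f => esym (e _ (wtop kapL bL) f)) (fun f => esym (e _ (wtop kapR bR) f))).
apply: shifts_lin; first exact: shifts_comp sr shifts_araise.
apply: shifts_lin shifts0.
exact: shifts_comp shifts_araise sr.
Qed.

Theorem shifts_sym (f : P) : swapsym f -> shifts (ML (Psi f)) (MR (Psi f)).
Proof.
move=> fs; have := psalg_symmetric (swapsym_symmetric fs).
elim=> [c|r r0|f1 f2 _ h1 _ h2|f1 f2 _ h1 _ h2].
- rewrite powsubC => h hs; exists (c *: h); first exact: swapsymZ.
  by rewrite !dunklMC -scalerAr !linearZ /= !scalerAr.
- have -> : Psi (\sum_j 'X_j ^+ r) = psum C N (m * r).
    by rewrite raddf_sum; apply: eq_bigr => j _ /=; rewrite rmorphXn /= powsubX exprM.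
  exact: shifts_power_sum.
- have e kap g : 1 *: dunklM zeta kap (Psi f1) g + dunklM zeta kap (Psi f2) g =
      dunklM zeta kap (Psi (f1 + f2)) g.
    by rewrite scale1r raddfD /= dunklMDl.
  exact: shifts_ext (e _) (e _) (shifts_lin 1 h1 h2).
have e kap g : (dunklM zeta kap (Psi f1) \o dunklM zeta kap (Psi f2)) g =
    dunklM zeta kap (Psi (f1 * f2)) g.
  by rewrite rmorphM /= dunklM_mul.
exact: shifts_ext (e _) (e _) (shifts_comp h1 h2).
Qed.

End Shifts.

(** * The product of the Dunkl operators *)

Section Cherednik.
Variables (C : numFieldType) (N : nat).
Local Notation P := {mpoly C[N]}.
Implicit Types (c z : C) (s : seq 'I_N) (f g h : P).

(** The Cherednik operator of type A. Its reflections with j < i come from the variables not yet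
    lowered when T_i acts in the product ([dunkl_step]). *)
Definition cherU c (i : 'I_N) h : P := rmulA c i h - c *: \sum_(j < N | (j < i)%N) swap C i j h.

Lemma cherU_linear c i : linear (cherU c i).
Proof.
move=> b f g; rewrite /cherU linearP /=.
have -> : \sum_(j < N | (j < i)%N) swap C i j (b *: f + g) =
   b *: (\sum_(j < N | (j < i)%N) swap C i j f) + \sum_(j < N | (j < i)%N) swap C i j g.
  by rewrite scaler_sumr -big_split; apply: eq_bigr => j _ /=; rewrite linearP.
by rewrite -!mul_mpolyC; ring.
Qed.

Definition cherDelta c z s h : P := foldr (fun i g => cherU c i g + z *: g) h s.

(** Polynomial dependence on z allows [cherDelta_vander] to be checked at natural numbers only. *)
Lemma cherDelta_poly c s h (phi : P -> C) : linear_for *%R phi ->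
  exists q : {poly C}, forall z, phi (cherDelta c z s h) = q.[z].
Proof.
elim: s phi => [|i s IH] phi lphi /=.
  by exists (phi h)%:P => z; rewrite hornerC.
have phiD f g : phi (f + g) = phi f + phi g by have := lphi 1 f g; rewrite scale1r mul1r.
have phi0 : phi 0 = 0 by apply: (addrI (phi 0)); rewrite -phiD !addr0.
have phiZ b f : phi (b *: f) = b * phi f by have := lphi b f 0; rewrite phi0 !addr0.
have [q1 e1] := IH (phi \o cherU c i) (fun b f g => etrans (congr1 phi (cherU_linear c i b f g)) (lphi _ _ _)).
have [q2 e2] := IH phi lphi.
exists (q1 + 'X * q2) => z; rewrite phiD phiZ e2.
by have /= -> := e1 z; rewrite !hornerE.
Qed.

Definition chi c z : C := \prod_(i < N) (z + 1 + c * (N.-1 - i)%N%:R).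

Lemma card_lt_ord (i : 'I_N) : \sum_(j < N | (j < i)%N) 1 = i%:R :> C.
Proof.
by rewrite -(big_ord_widen N (fun=> 1 : C) (ltnW (ltn_ord i))) sumr_const card_ord.
Qed.

(** The N-1 divided differences of x_i each give 1, and the i reflections remove i of them. *)
Lemma cherU1 c i : cherU c i 1 = (1 + c * (N.-1 - i)%N%:R) *: (1 : P).
Proof.
have N0 : (0 < N)%N by apply: leq_ltn_trans (ltn_ord i).
rewrite /cherU /rmulA /= /rmul /mpX mulr1 dunklAE mderivX mnm1E eqxx.
rewrite (_ : (_ - _)%MM = 0%MM); last by apply/mnmP => k; rewrite mnmBE subnn mnm0E.
rewrite mpolyX0 scale1r (eq_bigr (fun=> 1)) => [|j ji]; last first.
  by apply: nabE; rewrite 1?eq_sym // mul1r [msym _ _]swapX tpermL.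
rewrite [\sum_(j < N | (j < i)%N) _](eq_bigr (fun=> 1)) => [|j _]; last exact: rmorph1.
have e1 : \sum_(j < N | j != i) 1 = (N.-1)%:R *: (1 : P).
  by rewrite sumr_const cardC1 card_ord scaler_nat.
have e2 : \sum_(j < N | (j < i)%N) 1 = i%:R *: (1 : P).
  by rewrite -card_lt_ord scaler_suml; apply: eq_bigr => j _; rewrite scale1r.
rewrite e1 e2 natrB; last by rewrite -ltnS prednK.
by rewrite -!mul_mpolyC; ring.
Qed.

Lemma cherDelta1 c z : cherDelta c z (enum 'I_N) 1 = chi c z *: 1.
Proof.
have h s : cherDelta c z s 1 = (\prod_(i <- s) (z + 1 + c * (N.-1 - i)%N%:R)) *: 1.
  elim: s => [|i s IH] /=; first by rewrite big_nil scale1r.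
  have lU b : cherU c i (b *: 1) = b *: cherU c i 1.
    have e0 : cherU c i 0 = 0 by have := cherU_linear c i (-1) 0 0; rewrite scaleN1r addNr scaleN1r addNr.
    by have := cherU_linear c i b 1 0; rewrite e0 !addr0.
  rewrite IH lU cherU1 big_cons !scalerA -scalerDl; congr (_ *: _); ring.
by rewrite h /chi big_enum.
Qed.

Lemma poly_eq_nat (q1 q2 : {poly C}) : (forall n : nat, q1.[n%:R] = q2.[n%:R]) -> q1 = q2.
Proof.
move=> h; apply: subr0_eq.
apply: (@roots_geq_poly_eq0 _ _ [seq n%:R | n <- iota 0 (size (q1 - q2))]).
- by apply/allP => _ /mapP [n _ ->]; rewrite rootE !hornerE h subrr.
- rewrite map_inj_uniq ?iota_uniq // => x y /eqP.
  by rewrite eqr_nat => /eqP.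
- by rewrite size_map size_iota.
Qed.

End Cherednik.

Section ProductT.
Variables (C : numFieldType) (m : nat) (zeta : primroot C m) (N : nat) (kap : nat -> C).
Local Notation P := {mpoly C[N]}.
Local Notation T := (@dunklT C m zeta kap N).
Local Notation Psi := (powsub m).
Local Notation MT := (@dunklM C m zeta kap N).
Local Notation c := (kap 0%N).
Let m0 : (0 < m)%N := primroot_gt0 zeta.
Let mR0 : (m%:R : C) != 0. Proof. by rewrite pnatr_eq0 -lt0n. Qed.

(** The exponents while the product of the T_i is applied: the operators of largest index act first,
    so the variables from k on are already lowered. *)
Definition stepmon (b k : nat) : 'X_{1..N} := [multinom if (k <= j)%N then b else b.+1 | j < N].

Lemma dunkl_step b (i : 'I_N) h :
  T i ('X_[stepmon b i.+1] * Psi h) =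
  m%:R *: ('X_[stepmon b i] * Psi (cherU c i h + wtop m kap b *: h)).
Proof.
have sE : 'X_[stepmon b i.+1] = 'X_i * 'X_[stepmon b i] :> P.
  rewrite -mpolyXD; congr 'X_[_]; apply/mnmP => j; rewrite !(mnmDE, mnmE, mnm1E).
  case: (i =P j) => [->|/eqP ij]; first by rewrite ltnn leqnn add1n.
  by rewrite add0n ltn_neqAle -val_eqE in ij *; rewrite ij.
apply: (mulfI (X_neq0 C i)).
rewrite dunkl_red //; first last.
- by move=> j; rewrite !mnmE; case: ifP; case: ifP; lia.
- by move=> j; rewrite !mnmE; case: ifP; case: ifP; lia.
rewrite -scalerAr mulrA -sE.
suff -> : red_op m kap (stepmon b i.+1) i h = cherU c i h + wtop m kap b *: h by [].
rewrite /red_op !mnmE ltnn /cherU /rmulA /= /rmul /mpX dunklAE mderivM mderivX mnm1E eqxx.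
rewrite (_ : (_ - _)%MM = 0%MM); last by apply/mnmP => k; rewrite mnmBE subnn mnm0E.
rewrite mpolyX0 scale1r mul1r.
have -> : \sum_(j | j != i) (if (b.+1 <= stepmon b i.+1 j)%N then 'X_i * nab i j h
    else nab i j ('X_i * h)) =
    \sum_(j | j != i) nab i j ('X_i * h) - \sum_(j < N | (j < i)%N) swap C i j h.
  have -> : \sum_(j < N | (j < i)%N) swap C i j h =
      \sum_(j < N | j != i) if (j < i)%N then swap C i j h else 0.
    rewrite -big_mkcondr; apply: eq_bigl => j; rewrite -val_eqE /=.
    by case: ltngtP.
  rewrite -sumrB; apply: eq_bigr => j ji; rewrite mnmE.
  have -> : (b.+1 <= (if (i < j)%N then b else b.+1))%N = (j < i)%N.
    case: (ltnP i j) => ij; first by rewrite ltnn ltnNge (ltnW ij).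
    by rewrite leqnn ltn_neqAle ij andbT; apply/esym; move: ji; rewrite -val_eqE.
  by case: ifP => _; rewrite ?subr0 // nab_mulX 1?eq_sym // addrK.
rewrite /wtop; move: (_ / _ + kapz _ _ _) => w.
by rewrite -!mul_mpolyC mpolyCB mpolyC1; ring.
Qed.

Lemma prod_T b h : MT 'X_[cmon N 1] ('X_[cmon N b.+1] * Psi h) =
  m%:R ^+ N *: ('X_[cmon N b] * Psi (cherDelta c (wtop m kap b) (enum 'I_N) h)).
Proof.
rewrite dunklM_X /dunkl_mon.
have main k : (k <= N)%N ->
    foldr (fun i g => iter (cmon N 1 i) (T i) g) ('X_[cmon N b.+1] * Psi h) (drop (N - k) (enum 'I_N)) =
    m%:R ^+ k *: ('X_[stepmon b (N - k)] *
       Psi (cherDelta c (wtop m kap b) (drop (N - k) (enum 'I_N)) h)).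
  elim: k => [_|k IH kN].
    rewrite subn0 drop_oversize ?size_enum_ord //= scale1r; congr ('X_[_] * _).
    by apply/mnmP => j; rewrite !mnmE leqNgt ltn_ord.
  have lt : (N - k.+1 < N)%N by lia.
  have e : drop (N - k.+1) (enum 'I_N) = Ordinal lt :: drop (N - k) (enum 'I_N).
    rewrite (drop_nth (Ordinal lt)) ?size_enum_ord //.
    rewrite [nth _ _ _](nth_ord_enum (Ordinal lt) (Ordinal lt)).
    by congr (_ :: drop _ _); lia.
  rewrite e /= IH 1?ltnW // mnmE /= linearZ /=.
  have -> : stepmon b (N - k) = stepmon b (Ordinal lt).+1 by congr stepmon; rewrite /=; lia.
  by rewrite dunkl_step scalerA -exprSr.
have := main N (leqnn N); rewrite subnn drop0 => ->.
by congr (_ *: ('X_[_] * _)); apply/mnmP => j; rewrite !mnmE.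
Qed.

Lemma prod_T_iter b n g (X : C -> C) :
  (forall z, cherDelta c z (enum 'I_N) g = X z *: g) ->
  MT ('X_[cmon N 1] ^+ n) ('X_[cmon N (b + n)] * Psi g) =
  (\prod_(l < n) (m%:R ^+ N * X (wtop m kap (b + l)))) *: ('X_[cmon N b] * Psi g).
Proof.
move=> hg; elim: n => [|n IH].
  by rewrite addn0 expr0 dunklM1 big_ord0 scale1r.
rewrite exprSr dunklM_mul addnS prod_T hg [Psi (_ *: _)]linearZ /= -scalerAr scalerA linearZ /= IH.
by rewrite big_ord_recr /= scalerA mulrC.
Qed.

End ProductT.

Section Vandermonde.
Variables (C : numFieldType) (N : nat).
Local Notation P := {mpoly C[N]}.
Local Notation a := (vander C N).

Lemma powsub1 (f : P) : powsub 1 f = f.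
Proof.
suff : (@powsub C N 1 : {lrmorphism P -> P}) =1 (idfun : {lrmorphism P -> P}) by exact.
by apply: mpoly_lrmorph_ext => l /=; rewrite powsubX expr1.
Qed.

Lemma swapsym_cmon n : swapsym ('X_[cmon N n] : P).
Proof.
move=> i j ij; rewrite /swap /= msymX; congr 'X_[_]; apply/mnmP => k.
by rewrite !mnmE.
Qed.

(* For integral z this is the shift of the operator D_0 ... D_{N-1} applied to
   powers of the product of the variables; both sides are polynomial in z. *)
Lemma cherDelta_vander (c z : C) :
  cherDelta c z (enum 'I_N) a = chi N (c + 1) z *: a.
Proof.
apply/mpolyP => mu.
have [q hq] : exists q : {poly C}, forall z, (cherDelta c z (enum 'I_N) a)@_mu = q.[z].
  by apply: cherDelta_poly => b f g; rewrite mcoeffD mcoeffZ.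
pose qc : {poly C} := (a@_mu)%:P * \prod_(i < N) ('X + (1 + (c + 1) * (N.-1 - i)%N%:R)%:P).
have hqc z' : (chi N (c + 1) z' *: a)@_mu = qc.[z'].
  rewrite mcoeffZ /qc hornerM hornerC mulrC horner_prod; congr (_ * _).
  by apply: eq_bigr => i _; rewrite hornerD hornerX hornerC addrA.
rewrite hq hqc; suff -> : q = qc by [].
apply: poly_eq_nat => n; rewrite -hq -hqc; congr mcoeff.
pose kL := (fun=> c) : nat -> C; pose kR := (fun=> c + 1) : nat -> C.
have wt d : wtop 1 (fun=> d) n = n%:R.
  by rewrite /wtop /kapz dvd1n addr0 divr1 -natr1 addrK.
(* At order 1 the lists of weights are empty. The symmetric polynomial x_1...x_N, applied to a
   (x_1...x_N)^(n+1) at c and to (x_1...x_N)^(n+1) at c + 1, yields the same h'; [prod_T] computes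
   both results independently with z = n. *)
have := @shifts_sym C 1 (one_root C) N kL kR 0 0 erefl isT isT (perm_refl _)
  'X_[cmon N 1] (swapsym_cmon 1) 'X_[cmon N n.+1] (swapsym_cmon _).
rewrite !powsub1 => -[h' _]; rewrite !powsub1.
have c0 : 'X_[cmon N 0] = 1 :> P by rewrite -mpolyX0; congr 'X_[_]; apply/mnmP => k; rewrite !mnmE.
rewrite c0 !mul1r => -[eL eR].
have pL := @prod_T C 1 (one_root C) N kL n a.
have pR := @prod_T C 1 (one_root C) N kR n 1.
rewrite !powsub1 wt expr1n scale1r in pL; rewrite !powsub1 wt expr1n scale1r mulr1 in pR.
have : 'X_[cmon N n] * cherDelta c n%:R (enum 'I_N) a = 'X_[cmon N n] * (chi N (c + 1) n%:R *: a).
  rewrite -pL ['X_[_] * a]mulrC eL -eR pR cherDelta1.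
  by rewrite -!mul_mpolyC; ring.
by apply: mulfI; apply/eqP => /(congr1 (mcoeff (cmon N n))) /eqP; rewrite mcoeffX mcoeff0 eqxx oner_eq0.
Qed.

End Vandermonde.

(** * The pairing of homogeneous components *)

Section LowDegree.
Variables (C : fieldType) (N : nat).
Local Notation P := {mpoly C[N]}.

Definition lowdeg (d : nat) (f : P) := forall mu, (mdeg mu < d)%N -> f@_mu = 0.

Lemma lowdeg_lin d b f g : lowdeg d f -> lowdeg d g -> lowdeg d (b *: f + g).
Proof. by move=> hf hg mu lt; rewrite mcoeffD mcoeffZ hf // hg // mulr0 addr0. Qed.

Lemma lowdeg0 d : lowdeg d 0.
Proof. by move=> mu _; rewrite mcoeff0. Qed.

Lemma lowdegD d f g : lowdeg d f -> lowdeg d g -> lowdeg d (f + g).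
Proof. by move=> hf hg; rewrite -[f]scale1r; apply: lowdeg_lin. Qed.

Lemma lowdegZ d b f : lowdeg d f -> lowdeg d (b *: f).
Proof. by move=> hf; rewrite -[_ *: _]addr0; apply: lowdeg_lin => //; apply: lowdeg0. Qed.

Lemma lowdeg_sum d (I : Type) (r : seq I) (Q : pred I) (F : I -> P) :
  (forall i, Q i -> lowdeg d (F i)) -> lowdeg d (\sum_(i <- r | Q i) F i).
Proof. by move=> hF; apply: big_ind => //; [exact: lowdeg0|exact: lowdegD]. Qed.

Lemma lowdegX mu : lowdeg (mdeg mu) 'X_[mu].
Proof.
move=> nu lt; rewrite mcoeffX; case: eqP => // e.
by rewrite e ltnn in lt.
Qed.

Lemma lowdeg_leq d e f : (e <= d)%N -> lowdeg d f -> lowdeg e f.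
Proof. by move=> ed hf mu lt; apply: hf; apply: leq_trans ed. Qed.

Lemma lowdegM d e f g : lowdeg d f -> lowdeg e g -> lowdeg (d + e) (f * g).
Proof.
move=> hf hg; rewrite mpolyME; apply: lowdeg_sum => -[a b] _ /=.
case: (ltnP (mdeg a) d) => ad; first by rewrite hf // mul0r scale0r; apply: lowdeg0.
case: (ltnP (mdeg b) e) => be; first by rewrite hg // mulr0 scale0r; apply: lowdeg0.
apply: lowdegZ; apply: lowdeg_leq (@lowdegX _).
by rewrite mdegD leq_add.
Qed.

Lemma lowdeg_gsub d b (w : 'S_N) f : lowdeg d f -> lowdeg d (gsub b w f).
Proof.
move=> hf; rewrite (mpolyE f) raddf_sum /= big_seq; apply: lowdeg_sum => mu mus.
rewrite linearZ /= gsub_mon scalerA msymX; apply: lowdegZ.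
apply: lowdeg_leq (@lowdegX _); rewrite mdeg_mperm leqNgt; apply/negP => lt.
by move: mus; rewrite mcoeff_msupp hf ?eqxx.
Qed.

Variables (m : nat) (zeta : primroot C m) (kap : nat -> C).

Lemma lowdeg_dunkl_com d i l f : lowdeg d f -> lowdeg d (dunkl_com zeta kap i l f).
Proof.
move=> hf; rewrite dunkl_com.unlock; case: ifP => _; last first.
  rewrite -scaleN1r; do 2 apply: lowdegZ; apply: lowdeg_sum => s _; apply: lowdegZ.
  by rewrite refl.unlock; apply: lowdeg_gsub.
apply: lowdegD; first apply: lowdegD => //.
  apply: lowdegZ; do 2 apply: lowdeg_sum => ? _.
  by rewrite refl.unlock; apply: lowdeg_gsub.
apply: lowdeg_sum => t _; apply: lowdegZ; apply: lowdeg_sum => s _; apply: lowdegZ.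
by rewrite dil.unlock; apply: lowdeg_gsub.
Qed.

(** The commutators of T_i with the variables never lower the order, so each monomial is handled by
    removing one variable at a time. *)
Lemma lowdeg_dunkl d i f : lowdeg d.+1 f -> lowdeg d (dunklT zeta kap i f).
Proof.
have mon n : forall mu, mdeg mu = n -> lowdeg n.-1 (dunklT zeta kap i 'X_[mu]).
  elim: n => [mu /eqP|n IH mu hmu].
    by rewrite mdeg_eq0 => /eqP ->; rewrite mpolyX0 -mpolyC1 dunklC; apply: lowdeg0.
  have [l ml] : exists l, mu l != 0%N.
    apply/existsP; apply: contraPT hmu; rewrite negb_exists => /forallP h.
    suff -> : mu = 0%MM by rewrite mdeg0.
    by apply/mnmP => j; rewrite mnm0E; apply/eqP; move: (h j); rewrite negbK.
  have e : mu = (U_(l) + (mu - U_(l)))%MM by rewrite addmC submK // lep1mP.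
  have dn : mdeg (mu - U_(l)) = n by move: hmu; rewrite {1}e mdegD mdeg1 add1n => -[].
  rewrite e mpolyXD dunkl_mulX /=; apply: lowdegD; last first.
    by apply: lowdeg_dunkl_com; rewrite -{1}dn; apply: lowdegX.
  case: n IH dn {hmu} => [|n] IH dn; first by move=> nu; rewrite ltn0.
  rewrite -add1n; apply: lowdegM (IH _ dn).
  by rewrite -(mdeg1 l); apply: lowdegX.
move=> hf; rewrite (mpolyE f) raddf_sum big_seq; apply: lowdeg_sum => mu mus /=.
rewrite linearZ /=; apply: lowdegZ; apply: lowdeg_leq (mon _ mu erefl).
rewrite -ltnS prednK; last first.
  rewrite lt0n; apply/eqP => mu0; move: mus; rewrite mcoeff_msupp hf ?eqxx //.
  by rewrite mu0.
rewrite leqNgt; apply/negP => lt; move: mus; rewrite mcoeff_msupp hf ?eqxx //.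
Qed.

Lemma dunklM_lowdeg D f g : f \is D.-homog -> lowdeg D.+1 g -> (dunklM zeta kap f g)@_0%MM = 0.
Proof.
move=> hf hg.
have mon n : forall mu d h, mdeg mu = n -> lowdeg (n + d) h -> lowdeg d (dunklM zeta kap 'X_[mu] h).
  elim: n => [mu d h /eqP|n IH mu d h hmu hh].
    by rewrite mdeg_eq0 => /eqP -> ; rewrite mpolyX0 dunklM1.
  have [l ml] : exists l, mu l != 0%N.
    apply/existsP; apply: contraPT hmu; rewrite negb_exists => /forallP h0.
    suff -> : mu = 0%MM by rewrite mdeg0.
    by apply/mnmP => j; rewrite mnm0E; apply/eqP; move: (h0 j); rewrite negbK.
  have e : mu = (U_(l) + (mu - U_(l)))%MM by rewrite addmC submK // lep1mP.
  have dn : mdeg (mu - U_(l)) = n by move: hmu; rewrite {1}e mdegD mdeg1 add1n => -[].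
  rewrite e mpolyXD dunklM_mulX; apply: lowdeg_dunkl; apply: IH => //.
  by rewrite addnS -addSn.
rewrite (mpolyE f) dunklM_suml raddf_sum big_seq big1 // => mu mus /=.
rewrite dunklMZl mcoeffZ (mon D mu 1%N) ?mulr0 ?mdeg0 //; last by rewrite addn1.
by have := dhomogP _ _ _ hf mu mus.
Qed.

End LowDegree.

Section MainGeneric.
Variables (C : numFieldType) (N m p q : nat) (zeta : primroot C m) (kapL kapR : nat -> C).
Local Notation eta := (primroot_val zeta).
Local Notation P := {mpoly C[N]}.
Local Notation Psi := (powsub m).
Local Notation a := (vander C N).
Local Notation ML := (@dunklM C m zeta kapL N).
Local Notation MR := (@dunklM C m zeta kapR N).
Local Notation kL := (kapz m kapL).
Local Notation kR := (kapz m kapR).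
Hypothesis N0 : (0 < N)%N.
Hypothesis mE : m = (p * q)%N.
Hypothesis kap0 : kapR 0%N = kapL 0%N + 1.
Hypothesis kL0 : forall t, (q %| t)%N -> kL t = 0.
Hypothesis kR0 : forall t, (q %| t)%N -> kR t = 0.
Hypothesis kRL : forall t, ~~ (q %| t)%N -> kR t = kL t + p%:R^-1.
Hypothesis kLq : forall t, kL (t + q)%N = kL t.

Let m0 : (0 < m)%N := primroot_gt0 zeta.
Let p0 : (0 < p)%N. Proof. by move: m0; rewrite mE muln_gt0 => /andP[]. Qed.
Let q0 : (0 < q)%N. Proof. by move: m0; rewrite mE muln_gt0 => /andP[]. Qed.

Definition pi0 : P := 'X_[cmon N (q - 1)] * Psi a.

Lemma cmonD b d : 'X_[cmon N (b + d)] = 'X_[cmon N b] * 'X_[cmon N d] :> P.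
Proof. by rewrite -mpolyXD; congr 'X_[_]; apply/mnmP => j; rewrite !(mnmDE, mnmE). Qed.

Lemma cmonX n : 'X_[cmon N n] = 'X_[cmon N 1] ^+ n :> P.
Proof.
elim: n => [|n IH]; last by rewrite exprS -IH -cmonD add1n.
by rewrite expr0 -mpolyX0; congr 'X_[_]; apply/mnmP => j; rewrite !mnmE.
Qed.

Let pi_cmon j h : pi0 * ('X_[cmon N (j * q)] * Psi h) =
  'X_[cmon N (j * q + q - 1)] * Psi (a * h).
Proof.
have -> : (j * q + q - 1 = (q - 1) + j * q)%N by lia.
by rewrite cmonD rmorphM /= /pi0; ring.
Qed.

(** In each block of q factors the first on the left pairs with the last on the right, where both
    kappa terms vanish. Factor l+1 on the left pairs with factor l on the right: the exponents
    differ by q, and q/m = 1/p makes up for the difference of the kappas. *)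
Lemma wtop_block (X : C -> C) j :
  \prod_(l < j * q) X (wtop m kapL ((q - 1) + l)) = \prod_(l < j * q) X (wtop m kapR (0 + l)).
Proof.
elim: j => [|j IH]; first by rewrite !mul0n !big_ord0.
have -> : (j.+1 * q = j * q + q)%N by rewrite mulSn addnC.
rewrite !big_split_ord /= IH; congr (_ * _).
have pR0 : (p%:R : C) != 0 by rewrite pnatr_eq0 -lt0n.
have qR0 : (q%:R : C) != 0 by rewrite pnatr_eq0 -lt0n.
case: q q0 qR0 kL0 kR0 kRL kLq mE => // q' _ qR0 hL hR hRL hLq hm.
rewrite big_ord_recl [RHS]big_ord_recr /= mulrC; congr (_ * _).
  apply: eq_bigr => l _; congr X; rewrite /wtop.
  have nd : ~~ (q'.+1 %| (0 + (j * q'.+1 + l)).+1)%N.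
    by rewrite add0n -addnS dvdn_addr ?dvdn_mull // gtnNdvd // ltnS.
  rewrite (hRL _ nd) /= /bump /=.
  have -> : ((q'.+1 - 1 + (j * q'.+1 + (1 + l))).+1 = (0 + (j * q'.+1 + l)).+1 + q'.+1)%N by lia.
  rewrite hLq natrD hm natrM; move: (q'.+1%:R) qR0 => u u0; field.
  by rewrite pR0 u0.
congr X; rewrite /wtop.
have -> : ((q'.+1 - 1 + (j * q'.+1 + 0)).+1 = (0 + (j * q'.+1 + q')).+1)%N by lia.
rewrite hL ?hR //; have -> : ((0 + (j * q'.+1 + q')).+1 = j.+1 * q'.+1)%N by lia.
- exact: dvdn_mull.
- exact: dvdn_mull.
Qed.

(** Weights are taken under the dilation of a single variable by eta. It need not belong to
    G(m,p,N), but the T_i are equivariant under all of G(m,1,N). The constant term is unchanged,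
    while f(T) g is multiplied by eta^(d-b). *)
Lemma dunklM_weight kap b d f g h1 h2 : (b < m)%N -> (d < m)%N -> b != d ->
  f = 'X_[cmon N b] * Psi h1 -> g = 'X_[cmon N d] * Psi h2 ->
  (dunklM zeta kap f g)@_0%MM = 0.
Proof.
move=> bm dm bd -> ->; set F := 'X_[cmon N b] * _; set G := 'X_[cmon N d] * _.
pose i0 := Ordinal N0.
have zm : eta ^+ m = 1 by exact: primroot_expm.
have zVm : eta^-1 ^+ m = 1 by rewrite exprVn zm invr1.
have coef0 (z : C) (f0 : P) : (dil z i0 f0)@_0%MM = f0@_0%MM.
  elim/mpoly_ind_mulX: f0 => [c|f1 f2 h h'|l f1 h].
  - by rewrite dilC.
  - by rewrite raddfD /= !mcoeffD h h'.
  by rewrite !rmorphM /= dilX mcoeffZ !mcoeffX mnm1_eq0 mulr0 !mul0r.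
have e : dil eta i0 (dunklM zeta kap F G) = eta^-1 ^+ b *: (eta ^+ d *: dunklM zeta kap F G).
  have -> : dil eta i0 (dunklM zeta kap F G) = dunklM zeta kap (dil eta^-1 i0 F) (dil eta i0 G).
    rewrite dil.unlock gsub_dunklM; last by move=> l; case: eqP; rewrite ?expr1n.
    congr dunklM; apply: eq_gsub => l; case: eqP => // _; exact: invr1.
  rewrite !dil_mon // !mnmE dunklMZl linearZ /=; exact: erefl.
have := congr1 (mcoeff 0%MM) e; rewrite coef0 !mcoeffZ => e0.
have : (eta ^+ b - eta ^+ d) * (dunklM zeta kap F G)@_0%MM = 0.
  have b0 : eta ^+ b != 0 by exact: primroot_neq0.
  move: e0; rewrite exprVn; move: (eta ^+ b) (eta ^+ d) (_@_0%MM) b0 => u v x u0 h.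
  by rewrite mulrBl {1}h; field.
move/eqP; rewrite mulf_eq0 subr_eq0 (eq_prim_root_expr (primrootP zeta)) !modn_small //.
by rewrite (negbTE bd) => /eqP.
Qed.

Lemma homog_prod2 (f g : P) : (exists d, f \is d.-homog) -> (exists d, g \is d.-homog) ->
  exists d, f * g \is d.-homog.
Proof. by move=> [d hf] [e hg]; exists (d + e)%N; apply: dhomogM. Qed.

Lemma pi0_homog : exists d, pi0 \is d.-homog.
Proof.
apply: homog_prod2; first by exists (mdeg (cmon N (q - 1))); rewrite dhomogX.
have one_h : exists d, (1 : P) \is d.-homog by exists 0%N; apply: dhomog1.
rewrite vander.unlock rmorph_prod.
apply: (big_ind (fun f : P => exists d, f \is d.-homog)) => //; first exact: homog_prod2.
move=> i _; rewrite rmorph_prod.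
apply: (big_ind (fun f : P => exists d, f \is d.-homog)) => //; first exact: homog_prod2.
move=> j _; exists m; rewrite rmorphB /= !powsubX !mpolyXn.
by rewrite rpredB // dhomogX /= mdegMn mdeg1 mul1n.
Qed.

Lemma mcoeff0_powsub (f : P) : (Psi f)@_0%MM = f@_0%MM.
Proof.
elim/mpoly_ind_mulX: f => [c|f g hf hg|l f _].
- by rewrite powsubC.
- by rewrite [Psi (_ + _)]raddfD /= !mcoeffD hf hg.
rewrite !rmorphM /= powsubX rmorphXn /= mcoeffX mnm1_eq0 expr0n.
by rewrite gtn_eqF // !mul0r.
Qed.

(** For i = j, letting Psi s act first produces the same t' on both sides, of which only the
    constant term survives for degree reasons. What is left are the norms of pi x^(jqv) and x^(jqv),
    compared through the product of the T_i. *)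
Lemma pairing_block i j s t : (i < p)%N -> (j < p)%N -> swapsym s -> swapsym t ->
  (ML (pi0 * ('X_[cmon N (i * q)] * Psi s)) (pi0 * ('X_[cmon N (j * q)] * Psi t)))@_0%MM =
  (ML pi0 pi0)@_0%MM * (MR ('X_[cmon N (i * q)] * Psi s) ('X_[cmon N (j * q)] * Psi t))@_0%MM.
Proof.
move=> ip jp ss st.
have bm l : (l < p)%N -> (l * q + q - 1 < m)%N by move=> lp; rewrite mE; nia.
have bm' l : (l < p)%N -> (l * q < m)%N by move=> lp; rewrite mE; nia.
have [ij|ij] := eqVneq i j; last first.
  rewrite (@dunklM_weight kapL (i * q + q - 1) (j * q + q - 1) _ _ (a * s) (a * t)) ?bm //.
  - rewrite (@dunklM_weight kapR (i * q) (j * q) _ _ s t) ?bm' ?mulr0 //.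
    by rewrite eqn_pmul2r.
  - by apply: contraNneq ij => e; apply/eqP; nia.
have [t' _ [eL eR]] := shifts_sym zeta kap0 (bm _ jp) (bm' _ jp)
  (wgt_shift mE q0 jp kL0 kR0 kRL kLq) ss st.
have [d pid] := pi0_homog.
have [e Xe] : exists e, ('X_[cmon N (j * q)] : P) \is e.-homog.
  by exists (mdeg (cmon N (j * q))); rewrite dhomogX.
have lowt : lowdeg 1 (t' - (t'@_0)%:MP).
  move=> mu; rewrite ltnS leqn0 mdeg_eq0 => /eqP ->.
  by rewrite mcoeffB mcoeffC eqxx mulr1 subrr.
have lowPsi : lowdeg 1 (Psi (t' - (t'@_0)%:MP)).
  move=> mu; rewrite ltnS leqn0 mdeg_eq0 => /eqP ->.
  by rewrite mcoeff0_powsub lowt // mdeg0.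
have homlow D F : F \is D.-homog -> lowdeg D F.
  move=> hF mu lt; apply/eqP; move/negP: (lt) => lt'; apply: contraT => nz.
  by move: lt; rewrite (dhomogP _ _ _ hF mu) ?ltnn // mcoeff_msupp.
(* F(T) lowers degrees by D, so the part of F Psi t' of order above D contributes no constant
   term. *)
have splitE kap F D : F \is D.-homog ->
    (dunklM zeta kap F (F * Psi t'))@_0%MM = t'@_0 * (dunklM zeta kap F F)@_0%MM.
  move=> hF; have {1}-> : t' = (t'@_0)%:MP + (t' - (t'@_0)%:MP) by rewrite addrC subrK.
  rewrite [Psi (_ + _)]raddfD /= powsubC mulrDr linearD /= mcoeffD.
  rewrite [X in _ + X](@dunklM_lowdeg _ _ _ _ _ D) ?addr0 //; last first.
    by rewrite -addn1; apply: lowdegM lowPsi; apply: homlow.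
  by rewrite mulrC mul_mpolyC linearZ mcoeffZ.
have piX : pi0 * 'X_[cmon N (j * q)] = 'X_[cmon N (j * q + q - 1)] * Psi a.
  by have := pi_cmon j 1; rewrite rmorph1 !mulr1.
have hL : (ML (pi0 * ('X_[cmon N (j * q)] * Psi s)) (pi0 * ('X_[cmon N (j * q)] * Psi t)))@_0%MM =
    t'@_0%MM * (ML (pi0 * 'X_[cmon N (j * q)]) (pi0 * 'X_[cmon N (j * q)]))@_0%MM.
  rewrite [pi0 * (_ * Psi s)]mulrA dunklM_mul pi_cmon eL.
  by rewrite rmorphM /= mulrA -piX (splitE _ _ _ (dhomogM pid Xe)).
have hR : (MR ('X_[cmon N (j * q)] * Psi s) ('X_[cmon N (j * q)] * Psi t))@_0%MM =
    t'@_0%MM * (MR 'X_[cmon N (j * q)] 'X_[cmon N (j * q)])@_0%MM.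
  by rewrite dunklM_mul eR (splitE _ _ _ Xe).
rewrite ij hL hR mulrCA; congr (_ * _).
have piX' : pi0 * 'X_[cmon N (j * q)] = 'X_[cmon N ((q - 1) + j * q)] * Psi a.
  by rewrite piX; congr ('X_[cmon N _] * _); lia.
(* The operator (T_1...T_N)^(jq) takes pi x^(jqv) to a multiple of pi at k, and x^(jqv) to a
   constant at k + 1. *)
have TL := prod_T_iter zeta (q - 1) (j * q) (cherDelta_vander N (kapL 0%N)).
have TR := prod_T_iter zeta 0 (j * q) (cherDelta1 N (kapR 0%N)).
rewrite -kap0 in TL; rewrite rmorph1 !mulr1 add0n (cmonX (j * q)) (cmonX 0) expr0 in TR.
rewrite dunklM_mul piX' cmonX TL linearZ /= mcoeffZ mulrC TR mcoeffZ.
rewrite -mpolyC1 mcoeffC eqxx mulr1 mulr1; congr (_ * _).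
exact: (wtop_block (fun z => m%:R ^+ N * chi N (kapR 0) z)).
Qed.

End MainGeneric.

(** * Homogeneous components of the invariants *)

Section Decomposition.
Variables (C : numFieldType) (N m p q : nat).
Local Notation P := {mpoly C[N]}.
Local Notation Psi := (powsub m).
Hypothesis N0 : (0 < N)%N.
Hypothesis m0 : (0 < m)%N.
Hypothesis mE : m = (p * q)%N.

(** Invariance expressed through coefficients only, a form visibly preserved when they are
    conjugated ([map_inv_coeffs]). *)
Definition inv_coeffs (f : P) :=
  (forall mu, f@_mu != 0 -> (forall i j, mu i = mu j %[mod m]) /\ (forall i, q %| mu i)%N) /\
  (forall (w : 'S_N) (mu : 'X_{1..N}), f@_[multinom mu (w i) | i < N] = f@_mu).

Definition qmon (mu : 'X_{1..N}) (j : nat) := [multinom (m * mu i + j * q)%N | i < N].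
Definition qdiv (mu : 'X_{1..N}) := [multinom (mu i %/ m)%N | i < N].

Definition qpart (f : P) (j : nat) : P :=
  \sum_(mu <- msupp f | mu == qmon (qdiv mu) j) f@_mu *: 'X_[qdiv mu].

Lemma qdivK mu j : (j < p)%N -> qdiv (qmon mu j) = mu.
Proof.
move=> jp; apply/mnmP => i; rewrite !mnmE mulnC divnMDl // divn_small ?addn0 //.
by rewrite mE ltn_pmul2r //; move: m0; rewrite mE muln_gt0 => /andP[].
Qed.

Lemma mcoeff_qpart f j nu : (j < p)%N -> (qpart f j)@_nu = f@_(qmon nu j).
Proof.
move=> jp; rewrite [in RHS](mpolyE f) !raddf_sum /= big_mkcond /=; apply: eq_bigr => mu _.
rewrite !mcoeffZ !mcoeffX; have [->|ne] := eqVneq mu (qmon nu j).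
  by rewrite qdivK // !eqxx.
rewrite mulr0; case: eqP => // e; case: eqP => [e'|]; last by rewrite mulr0.
by case/eqP: ne; rewrite e e'.
Qed.

Lemma swapsym_qpart f j : (j < p)%N -> inv_coeffs f -> swapsym (qpart f j).
Proof.
move=> jp [_ h] i l _; apply/mpolyP => mu; rewrite mcoeff_sym !mcoeff_qpart //.
rewrite -[RHS](h (tperm i l)); congr (_@_ _).
by apply/mnmP => k; rewrite !mnmE.
Qed.

Lemma powsub_mon (mu : 'X_{1..N}) : Psi 'X_[mu] = 'X_[[multinom (m * mu i)%N | i < N]] :> P.
Proof.
rewrite !mpolyXE_id rmorph_prod; apply: eq_bigr => i _.
by rewrite rmorphXn /= powsubX mnmE exprM.
Qed.

Lemma qpart_decomposition f : inv_coeffs f ->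
  f = \sum_(j < p) 'X_[cmon N (j * q)] * Psi (qpart f j).
Proof.
move=> [h _]; rewrite {1}(mpolyE f).
under [RHS]eq_bigr => j _ do rewrite raddf_sum mulr_sumr big_mkcond /=.
rewrite exchange_big /= !big_seq; apply: eq_bigr => mu; rewrite mcoeff_msupp => /h [h1 h2].
have q0 : (0 < q)%N by move: m0; rewrite mE muln_gt0 => /andP[].
pose i0 := Ordinal N0.
have jp : (mu i0 %% m %/ q < p)%N by rewrite ltn_divLR // -mE ltn_mod.
have e i : (mu i %% m = (mu i0 %% m %/ q) * q)%N.
  by rewrite (h1 i i0) divnK // /dvdn mE modn_dvdm ?dvdn_mull //; exact: h2.
have e' : mu = qmon (qdiv mu) (mu i0 %% m %/ q).
  by apply/mnmP => i; rewrite !mnmE -(e i) mulnC -divn_eq.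
rewrite (bigD1 (Ordinal jp)) //= -e' eqxx [X in _ + X]big1 => [|j jn]; last first.
  case: eqP => // e2; case/eqP: jn; apply/val_inj => /=.
  move/mnmP: (e2) => /(_ i0); rewrite {1}e' !mnmE => /eqP.
  by rewrite eqn_add2l eqn_pmul2r // => /eqP.
rewrite addr0 linearZ /= -scalerAr powsub_mon -mpolyXD; congr (_ *: 'X_[_]).
by rewrite {1}e'; apply/mnmP => i; rewrite !mnmE addnC.
Qed.

Lemma map_inv_coeffs (sg : {rmorphism C -> C}) f : inv_coeffs f -> inv_coeffs (map_mpoly sg f).
Proof.
move=> [h1 h2]; split=> [mu|w mu]; rewrite !mcoeff_map_mpoly; last by rewrite h2.
by rewrite fmorph_eq0; apply: h1.
Qed.

End Decomposition.

(** Two kinds of diagonal matrices suffice: eta and its inverse in two places give the congruences,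
    and eta^p in one place, whose q-th power is eta^m = 1, gives divisibility by q. *)
Lemma inv_coeffs_gsub (C : numFieldType) (N m p q : nat) (zeta : primroot C m) (f : {mpoly C[N]}) :
  m = (p * q)%N ->
  (forall (b : 'I_N -> C) (w : 'S_N), (forall i, b i ^+ m = 1) -> (\prod_i b i) ^+ q = 1 ->
    gsub b w f = f) -> inv_coeffs m q f.
Proof.
move=> mE inv; have m0 := primroot_gt0 zeta.
have coef (b : 'I_N -> C) mu : (forall i, b i ^+ m = 1) -> (\prod_i b i) ^+ q = 1 ->
    f@_mu != 0 -> \prod_i b i ^+ mu i = 1.
  move=> b1 b2 nz; have := congr1 (mcoeff mu) (inv b 1%g b1 b2).
  rewrite {1}(mpolyE f) !raddf_sum /=.
  under eq_bigr => nu _ do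
    rewrite linearZ /= gsub_mon msym1m scalerA mcoeffZ mcoeffX.
  rewrite (bigD1_seq mu) ?msupp_uniq ?mcoeff_msupp //= eqxx mulr1 [X in _ + X = _]big1 => [|nu ne]; last first.
    by rewrite (negbTE ne) mulr0.
  by rewrite addr0 -[RHS]mulr1 => /(mulfI nz).
split=> [mu nz|w mu]; last first.
  have := congr1 (mcoeff mu) (inv (fun=> 1) w (fun=> expr1n _ _) _).
  by rewrite -msym_gsub mcoeff_sym; apply; rewrite prodr_const !expr1n.
split=> [i j|i].
  have [-> //|ij] := eqVneq i j.
  apply/eqP; rewrite -(eq_prim_root_expr (primrootP zeta)); apply/eqP.
  have z0 : primroot_val zeta != 0 := primroot_neq0 zeta 1.
  pose b l := if l == i then primroot_val zeta else if l == j then (primroot_val zeta)^-1 else 1.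
  have prodE (F : 'I_N -> nat) : \prod_l b l ^+ F l = primroot_val zeta ^+ F i * (primroot_val zeta)^-1 ^+ F j.
    rewrite (bigD1 i) //= (bigD1 j) 1?eq_sym //= /b !eqxx eq_sym (negbTE ij).
    rewrite big1 ?mulr1 // => l /andP[/negbTE -> /negbTE ->]; exact: expr1n.
  have := coef b mu _ _ nz; rewrite prodE exprVn => h.
  apply: (mulIf (_ : (primroot_val zeta ^+ mu j)^-1 != 0)).
    by rewrite invr_eq0 primroot_neq0.
  rewrite mulfV ?primroot_neq0 //; apply: h.
    move=> l; rewrite /b; case: eqP => _; last case: eqP => _.
    - exact: primroot_expm.
    - by rewrite exprVn primroot_expm invr1.
    - exact: expr1n.
  have := prodE (fun=> 1%N); under eq_bigr => l _ do rewrite expr1.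
  by move=> ->; rewrite !expr1 mulfV // expr1n.
pose b l := if l == i then primroot_val zeta ^+ p else 1.
have p0 : (0 < p)%N by move: m0; rewrite mE muln_gt0 => /andP[].
have prodE (F : 'I_N -> nat) : \prod_l b l ^+ F l = primroot_val zeta ^+ (p * F i).
  rewrite (bigD1 i) //= /b eqxx exprM big1 ?mulr1 // => l /negbTE ->; exact: expr1n.
have := coef b mu _ _ nz; rewrite prodE => h.
rewrite -(dvdn_pmul2l p0) -mE (prim_order_dvd (primrootP zeta)); apply/eqP; apply: h.
  by move=> l; rewrite /b; case: eqP => _; rewrite ?expr1n // exprAC primroot_expm expr1n.
have := prodE (fun=> 1%N); under eq_bigr => l _ do rewrite expr1.
by move=> ->; rewrite muln1 -exprM -mE primroot_expm.
Qed.

Lemma dunkl_pairing_shift (C : numFieldType) (N m p q : nat) (zeta : primroot C m) (kapL kapR : nat -> C)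
    (f g : {mpoly C[N]}) : (0 < N)%N -> m = (p * q)%N ->
  kapR 0%N = kapL 0%N + 1 ->
  (forall t, (q %| t)%N -> kapz m kapL t = 0) -> (forall t, (q %| t)%N -> kapz m kapR t = 0) ->
  (forall t, ~~ (q %| t)%N -> kapz m kapR t = kapz m kapL t + p%:R^-1) ->
  (forall t, kapz m kapL (t + q)%N = kapz m kapL t) ->
  inv_coeffs m q f -> inv_coeffs m q g ->
  (dunklM zeta kapL (pi0 C N m q * f) (pi0 C N m q * g))@_0%MM =
  (dunklM zeta kapL (pi0 C N m q) (pi0 C N m q))@_0%MM * (dunklM zeta kapR f g)@_0%MM.
Proof.
move=> N0 mE kap0 kL0 kR0 kRL kLq hf hg; have m0 := primroot_gt0 zeta.
have ss (j : 'I_p) := swapsym_qpart m0 mE (ltn_ord j) hf.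
have st (j : 'I_p) := swapsym_qpart m0 mE (ltn_ord j) hg.
rewrite (qpart_decomposition N0 m0 mE hf) (qpart_decomposition N0 m0 mE hg).
move: (qpart m q f) (qpart m q g) ss st => s t ss st {hf hg}.
rewrite !mulr_sumr !dunklM_suml !raddf_sum mulr_sumr; apply: eq_bigr => i _ /=.
rewrite !raddf_sum mulr_sumr; apply: eq_bigr => j _ /=.
exact: (pairing_block zeta N0 mE kap0 kL0 kR0 kRL kLq).
Qed.

Lemma pi0E (C : numFieldType) (N m q : nat) : pi0 C N m q =
  (\prod_(i < N) 'X_i) ^+ (q - 1) * \prod_(i < N) \prod_(j < N | (i < j)%N) ('X_i ^+ m - 'X_j ^+ m).
Proof.
have x1 : 'X_[cmon N 1] = \prod_(i < N) 'X_i :> {mpoly C[N]}.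
  by rewrite mpolyXE_id; apply: eq_bigr => i _; rewrite mnmE expr1.
rewrite /pi0 cmonX x1 vander.unlock rmorph_prod; congr (_ * _); apply: eq_bigr => i _.
by rewrite rmorph_prod; apply: eq_bigr => j _; rewrite rmorphB /= !powsubX.
Qed.

Lemma map_pi0 (C : numFieldType) (N m q : nat) (sg : {rmorphism C -> C}) :
  map_mpoly sg (pi0 C N m q) = pi0 C N m q.
Proof.
rewrite pi0E rmorphM rmorphXn !rmorph_prod.
under eq_bigr => i _ do rewrite /= map_mpolyX.
congr (_ * _); apply: eq_bigr => i _; rewrite rmorph_prod; apply: eq_bigr => j _.
by rewrite rmorphB !rmorphXn /= !map_mpolyX.
Qed.

(** Column j of the matrix must carry [b j] in row [w j]. Since [in_G] describes matrices by rows,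
    the inverse permutation appears. *)
Lemma gsub_matrix (C : comRingType) (N : nat) (b : 'I_N -> C) (w : 'S_N) (f : {mpoly C[N]}) :
  gsub b w f = f \mPo [tuple \sum_(i < N)
    (\matrix_(i, j) (if j == w^-1%g i then b (w^-1%g i) else 0) : 'M_N) i j *: 'X_i | j < N].
Proof.
rewrite gsub.unlock; congr (_ \mPo _).
apply: eq_from_tnth => j; rewrite !tnth_mktuple (bigD1 (w j)) //= mxE permK eqxx.
rewrite big1 ?addr0 // => i ne; rewrite mxE; case: eqP => [e|_]; last exact: scale0r.
by move: ne; rewrite e permKV eqxx.
Qed.

(** * From the definitions of the statement to the operators over a general field *)

Section Bridge.
Variables (R : realType) (m N : nat) (m0 : (0 < m)%N).
Local Notation zeta := (Primroot (eta_prim R m0)).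
Local Notation eta := (Defs.eta R m).
Local Notation P := {mpoly R[i][N]}.

Lemma tau_gsub (s : int) (i : 'I_N) (f : P) :
  tau m s i f = gsub (fun l => if l == i then eta ^ s else 1) 1%g f.
Proof.
rewrite [in RHS](mpolyE f) raddf_sum /tau /=; apply: eq_bigr => mu _.
rewrite linearZ /= gsub_mon msym1m scalerA mulrC; congr (_ * _ *: _).
rewrite (bigD1 i) //= eqxx big1 ?mulr1 => [|l /negbTE ->]; last exact: expr1n.
by rewrite exprnP exprz_exp.
Qed.

Lemma tau_dil (s : nat) (i : 'I_N) (f : P) : tau m s%:Z i f = dil (eta ^+ s) i f.
Proof. by rewrite tau_gsub dil.unlock exprnP. Qed.

Lemma tau_refl (s : nat) (i j : 'I_N) (f : P) : i != j ->
  tau m (- s%:Z) i (msym (tperm i j) (tau m s%:Z i f)) = refl (eta ^+ s) i j f.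
Proof.
move=> ij; rewrite !tau_gsub msym_gsub -exprnP -exprnN refl.unlock !gsub_comp.
rewrite mul1g mulg1; apply: eq_gsub => l; rewrite mul1r perm1.
case: tpermP => [->|->|/eqP/negbTE li /eqP/negbTE lj].
- by rewrite eqxx eq_sym (negbTE ij) mulr1.
- by rewrite eqxx eq_sym (negbTE ij) eqxx mul1r.
- by rewrite li lj mulr1.
Qed.

Lemma dunkl_dunklT (kap : nat -> R[i]) (i : 'I_N) (f : P) : dunkl m kap i f = dunklT zeta kap i f.
Proof.
rewrite dunklTE /dunkl; apply: (congr2 (fun u v => f^`M(i) + kap 0%N *: u + v)).
  apply: eq_bigr => j ji; apply: eq_bigr => s _.
  by rewrite tau_refl 1?eq_sym // ddiff.unlock.
apply: eq_bigr => t _; congr (_ *: _); rewrite dilquo.unlock; apply: (congr1 (fun u => mquo u _)).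
apply: eq_bigr => s _; rewrite tau_dil; congr (_ *: _).
by rewrite -exprnN exprM.
Qed.

Lemma pairing_dunklM p k (f g : P) :
  pairing m p k f g = (dunklM zeta (kappa m p k) (map_mpoly Num.conj f) g)@_0%MM.
Proof.
have ev (h : P) : h.@[fun=> 0] = h@_0%MM.
  elim/mpoly_ind_mulX: h => [c|h1 h2 e1 e2|l h _].
  - by rewrite mevalC mcoeffC eqxx mulr1.
  - by rewrite mevalD mcoeffD e1 e2.
  by rewrite mevalM mevalXU !rmorphM /= mcoeffX mnm1_eq0 !mul0r.
rewrite /pairing ev dunklM.unlock /subst_op /subst_mpoly; congr (_@_ _).
apply: eq_bigr => mu _; congr (_ *: _).
elim: (enum _) => //= i s ->; elim: (mu i) => //= n ->; exact: dunkl_dunklT.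
Qed.

Lemma piG_pi0 p : piG R m p N = pi0 _ N m (m %/ p).
Proof. by rewrite pi0E. Qed.

Lemma G_invariant_coeffs p (f : P) : (p %| m)%N -> G_invariant m p f -> inv_coeffs m (m %/ p) f.
Proof.
move=> pm inv; apply: (inv_coeffs_gsub (p := p) zeta); first by rewrite mulnC divnK.
move=> b w b1 b2.
have hg : in_G m p (\matrix_(i, j) (if j == w^-1%g i then b (w^-1%g i) else 0)).
  have prodE : \prod_i b (w^-1%g i) = \prod_i b i by rewrite [RHS](reindex_inj (@perm_inj _ w^-1%g)).
  exists w^-1%g, (fun i => b (w^-1%g i)); split; [by move=> i; exact: b1 | by rewrite prodE | exact: erefl].
by rewrite gsub_matrix; exact: inv _ hg.
Qed.

End Bridge.

Lemma kapz_kappa (R : realType) m p q (k : multiplicity R) t : m = (p * q)%N -> (0 < m)%N ->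
  kapz m (kappa m p k) t = if (q %| t)%N then 0 else kC1 k (t %% q)%N / p%:R.
Proof.
move=> mE m0; have p0 : (0 < p)%N by move: m0; rewrite mE muln_gt0 => /andP[].
have qE : (m %/ p = q)%N by rewrite mE mulKn.
have qm : (q %| m)%N by rewrite mE dvdn_mull.
rewrite /kapz /kappa qE; case: ifP => mt; first by rewrite (dvdn_trans qm mt).
have -> : (t %% m == 0)%N = false by exact: mt.
by rewrite {1}/dvdn !modn_dvdm.
Qed.

Theorem corollary3p27 (R : realType) (m p N : nat) (k : multiplicity R)
    (hN : (0 < N)%N) (hm : (2 <= m)%N) (hp : (p %| m)%N)
    (hN1 : N = 1%N -> p = 1%N)
    (f g : {mpoly R[i][N]}) (hf : G_invariant m p f) (hg : G_invariant m p g) :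
  pairing m p k (piG R m p N * f) (piG R m p N * g) =
  pairing m p k (piG R m p N) (piG R m p N) * pairing m p (mult_add1 k) f g.
Proof.
have m0 : (0 < m)%N by exact: ltnW.
have mE : m = (p * (m %/ p))%N by rewrite mulnC divnK.
(* The pairing conjugates its first argument: pi has integer coefficients, and the conjugate of f
   still satisfies [inv_coeffs]. *)
rewrite !(pairing_dunklM m0) !piG_pi0 rmorphM /= !map_pi0.
apply: (dunkl_pairing_shift (p := p)) => //.
- by move=> t qt; rewrite (kapz_kappa _ _ mE m0) qt.
- by move=> t qt; rewrite (kapz_kappa _ _ mE m0) qt.
- move=> t /negbTE qt; rewrite !(kapz_kappa _ _ mE m0) qt /=.
  by rewrite mulrDl mul1r.
- move=> t; rewrite !(kapz_kappa _ _ mE m0) dvdn_addl // modnDr //.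
- by apply: map_inv_coeffs; apply: G_invariant_coeffs.
- exact: G_invariant_coeffs.
Qed.
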